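(* Let $1\le N\le4$, let $\phi$ be a fixed reference function as in the context, assume in addition that $\nabla\phi\in L^{\frac N{N-1}}(\mathbb{R}^N)$ if $N=3,4$, and let $W$ be a real-valued even distribution on $\mathbb{R}^N$ satisfying condition $(\mathcal{W}_N)$ (defined in the context) and at least one of the following: (a) $N\ge 2$ and $W$ is positive definite; (b) $W\in\mathcal{M}_{1,1}(\mathbb{R}^N)$ and $W$ is a positive distribution; (c) $\operatorname{ess\,inf}\widehat W\ge\sigma$ for some $\sigma>0$. Suppose that $u_0\in\phi+H^1(\mathbb{R}^N)$ has finite generalized mass. Then the generalized mass of the associated global solution $u$ of (NGP) is conserved by the flow, i.e. $u(t)$ has a generalized mass and $m(u(t))=m(u_0)$ for every $t\in\mathbb{R}$.
   Context: $\mathcal{M}_{p,q}(\mathbb{R}^N)$ is the set of tempered distributions $W$ such that $f\mapsto W*f$ is bounded from $L^p(\mathbb{R}^N)$ to $L^q(\mathbb{R}^N)$; $W*f$ denotes the corresponding continuous extension. If $W\in\mathcal{M}_{2,2}$ then $\widehat W\in L^\infty$. Condition $(\mathcal{W}_N)$: there exist $p_1,p_2,p_3,p_4,q_1,q_2,q_3,q_4,s_1,s_2\in[1,\infty)$ such that - if $N\ge 3$: $p_4<\frac{N}{N-2}$, $\ 2\le p_2,p_3,s_1,s_2<\frac{2N}{N-2}$, $\ \frac{2N}{N+2}<q_1\le 2$, $\ q_3,q_4>\frac N2$; - if $N\in\{1,2\}$: $p_2,p_3,s_1,s_2\ge 2$ and $1<q_1\le 2$; - $W\in\mathcal{M}_{2,2}(\mathbb{R}^N)\cap\bigcap_{i=1}^4\mathcal{M}_{p_i,q_i}(\mathbb{R}^N)$;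 - $\frac1{p_3}+\frac1{q_2}=\frac1{q_1}$, $\ \frac1{p_1}-\frac1{p_3}=\frac1{s_1}$, $\ \frac1{q_1}-\frac1{q_3}=\frac1{s_2}$. Real-valued distribution $W$: even if $\langle W,\varphi\rangle=\langle W,\widetilde\varphi\rangle$ for all $\varphi\in C_0^\infty(\mathbb{R}^N;\mathbb{R})$, where $\widetilde\varphi(x)=\varphi(-x)$; positive if $\langle W,\varphi\rangle\ge 0$ for all $\varphi\in C_0^\infty(\mathbb{R}^N;\mathbb{R})$, $\varphi\ge 0$; positive definite if $\langle W,\varphi*\widetilde\varphi\rangle\ge0$ for all $\varphi\in C_0^\infty(\mathbb{R}^N;\mathbb{R})$. Reference function: $\phi:\mathbb{R}^N\to\mathbb{C}$ satisfies $\phi\in W^{1,\infty}(\mathbb{R}^N)$, $\nabla\phi\in H^2(\mathbb{R}^N)\cap C(B^c)$, $|\phi|^2-1\in L^2(\mathbb{R}^N)$, where $B^c$ is the complement of some ball $B\subseteq\mathbb{R}^N$. (NGP): $i\partial_t u+\Delta u+u\,(W*(1-|u|^2))=0$ on $\mathbb{R}^N\times\mathbb{R}$, $u(0)=u_0$. If $W$ is a real-valued even distribution on $\mathbb{R}^N$ satisfying condition $(\mathcal{W}_N)$ and at least one of: (a) $N\ge 2$ and $W$ is positive definite; (b) $W\in\mathcal{M}_{1,1}(\mathbb{R}^N)$ and $W$ is a positive distribution; (c) $\operatorname{ess\,inf}\widehat W\ge\sigma$ for some $\sigma>0$; then for every $u_0\in\phi+H^1(\mathbb{R}^N)$ it is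 known that there exists a unique global solution $u$ with $u-\phi\in C(\mathbb{R},H^1(\mathbb{R}^N))\cap C^1(\mathbb{R},H^{-1}(\mathbb{R}^N))$, the equation for $w=u-\phi$ holding in $H^{-1}(\mathbb{R}^N)$. Generalized mass. Fix $\chi\in C_0^\infty(\mathbb{R};\mathbb{R})$ with $\chi(x)=1$ if $|x|\le1$, $\chi(x)=0$ if $|x|\ge2$, and $\|\chi'\|_{L^\infty},\|\chi''\|_{L^\infty}\le2$. For $R>0$, $a\in\mathbb{R}^N$ put $\chi_{a,R}(x)=\chi(|x-a|/R)$, and $$m^+(u)=\inf_{a\in\mathbb{R}^N}\limsup_{R\to\infty}\int_{\mathbb{R}^N}(1-|u|^2)\chi_{a,R}\,dx,\qquad m^-(u)=\sup_{a\in\mathbb{R}^N}\liminf_{R\to\infty}\int_{\mathbb{R}^N}(1-|u|^2)\chi_{a,R}\,dx .$$ If $m^+(u)=m^-(u)$, the generalized mass of $u$ is $m(u):=m^+(u)=m^-(u)$.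
   Formalization: No smooth cutoff χ equal to 1 for |x|≤1 and 0 for |x|≥2 satisfies ‖χ''‖≤2 (it would give χ(3/2)≥3/4 and χ(3/2)≤1/4); the bound 2 on ‖χ'‖ and ‖χ''‖ is replaced by an arbitrary constant K, so every such smooth cutoff is covered. *)

(* Defs.v *)
From HB Require Import structures.
From mathcomp Require Import all_boot all_order all_algebra.
From mathcomp Require Import complex.
From mathcomp Require Import all_classical all_reals all_analysis.
From mathcomp Require Import ess_sup_inf.

Set Implicit Arguments.
Unset Strict Implicit.
Unset Printing Implicit Defensive.
Import Order.TTheory GRing.Theory Num.Theory.
Import numFieldNormedType.Exports.

Local Open Scope classical_set_scope.
Local Open Scope ring_scope.

Definition rV_display : measure_display.
Proof. exact: (default_measure_display). Qed.

Section rV_measurable.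
Context {R : realType} {n : nat}.

(* Cylinders over the coordinates; they generate the Borel sets of R^n. *)
Definition rV_cylinders : set (set 'rV[R]_n) :=
  [set A | exists (i : 'I_n) (B : set (measurableTypeR R)),
     measurable B /\ A = (fun x : 'rV[R]_n => x ord0 i) @^-1` B].

Let rV_set0 : <<s rV_cylinders >> set0.
Proof. exact: sigma_algebra0. Qed.

Let rV_setC A : <<s rV_cylinders >> A -> <<s rV_cylinders >> (~` A).
Proof. exact: sigma_algebraC. Qed.

Let rV_bigcup (F : (set 'rV[R]_n)^nat) :
  (forall i, <<s rV_cylinders >> (F i)) -> <<s rV_cylinders >> (\bigcup_i (F i)).
Proof. exact: sigma_algebra_bigcup. Qed.

HB.instance Definition _ := @isMeasurable.Build rV_display 'rV[R]_n
  <<s rV_cylinders >> rV_set0 rV_setC rV_bigcup.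

Lemma measurable_rV_coord (i : 'I_n) :
  measurable_fun setT (fun x : 'rV[R]_n => x ord0 i : measurableTypeR R).
Proof.
by move=> _ B mB; rewrite setTI; apply: sub_sigma_algebra; exists i, B.
Qed.

Lemma measurable_fun_rV d (T : measurableType d) (f : T -> 'rV[R]_n) :
  (forall i, measurable_fun setT (fun x => f x ord0 i : measurableTypeR R)) ->
  measurable_fun setT f.
Proof.
move=> mf; apply: (@measurability _ _ _ _ setT f rV_cylinders) => //.
move=> _ [_ [i [B [mB ->]] <-]].
by have := mf i measurableT _ mB.
Qed.

End rV_measurable.

Section Lebesgue.
Context {R : realType}.

Definition rV_cons n (p : measurableTypeR R * 'rV[R]_n) : 'rV[R]_n.+1 :=
  \row_j (if unlift ord0 j is Some i then p.2 ord0 i else p.1).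

Definition rV_uncons n (x : 'rV[R]_n.+1) : measurableTypeR R * 'rV[R]_n :=
  (x ord0 ord0, \row_i x ord0 (lift ord0 i)).

Lemma rV_consK n : cancel (@rV_cons n) (@rV_uncons n).
Proof.
move=> [a v]; rewrite /rV_uncons mxE unlift_none /=; congr pair.
by apply/rowP => i; rewrite !mxE liftK.
Qed.

Lemma measurable_rV_cons n : measurable_fun setT (@rV_cons n).
Proof.
apply: measurable_fun_rV => i.
have [j ->|->] := unliftP ord0 i.
  rewrite (_ : (fun _ => _) =
    (fun x : 'rV[R]_n => x ord0 j : measurableTypeR R) \o snd).
    by apply: measurableT_comp; [exact: measurable_rV_coord|].
  by apply/funext => p /=; rewrite mxE liftK.
rewrite (_ : (fun _ => _) = fst) //.
by apply/funext => p /=; rewrite mxE unlift_none.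
Qed.

Lemma measurable_rV_uncons n : measurable_fun setT (@rV_uncons n).
Proof.
apply: measurable_fun_pair; first exact: measurable_rV_coord.
apply: measurable_fun_rV => i.
rewrite (_ : (fun _ => _) =
  (fun x : 'rV[R]_n.+1 => x ord0 (lift ord0 i) : measurableTypeR R)).
  exact: measurable_rV_coord.
by apply/funext => x; rewrite mxE.
Qed.

Section step.
Variables (n : nat) (m : {sigma_finite_measure set 'rV[R]_n -> \bar R}).

Definition leb_step : set 'rV[R]_n.+1 -> \bar R :=
  pushforward (lebesgue_measure \x m)%E (@rV_cons n).

Let leb_step0 : leb_step set0 = 0%E.
Proof. by rewrite /leb_step /pushforward preimage_set0 measure0. Qed.

Let leb_step_ge0 A : (0 <= leb_step A)%E.
Proof. by rewrite /leb_step /pushforward measure_ge0. Qed.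

Let mcons A : measurable A -> measurable (@rV_cons n @^-1` A).
Proof. by move=> mA; rewrite -[X in measurable X]setTI; exact: measurable_rV_cons. Qed.

Let leb_step_sigma_additive : semi_sigma_additive leb_step.
Proof.
move=> F mF tF mUF; rewrite /leb_step /pushforward preimage_bigcup.
apply: measure_semi_sigma_additive.
- by move=> k; exact: mcons.
- apply/trivIsetP => /= i j _ _ ij; rewrite -preimage_setI.
  by move/trivIsetP : tF => /(_ _ _ _ _ ij) ->//; rewrite preimage_set0.
- by rewrite -preimage_bigcup; exact: mcons.
Qed.

HB.instance Definition _ := isMeasure.Build _ _ _ leb_step
  leb_step0 leb_step_ge0 leb_step_sigma_additive.

Let leb_step_sigma_finite : sigma_finite setT leb_step.
Proof.
have /sigma_finiteP[F [TF ndF Foo]] := sigma_finiteT (@lebesgue_measure R).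
have /sigma_finiteP[G [TG ndG Goo]] := sigma_finiteT m.
exists (fun k => @rV_uncons n @^-1` (F k `*` G k)).
  rewrite -preimage_bigcup (_ : \bigcup_k _ = setT) ?preimage_setT//.
  rewrite -setXTT TF TG predeqE => -[x y]; split.
    by move=> [k _ []/= ? ?]; split; exists k.
  move=> [/= [k _ Fkx] [l _ Gly]]; exists (maxn k l) => //; split.
  - by move: x Fkx; exact/subsetPset/ndF/leq_maxl.
  - by move: y Gly; exact/subsetPset/ndG/leq_maxr.
move=> k; have [mF Fk] := Foo k; have [mG Gk] := Goo k; split.
  rewrite -[X in measurable X]setTI.
  by apply: measurable_rV_uncons => //; exact: measurableX.
rewrite /leb_step /pushforward -comp_preimage.
rewrite (_ : @rV_uncons n \o _ = id); last by rewrite funeqE => p; exact: rV_consK.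
by rewrite preimage_id product_measure1E// lte_mul_pinfty// ge0_fin_numE.
Qed.

HB.instance Definition _ := @Measure_isSigmaFinite.Build _ _ _
  leb_step leb_step_sigma_finite.
End step.

(* Lebesgue measure on R^n, as the n-fold product of the one-dimensional one. *)
Fixpoint leb (n : nat) : {sigma_finite_measure set 'rV[R]_n -> \bar R} :=
  match n with
  | 0 => [the {sigma_finite_measure set 'rV[R]_0 -> \bar R} of \d_(0 : 'rV[R]_0)]
  | k.+1 => [the {sigma_finite_measure set 'rV[R]_k.+1 -> \bar R} of
              leb_step (leb k)]
  end.

End Lebesgue.

(* Functions R^N -> C stand for their classes modulo equality a.e. Derivatives
   and integrals of complex-valued functions are taken componentwise. *)
Section analysis.
Context {R : realType} {N : nat}.
Local Notation E := 'rV[R]_N.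
Local Notation C := R[i].
Local Notation mu := (leb N : {measure set E -> \bar R}).
Local Notation normc := (@Normc.normc R).
Implicit Types (f g psi u : E -> C) (W T : (E -> C) -> C) (p q : \bar R).

Definition dotv (x y : E) : R := \sum_(j < N) x ord0 j * y ord0 j.

Definition enorm (x : E) : R := Num.sqrt (dotv x x).

Definition cRe f : E -> R := fun x => complex.Re (f x).
Definition cIm f : E -> R := fun x => complex.Im (f x).
Definition cOf (h : E -> R) : E -> C := fun x => (h x)%:C%C.

Definition partial (j : 'I_N) (h : E -> R) : E -> R :=
  fun x => 'D_(delta_mx ord0 j) h x.

Definition partials (js : seq 'I_N) (h : E -> R) : E -> R :=
  foldr partial h js.

Definition smooth (h : E -> R) : Prop :=
  forall js : seq 'I_N, continuous (partials js h) /\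
    forall (j : 'I_N) (x : E), derivable (partials js h) x (delta_mx ord0 j).

Definition csmooth f : Prop := smooth (cRe f) /\ smooth (cIm f).

Definition cpartials (js : seq 'I_N) f : E -> C :=
  fun x => (partials js (cRe f) x +i* partials js (cIm f) x)%C.

Definition claplacian f : E -> C :=
  fun x => \sum_(j < N) cpartials [:: j; j] f x.

Definition compact_supp (h : E -> C) : Prop :=
  exists r : R, forall x, r < enorm x -> h x = 0.

Definition test_fun psi : Prop := csmooth psi /\ compact_supp psi.

Definition real_test_fun (h : E -> R) : Prop := test_fun (cOf h).

Definition schwartz_le (k : nat) (M : R) f : Prop :=
  forall (js : seq 'I_N) (x : E), (size js <= k)%N ->
    (1 + enorm x) ^+ k * normc (cpartials js f x) <= M.

Definition schwartz f : Prop :=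
  csmooth f /\ forall k, exists M, schwartz_le k M f.

Definition cmeasurable f : Prop :=
  measurable_fun setT (cRe f) /\ measurable_fun setT (cIm f).

Definition cint f : C :=
  ((\int[mu]_x cRe f x)%R +i* (\int[mu]_x cIm f x)%R)%C.

Definition cLnorm p f : \bar R := Lnorm mu p (fun x => (normc (f x))%:E).

Definition Lp p f : Prop := cmeasurable f /\ (cLnorm p f < +oo)%E.

Definition locally_integrable f : Prop :=
  cmeasurable f /\
  forall r : R, mu.-integrable [set x | enorm x <= r]
                  (fun x => (normc (f x))%:E).

Definition weak_partial (j : 'I_N) f g : Prop :=
  [/\ locally_integrable f, locally_integrable g &
      forall psi, test_fun psi ->
        cint (fun x => f x * cpartials [:: j] psi x) =
        - cint (fun x => g x * psi x)].

Fixpoint sobolev (k : nat) p f : Prop :=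
  if k is l.+1 then
    Lp p f /\ forall j, exists g, weak_partial j f g /\ sobolev l p g
  else Lp p f.

(* A choice of representative of the weak derivative, unique a.e. if it exists. *)
Definition wD (j : 'I_N) f : E -> C := xget (fun=> 0) [set g | weak_partial j f g].

Definition H1norm f : \bar R :=
  ((cLnorm 2%:E f `^ 2 + \sum_(j < N) cLnorm 2%:E (wD j f) `^ 2) `^ 2^-1)%E.

(* H^{-1} is the dual of H^1; by density of the test functions in H^1 its
   elements are encoded by their values on test functions. *)
Definition Hm1norm T : \bar R :=
  ereal_sup [set (normc (T psi))%:E |
             psi in [set psi | test_fun psi /\ (H1norm psi <= 1)%E]].

Definition inHm1 T : Prop :=
  (forall (a : C) psi1 psi2, test_fun psi1 -> test_fun psi2 ->
     T (fun x => a * psi1 x + psi2 x) = a * T psi1 + T psi2) /\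
  (Hm1norm T < +oo)%E.

Definition distr_of f : (E -> C) -> C := fun psi => cint (fun x => f x * psi x).

(* A tempered distribution is a function on E -> C of which only the values on
   Schwartz functions matter. *)
Definition tempered W : Prop :=
  (forall (a : C) f g, schwartz f -> schwartz g ->
     W (fun x => a * f x + g x) = a * W f + W g) /\
  exists (k : nat) (K : R), forall f (M : R),
    schwartz f -> schwartz_le k M f -> normc (W f) <= K * M.

Definition dconv W f : E -> C := fun x => W (fun y => f (x - y)).

(* W is in M_{p,q}: the bound is required on Schwartz functions, which are
   dense in L^p as p is always finite here; conv_ext below is the continuous
   extension. *)
Definition multiplier (p q : R) W : Prop :=
  tempered W /\
  exists K : R, forall f, schwartz f ->
    (cLnorm q%:E (dconv W f) <= K%:E * cLnorm p%:E f)%E.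

Definition conv_ext (p q : R) W f (V : E -> C) : Prop :=
  [/\ Lp p%:E f, Lp q%:E V &
   exists f_ : (E -> C)^nat,
    [/\ forall n, schwartz (f_ n),
        (fun n => cLnorm p%:E (fun x => f_ n x - f x)) @ \oo --> 0%E &
        (fun n => cLnorm q%:E (fun x => dconv W (f_ n) x - V x)) @ \oo
          --> 0%E]].

Definition fourier psi : E -> C :=
  fun xi => cint (fun x => psi x * (cos (dotv x xi) -i* sin (dotv x xi))%C).

(* The Fourier transform of W is the bounded real-valued function h; it is
   real-valued whenever W is real-valued and even. *)
Definition fourier_transform W (h : E -> R) : Prop :=
  Lp +oo%E (cOf h) /\
  forall psi, schwartz psi ->
    W (fourier psi) = cint (fun xi => (h xi)%:C%C * psi xi).

Definition reflect_fun (h : E -> R) : E -> R := fun x => h (- x).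

Definition conv_fun (h1 h2 : E -> R) : E -> R :=
  fun x => \int[mu]_y (h1 y * h2 (x - y)).

Definition real_distr W : Prop :=
  forall h, real_test_fun h -> complex.Im (W (cOf h)) = 0.

Definition even_distr W : Prop :=
  forall h, real_test_fun h -> W (cOf h) = W (cOf (reflect_fun h)).

Definition positive_distr W : Prop :=
  forall h, real_test_fun h -> (forall x, 0 <= h x) -> 0 <= W (cOf h).

Definition positive_definite_distr W : Prop :=
  forall h, real_test_fun h -> 0 <= W (cOf (conv_fun h (reflect_fun h))).

Definition condition_W W : Prop :=
  exists p1 p2 p3 p4 q1 q2 q3 q4 s1 s2 : R,
    [/\ all (fun r => 1 <= r) [:: p1; p2; p3; p4; q1; q2; q3; q4; s1; s2],
       ((3 <= N)%N ->
         [/\ p4 < N%:R / (N%:R - 2),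
             all (fun r => 2 <= r < 2 * N%:R / (N%:R - 2)) [:: p2; p3; s1; s2],
             2 * N%:R / (N%:R + 2) < q1 <= 2 &
             all (fun r => N%:R / 2 < r) [:: q3; q4]]),
       ((1 <= N <= 2)%N ->
         all (fun r => 2 <= r) [:: p2; p3; s1; s2] /\ 1 < q1 <= 2),
       [/\ multiplier 2 2 W, multiplier p1 q1 W, multiplier p2 q2 W,
           multiplier p3 q3 W & multiplier p4 q4 W] &
       [/\ p3^-1 + q2^-1 = q1^-1, p1^-1 - p3^-1 = s1^-1 &
           q1^-1 - q3^-1 = s2^-1]].

Definition ess_inf_fourier_pos W : Prop :=
  exists (sigma : R) (h : E -> R),
    [/\ 0 < sigma, fourier_transform W h &
        (sigma%:E <= ess_inf mu (EFin \o h))%E].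

Definition reference_function (phi : E -> C) : Prop :=
  [/\ sobolev 1 +oo%E phi,
      Lp 2%:E (fun x => (normc (phi x) ^+ 2 - 1)%:C%C) &
      exists (c : E) (r : R), 0 < r /\
        forall j, exists g,
          [/\ weak_partial j phi g, sobolev 2 2%:E g,
              {within [set x | r <= enorm (x - c)], continuous (cRe g)} &
              {within [set x | r <= enorm (x - c)], continuous (cIm g)}]].

Definition grad_in_Lp p f : Prop :=
  forall j, exists g, weak_partial j f g /\ Lp p g.

Definition H1_continuous (w : R -> E -> C) : Prop :=
  forall t, sobolev 1 2%:E (w t) /\
    (fun s => H1norm (fun x => w s x - w t x)) @ t --> 0%E.

(* w is in C^1(R, H^{-1}), with derivative v *)
Definition Hm1_C1 (w : R -> E -> C) (v : R -> (E -> C) -> C) : Prop :=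
  forall t,
    [/\ inHm1 (v t),
        (fun s => Hm1norm (fun psi => v s psi - v t psi)) @ t --> 0%E &
        (fun h => Hm1norm (fun psi =>
           (h^-1)%:C%C * (distr_of (w (t + h)) psi - distr_of (w t) psi)
           - v t psi)) @ 0^' --> 0%E].

(* The potential W * (1 - |u|^2) is taken in the sense of M_{2,2}: for u in
   phi + H^1 and N <= 4 one has 1 - |u|^2 in L^2, since H^1 embeds in L^4. *)
Definition NGP_solution W (phi u0 : E -> C) (u : R -> E -> C) : Prop :=
  exists v : R -> (E -> C) -> C,
    [/\ H1_continuous (fun t x => u t x - phi x),
        Hm1_C1 (fun t x => u t x - phi x) v,
        {ae mu, forall x, u 0 x = u0 x} &
        forall t, exists V : E -> C,
          conv_ext 2 2 W (fun x => (1 - normc (u t x) ^+ 2)%:C%C) V /\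
          forall psi, test_fun psi ->
            'i%C * v t psi + cint (fun x => u t x * claplacian psi x)
            + cint (fun x => u t x * V x * psi x) = 0].

(* A smooth cutoff equal to 1 on [-1, 1] and to 0 off ]-2, 2[; K bounds its
   first two derivatives. K = 2 is impossible: |chi''| <= 2 would give
   chi (3/2) >= 3/4 from the left and chi (3/2) <= 1/4 from the right. *)
Definition cutoff (K : R) (chi : R -> R) : Prop :=
  [/\ forall (n : nat) (x : R), derivable (derive1n n chi) x 1,
      forall x : R, `|x| <= 1 -> chi x = 1,
      forall x : R, 2 <= `|x| -> chi x = 0,
      forall x : R, `|derive1n 1 chi x| <= K &
      forall x : R, `|derive1n 2 chi x| <= K].

Definition local_mass (chi : R -> R) u (a : E) (r : R) : \bar R :=
  (\int[mu]_x ((1 - normc (u x) ^+ 2) * chi (enorm (x - a) / r))%:E)%E.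

Definition mass_sup (chi : R -> R) u : \bar R :=
  ereal_inf (range (fun a => limf_esup (local_mass chi u a) (pinfty_nbhs R))).

Definition mass_inf (chi : R -> R) u : \bar R :=
  ereal_sup (range (fun a => limf_einf (local_mass chi u a) (pinfty_nbhs R))).

Definition generalized_mass (chi : R -> R) u (m : \bar R) : Prop :=
  mass_sup chi u = m /\ mass_inf chi u = m.

End analysis.

(* Main.v *)
Require Import Defs.
From mathcomp Require Import all_boot all_order all_algebra.
From mathcomp Require Import complex.
From mathcomp Require Import all_classical all_reals all_analysis.
From mathcomp Require Import measurable_realfun ess_sup_inf ring lra.

Import Order.TTheory GRing.Theory Num.Theory.
Import numFieldNormedType.Exports.

Local Open Scope classical_set_scope.
Local Open Scope ring_scope.

(** Write u = al + i be = phi + w and eta(x) = chi(|x - a| / l). The localised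
    mass of u(t), i.e. the integral of |u|^2 eta, is differentiable in t, with
    derivative the flux, i.e. the integral of
    2 sum_j (al d_j be - be d_j al) d_j eta:
    the potential W * (1 - |u|^2) is real and drops out. As the equation holds
    in H^{-1} only, u eta is first mollified.

    The flux is supported in the annulus l <= |x - a| <= 2 l, where
    |D eta| <= K / l and |D^2 eta| <= 3 K / l^2. Terms quadratic in
    (w, D w, D phi) are O(1 / l). In the term phi D w the derivative is moved
    off w, which leaves |w| / l^2; the last term is |phi| |D phi| / l. By Young's
    inequality both are at most e l^{-N} on the annulus, whose volume is O(l^N),
    plus the tail of an integrable function: this is where N <= 4 and
    D phi in L^{N/(N-1)} (or L^2 if N <= 2) are used. So the flux tends to 0 as
    l -> oo, uniformly for t in compact sets since w is continuous in H^1, and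
    the mean value theorem shows that the localised masses at times 0 and t
    have the same upper and lower limits, for each centre a. *)

Set Implicit Arguments.
Unset Strict Implicit.
Unset Printing Implicit Defensive.

(** * Integration of real functions *)

(** For fixed h the difference quotient of the mass is exactly a pairing of (u(t+h) - u(t)) / h with
    (u(t+h) + u(t)) eta. Only the second factor is mollified: this yields legitimate test functions
    whose H^1 norms are bounded independently of the mollification, so the H^{-1} error bounds
    survive a merely weak limit. That weak convergence is built by a monotone class argument from
    indicators of orthants, for which mollification is explicit. Products are dominated by pointwise
    Young inequalities; in particular u is locally in L^4 because 1 - |u|^2 is in L^2. The reality
    of the potential is an obstacle of its own: W is assumed real on compactly supported tests,
    while W * (1 - |u|^2) is an L^2 limit over Schwartz functions, so reality must first be extended
    by temperedness and then carried through the limit. In the flux estimate the small parameter e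
    is chosen before the radius, because the integrable functions whose tails are taken depend on
    e. *)

Section real_integrals.
Context {d : measure_display} {T : measurableType d} {R : realType}.
Variable mu : {measure set T -> \bar R}.
Implicit Types f g h : T -> R.

Definition rintegrable f := mu.-integrable setT (EFin \o f).
Definition meas f := measurable_fun setT f.

Lemma intg_meas f : rintegrable f -> meas f.
Proof. by case/integrableP => /measurable_EFinP. Qed.

Lemma intgD f g : rintegrable f -> rintegrable g -> rintegrable (fun x => f x + g x).
Proof. by move=> If Ig; exact: (integrableD _ If Ig). Qed.

Lemma intgZ c f : rintegrable f -> rintegrable (fun x => c * f x).
Proof. by move=> If; exact: (integrableZl _ c If). Qed.

Lemma intgN f : rintegrable f -> rintegrable (fun x => - f x).
Proof. by move=> /(intgZ (-1)); under eq_fun do rewrite mulN1r. Qed.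

Lemma intgB f g : rintegrable f -> rintegrable g -> rintegrable (fun x => f x - g x).
Proof. by move=> If Ig; apply: intgD => //; exact: intgN. Qed.

Lemma intg0 : rintegrable (fun=> 0).
Proof. exact: integrable0. Qed.

Lemma intg_sum (I : Type) (s : seq I) (F : I -> T -> R) :
  (forall i, rintegrable (F i)) -> rintegrable (fun x => \sum_(i <- s) F i x).
Proof.
move=> IF; elim: s => [|i s IH].
  by under eq_fun do rewrite big_nil; exact: intg0.
by under eq_fun do rewrite big_cons; apply: intgD.
Qed.

Lemma le_intg f g : meas f -> (forall x, `|f x| <= g x) -> rintegrable g -> rintegrable f.
Proof.
move=> mf fg Ig; apply: (le_integrable measurableT _ _ Ig) => //.
  exact/measurable_EFinP.
by move=> x _ /=; rewrite lee_fin (le_trans (fg x))// ler_norm.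
Qed.

Lemma intg_norm f : rintegrable f -> rintegrable (fun x => `|f x|).
Proof.
move=> If; apply: (le_integrable measurableT _ _ If) => //.
  apply/measurable_EFinP; apply: measurableT_comp => //; exact: intg_meas If.
by move=> x _ /=; rewrite normr_id.
Qed.

Lemma ae_le_intg f g : meas f -> {ae mu, forall x, `|f x| <= g x} -> rintegrable g ->
  rintegrable f.
Proof.
move=> mf fg Ig; apply/integrableP; split; first exact/measurable_EFinP.
case/integrableP : (intg_norm Ig) => mg; apply: le_lt_trans.
apply: ae_ge0_le_integral => //=.
- by apply/measurable_EFinP; apply: measurableT_comp.
- apply/measurable_EFinP; apply: measurableT_comp => //.
  by apply: measurableT_comp => //; exact: intg_meas Ig.
- by apply: filterS fg => x fx _; rewrite lee_fin normr_id (le_trans fx)// ler_norm.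
Qed.

Lemma ae_intg f g : meas g -> {ae mu, forall x, f x = g x} -> rintegrable f -> rintegrable g.
Proof.
move=> mg fg If; apply: (ae_le_intg mg _ (intg_norm If)).
by apply: filterS fg => x ->.
Qed.

Lemma eq_int f g : (forall x, f x = g x) ->
  \int[mu]_x f x = \int[mu]_x g x.
Proof. by move=> fg; apply: eq_Rintegral => x _; exact: fg. Qed.

Lemma ae_eq_int f g : meas f -> meas g -> {ae mu, forall x, f x = g x} ->
  \int[mu]_x f x = \int[mu]_x g x.
Proof.
move=> mf mg fg; rewrite /Rintegral; congr fine.
apply: ae_eq_integral => //; try exact/measurable_EFinP.
by apply: filterS fg => x fx _ /=; rewrite fx.
Qed.

Lemma intE f : rintegrable f -> (\int[mu]_x (f x)%:E)%E = (\int[mu]_x f x)%R%:E.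
Proof. by move=> If; rewrite fineK//; exact: integrable_fin_num. Qed.

Lemma intD f g : rintegrable f -> rintegrable g ->
  \int[mu]_x (f x + g x) = \int[mu]_x f x + \int[mu]_x g x.
Proof. by move=> If Ig; rewrite RintegralD. Qed.

Lemma intB f g : rintegrable f -> rintegrable g ->
  \int[mu]_x (f x - g x) = \int[mu]_x f x - \int[mu]_x g x.
Proof. by move=> If Ig; rewrite RintegralB. Qed.

Lemma intZ c f : rintegrable f -> \int[mu]_x (c * f x) = c * \int[mu]_x f x.
Proof. by move=> If; rewrite RintegralZl. Qed.

Lemma int0 : \int[mu]_x (0 : R) = 0.
Proof. by rewrite /Rintegral integral0. Qed.

Lemma intN f : rintegrable f -> \int[mu]_x (- f x) = - \int[mu]_x f x.
Proof.
move=> If; rewrite -[RHS]mulN1r -intZ//.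
by apply: eq_int => x; rewrite mulN1r.
Qed.

Lemma int_sum (I : Type) (s : seq I) (F : I -> T -> R) :
  (forall i, rintegrable (F i)) ->
  \int[mu]_x (\sum_(i <- s) F i x) = \sum_(i <- s) \int[mu]_x F i x.
Proof.
move=> IF; elim: s => [|i s IH].
  by rewrite big_nil -[RHS]int0; apply: eq_int => x; rewrite big_nil.
rewrite big_cons -IH -intD//; last exact: intg_sum.
by apply: eq_int => x; rewrite big_cons.
Qed.

Lemma le_int f g : rintegrable f -> rintegrable g -> (forall x, f x <= g x) ->
  \int[mu]_x f x <= \int[mu]_x g x.
Proof. by move=> If Ig fg; apply: le_Rintegral => // x _. Qed.

Lemma int_ge0 f : (forall x, 0 <= f x) -> 0 <= \int[mu]_x f x.
Proof. by move=> f0; apply: Rintegral_ge0. Qed.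

Lemma ler_norm_int f : rintegrable f -> `|\int[mu]_x f x| <= \int[mu]_x `|f x|.
Proof. by move=> If; apply: le_normr_Rintegral. Qed.

Lemma norm_int_le f g : rintegrable f -> rintegrable g -> (forall x, `|f x| <= g x) ->
  `|\int[mu]_x f x| <= \int[mu]_x g x.
Proof.
move=> If Ig fg; rewrite (le_trans (ler_norm_int If))//.
by apply: le_int => //; exact: intg_norm.
Qed.

Lemma int_ge0_eq0 f : rintegrable f -> (forall x, 0 <= f x) -> \int[mu]_x f x = 0 ->
  {ae mu, forall x, f x = 0}.
Proof.
move=> If f0 i0.
have /(ae_eq_integral_abs mu measurableT) : measurable_fun setT (EFin \o f).
  by apply/measurable_EFinP; exact: intg_meas.
case=> + _; rewrite (eq_integral (fun x => (f x)%:E)); last first.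
  by move=> x _; rewrite /= ger0_norm.
rewrite intE// i0 => /(_ erefl).
by apply: filterS => x /(_ I) [].
Qed.

Lemma dominated_int (F : nat -> T -> R) f g :
  (forall n, meas (F n)) -> meas f -> rintegrable g ->
  (forall n x, `|F n x| <= g x) ->
  (forall x, F ^~ x @ \oo --> f x) ->
  rintegrable f /\ (fun n => \int[mu]_x F n x) @ \oo --> \int[mu]_x f x.
Proof.
move=> mF mf Ig Fg cF.
have [||||| If _ c] := @dominated_convergence _ _ _ mu setT measurableT
  (fun n x => (F n x)%:E) (EFin \o f) (EFin \o g).
- by move=> n; apply/measurable_EFinP; exact: mF.
- exact/measurable_EFinP.
- by apply: aeW => x _; apply: cvg_comp (cF x) _.
- exact: Ig.
- by apply: aeW => x n _; rewrite lee_fin.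
split => //.
have {}c : (\int[mu]_x (F n x)%:E)%E @[n --> \oo] --> (\int[mu]_x f x)%R%:E.
  by rewrite -intE.
exact: (fine_cvg c).
Qed.

End real_integrals.

(** * Reflections, translations and cubes for Lebesgue measure on R^n *)

Section lebesgue_invariance.
Context {R : realType}.

(** The preimage of ]x, y] is [a - y, a - x[, which is open at the other end but has the same
    length. Uniqueness of the measure with these values on half-open intervals concludes. *)
Let lebesgue_refl (a : R) (A : set (measurableTypeR R)) : measurable A ->
  lebesgue_measure A = lebesgue_measure ((fun x : R => a - x) @^-1` A).
Proof.
have mf : measurable_fun setT ((fun x : R => a - x) : measurableTypeR R -> measurableTypeR R).
  by apply: measurable_funB.
pose m := measure_function_pushforward__canonical__measure_function_Measure
  (@lebesgue_measure R) mf.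
apply: (@lebesgue_measure_unique R m) => X /ocitvP[->|[[x y] /= xy ->]].
  by rewrite !measure0.
rewrite /m /= /pushforward (_ : _ @^-1` _ = `[a - y, a - x[%classic).
  rewrite !lebesgue_measure_itv/= !lte_fin ltrD2l ltrN2 xy.
  by rewrite -!EFinB; congr EFin; ring.
by apply/seteqP; split => z /=; rewrite !in_itv/= => /andP[? ?]; apply/andP; split; lra.
Qed.

Lemma integral_lebesgue_refl (a : R) (F : measurableTypeR R -> \bar R) :
  measurable_fun setT F -> (forall x, 0 <= F x)%E ->
  (\int[lebesgue_measure]_x F (a - x)%R = \int[lebesgue_measure]_x F x)%E.
Proof.
move=> mF F0.
have mf : measurable_fun setT ((fun x : R => a - x) : measurableTypeR R -> measurableTypeR R).
  by apply: measurable_funB.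
rewrite [RHS](eq_measure_integral
  (measure_function_pushforward__canonical__measure_function_Measure
  (@lebesgue_measure R) mf)); last first.
  by move=> A mA _; exact: lebesgue_refl.
by rewrite ge0_integral_pushforward.
Qed.

(** By construction [leb n.+1] is the image under [rV_cons] of the product of the line with [leb n],
    so this is the formula for image measures followed by Tonelli's theorem. *)
Lemma leb_tonelli n (F : 'rV[R]_n.+1 -> \bar R) :
  measurable_fun setT F -> (forall x, 0 <= F x)%E ->
  (\int[leb n.+1]_x F x =
   \int[lebesgue_measure]_s \int[leb n]_y F (rV_cons (s, y)))%E.
Proof.
move=> mF F0.
rewrite (eq_measure_integral
  (measure_function_pushforward__canonical__measure_function_Measure
  (@lebesgue_measure R \x leb n)%E (@measurable_rV_cons R n))); last by [].
rewrite ge0_integral_pushforward//=; last exact: measurable_rV_cons.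
rewrite preimage_setT fubini_tonelli1//.
by apply: measurableT_comp => //; exact: measurable_rV_cons.
Qed.

Lemma measurable_rV_refl n (a : 'rV[R]_n) : 
  measurable_fun setT (fun x : 'rV[R]_n => a - x : 'rV[R]_n).
Proof.
apply: measurable_fun_rV => i; under eq_fun do rewrite !mxE.
apply: measurable_funB => //; exact: measurable_rV_coord.
Qed.

(** Induction on the dimension: Tonelli splits off the first coordinate, reflected by the
    one-dimensional case, and the induction hypothesis reflects the others. *)
Lemma integral_leb_refl n (a : 'rV[R]_n) (F : 'rV[R]_n -> \bar R) :
  measurable_fun setT F -> (forall x, 0 <= F x)%E ->
  (\int[leb n]_x F (a - x)%R = \int[leb n]_x F x)%E.
Proof.
elim: n a F => [|n IH] a F mF F0.
  by congr (integral _ _ _); apply/funext => x; congr F; apply/rowP => -[].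
rewrite !leb_tonelli//; last first.
  exact: (measurableT_comp mF (measurable_rV_refl a)).
have mF2 : measurable_fun setT
    (F \o (@rV_cons R n)).
  exact: (measurableT_comp mF (@measurable_rV_cons R n)).
pose G s := (\int[leb n]_y F (rV_cons (s, y)))%E.
rewrite -[RHS](@integral_lebesgue_refl (a ord0 ord0) G); first last.
- by move=> s; apply: integral_ge0 => y _; exact: F0.
- exact: (measurable_fun_fubini_tonelli_F (m2 := leb n) _ mF2 (fun p => F0 _)).
apply: eq_integral => s _; rewrite /G.
pose a' : 'rV[R]_n := \row_i a ord0 (lift ord0 i).
rewrite -[RHS](IH a'); first last.
- by move=> y; exact: F0.
- exact: (measurableT_comp mF2
    (@pair1_measurable _ _ (measurableTypeR R) 'rV[R]_n (a ord0 ord0 - s))).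
apply: eq_integral => y _; congr F; apply/rowP => i; rewrite !mxE.
by case: unliftP => [j ->|->]; rewrite /= ?mxE ?liftK.
Qed.

(** A translation is the composition of two reflections, x + a = a - (0 - x). *)
Lemma integral_leb_shift n (a : 'rV[R]_n) (F : 'rV[R]_n -> \bar R) :
  measurable_fun setT F -> (forall x, 0 <= F x)%E ->
  (\int[leb n]_x F (x + a)%R = \int[leb n]_x F x)%E.
Proof.
move=> mF F0; rewrite -(integral_leb_refl a mF F0).
rewrite -[RHS](@integral_leb_refl _ 0 (fun x => F (a - x))); first last.
- by move=> x; exact: F0.
- exact: (measurableT_comp mF (measurable_rV_refl a)).
by apply: eq_integral => x _; rewrite sub0r opprK addrC.
Qed.

Lemma measurable_cube n (r : R) :
  measurable [set x : 'rV[R]_n | forall i, `|x ord0 i| <= r].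
Proof.
rewrite (_ : [set _ | _] = \bigcap_(i in [set: 'I_n])
    ((fun x : 'rV[R]_n => x ord0 i : measurableTypeR R) @^-1` `[- r, r]%classic)).
  apply: fin_bigcap_measurable => [|i _]; first exact: finite_finset.
  rewrite -[X in measurable X]setTI.
  by apply: measurable_rV_coord.
apply/seteqP; split => x /= H.
  by move=> i _ /=; rewrite in_itv/= -ler_norml.
by move=> i; have := H i I; rewrite /= in_itv/= -ler_norml.
Qed.

Lemma leb_cube n (r : R) : 0 <= r ->
  leb n [set x : 'rV[R]_n | forall i, `|x ord0 i| <= r] = ((2 * r) ^+ n)%:E.
Proof.
move=> r0; elim: n => [|n IH].
  rewrite (_ : [set _ | _] = setT) /=; first by rewrite diracT expr0.
  by apply/seteqP; split => // x _ [].
rewrite /= /leb_step /pushforward.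
rewrite (_ : _ @^-1` _ = `[-r, r]%classic `*` [set y : 'rV[R]_n | forall i, `|y ord0 i| <= r]).
  rewrite product_measure1E ?IH//; last first.
    exact: measurable_cube.
  rewrite exprS EFinM; congr (_ * _)%E.
  transitivity (@lebesgue_measure R `[- r, r]%classic) => //.
  rewrite lebesgue_measure_itv/= lte_fin; case: ltP => rr.
    by rewrite -EFinB; congr EFin; ring.
  by congr EFin; lra.
apply/seteqP; split => -[s y] /= H.
  split; first by have := H ord0; rewrite mxE unlift_none/= in_itv/= ler_norml.
  by move=> i; have := H (lift ord0 i); rewrite mxE liftK.
move=> i; rewrite mxE; case: H => /=; rewrite in_itv/= -ler_norml => H1 H2.
by case: unliftP.
Qed.

End lebesgue_invariance.

(** * Open sets are measurable; changes of variables for real integrals *)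

Section euclidean_integrals.
Context {R : realType} {N : nat}.
Local Notation E := 'rV[R]_N.
Local Notation mu := (leb N : {measure set E -> \bar R}).
Local Notation intg := (rintegrable mu).

Lemma measurable_cube_at (a : E) (r : R) :
  measurable [set x : E | forall i, `|a ord0 i - x ord0 i| <= r].
Proof.
have := @measurable_rV_refl R N a measurableT _ (@measurable_cube R N r).
rewrite setTI; congr measurable.
by apply/seteqP; split => x /= H i; have := H i; rewrite !mxE.
Qed.

(** Measurable sets are generated by cylinders, so U has to be exhibited as a countable union of
    cubes: those with rational centre and half-side 1 / (k + 1) that are contained in it. *)
Lemma open_measurable_rV (U : set E) : open U -> measurable U.
Proof.
move=> oU.
pose D := [set p : 'rV[rat]_N * nat |
  [set x : E | forall i, `|ratr (p.1 ord0 i) - x ord0 i| <= p.2.+1%:R^-1] `<=` U].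
rewrite (_ : U = \bigcup_(p in D)
  [set x : E | forall i, `|ratr (p.1 ord0 i) - x ord0 i| <= p.2.+1%:R^-1]).
  rewrite bigcup_mkcond; apply: countable_bigcupT_measurable => [|p].
    exact: countableP.
  case: ifPn => // _.
  have := @measurable_cube_at (\row_i ratr (p.1 ord0 i)) p.2.+1%:R^-1.
  congr measurable.
  by apply/seteqP; split => x /= H i; have := H i; rewrite !mxE.
apply/seteqP; split => [x Ux|x [p Dp px]]; last exact: Dp.
have /nbhs_ballP[e /= e0 xe] : nbhs x U by exact: open_nbhs_nbhs.
(* Two points of such a cube differ by at most 2 / (k + 1) in each coordinate; this k keeps the cube
   inside the ball of radius e. *)
pose k := Num.truncn (2 / e).
have ke : (2:R) * k.+1%:R^-1 < e.
  by rewrite ltr_pdivrMr// mulrC -ltr_pdivrMr// /k truncnS_gt.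
have qe i : exists q : rat, `|ratr q - x ord0 i| <= k.+1%:R^-1 :> R.
  have /rat_in_itvoo[q] : x ord0 i < x ord0 i + k.+1%:R^-1 by rewrite ltrDl invr_gt0.
  rewrite in_itv/= => /andP[xq qx]; exists q.
  by rewrite ger0_norm ?subr_ge0 ?(ltW xq)// lerBlDl ltW.
exists (\row_i xchoose (qe i), k); last first.
  by move=> i /=; rewrite mxE; exact: (xchooseP (qe i)).
move=> y /= ky; apply: xe; split => // i j; rewrite (ord1 i) /ball/=.
rewrite (@le_lt_trans _ _ (2 * k.+1%:R^-1))//.
have := ky j; rewrite mxE => k1; have k2 := xchooseP (qe j).
rewrite (_ : x _ _ - _ = (ratr (xchoose (qe j)) - y ord0 j) -
  (ratr (xchoose (qe j)) - x ord0 j)); last by ring.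
by rewrite (le_trans (ler_normB _ _))// mulrDl mul1r lerD.
Qed.

Lemma continuous_meas (h : E -> R) : continuous h -> measurable_fun setT h.
Proof.
move=> ch; apply: (@measurability _ _ E (measurableTypeR R) setT h (@RGenOInfty.G R)) => [|_ [_ [c ->] <-]].
  exact: RGenOInfty.measurableE.
rewrite setTI; apply: open_measurable_rV.
by apply: open_comp => // *; exact: ch.
Qed.

Lemma measurable_rV_sub :
  measurable_fun setT (fun p : E * E => p.1 - p.2 : E).
Proof.
apply: measurable_fun_rV => i; under eq_fun do rewrite !mxE.
by apply: measurable_funB; apply: measurableT_comp (measurable_rV_coord i) _.
Qed.

Lemma measurable_rV_shift (a : E) : measurable_fun setT (fun x : E => x + a : E).
Proof.
apply: measurable_fun_rV => i; under eq_fun do rewrite !mxE.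
apply: measurable_funD => //; exact: measurable_rV_coord.
Qed.

(** An identity between integrals of non-negative functions passes to real functions through their
    positive and negative parts. *)
Let intg_comp (s : E -> E) (f : E -> R) : measurable_fun setT s ->
  (forall F : E -> \bar R, measurable_fun setT F -> (forall x, 0 <= F x)%E ->
     (\int[leb N]_x F (s x) = \int[leb N]_x F x)%E) -> intg f ->
  intg (fun x => f (s x)) /\ \int[mu]_x f (s x) = \int[mu]_x f x.
Proof.
move=> ms H If; have mf := intg_meas If.
have mfs : measurable_fun setT (fun x => f (s x)) by exact: measurableT_comp mf ms.
split.
  apply/integrableP; split; first exact/measurable_EFinP.
  rewrite [ltLHS](H (fun x => `|(f x)%:E|))%E//; last first.
    by apply: measurableT_comp => //; exact/measurable_EFinP.
  by case/integrableP : If.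
rewrite /Rintegral; congr fine; rewrite integralE [RHS]integralE; congr (_ - _)%E.
- rewrite -[RHS]H//; last by apply: measurable_funepos; exact/measurable_EFinP.
  by apply: eq_integral => x _; rewrite ?funeposE ?funenegE.
- rewrite -[RHS]H//; last by apply: measurable_funeneg; exact/measurable_EFinP.
  by apply: eq_integral => x _; rewrite ?funeposE ?funenegE.
Qed.

Lemma intg_refl a f : intg f -> intg (fun x => f (a - x)).
Proof.
move=> If; have [I1 I2] := (@intg_comp _ f (measurable_rV_refl a)
  (fun F => @integral_leb_refl R N a F) If).
exact: I1.
Qed.

Lemma int_refl a f : intg f -> \int[mu]_x f (a - x) = \int[mu]_x f x.
Proof.
move=> If; have [I1 I2] := (@intg_comp _ f (measurable_rV_refl a)
  (fun F => @integral_leb_refl R N a F) If).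
exact: I2.
Qed.

Lemma intg_shift a f : intg f -> intg (fun x => f (x + a)).
Proof.
move=> If; have [I1 I2] := (@intg_comp _ f (measurable_rV_shift a)
  (fun F => @integral_leb_shift R N a F) If).
exact: I1.
Qed.

Lemma int_shift a f : intg f -> \int[mu]_x f (x + a) = \int[mu]_x f x.
Proof.
move=> If; have [I1 I2] := (@intg_comp _ f (measurable_rV_shift a)
  (fun F => @integral_leb_shift R N a F) If).
exact: I2.
Qed.

End euclidean_integrals.

(** * Convolution and test functions *)

Section convolution.
Context {R : realType} {N : nat}.
Local Opaque Rintegral integrable.
Local Notation E := 'rV[R]_N.
Local Notation mu := (leb N : {measure set E -> \bar R}).
Local Notation intg := (rintegrable mu).
Local Notation m2 := ((leb N \x leb N)%E : {measure set (E * E) -> \bar R}).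
Implicit Types f g h k r : E -> R.

Definition convol f r : E -> R := fun x => \int[mu]_y (f y * r (x - y)).

Lemma meas_fst f : meas f -> meas (fun p : E * E => f p.1).
Proof. by move=> mf; apply: measurableT_comp mf _. Qed.

Lemma meas_snd f : meas f -> meas (fun p : E * E => f p.2).
Proof. by move=> mf; apply: measurableT_comp mf _. Qed.

Lemma meas_sub f : meas f -> meas (fun p : E * E => f (p.1 - p.2)).
Proof. by move=> mf; apply: measurableT_comp mf measurable_rV_sub. Qed.

(** The real inner integrals may differ from the extended ones where a section fails to be
    integrable. Almost every section is integrable, so the discrepancy is confined to a null set. *)
Lemma fubini_real (F : E * E -> R) : rintegrable m2 F ->
  [/\ intg (fun x => \int[mu]_y F (x, y)), intg (fun y => \int[mu]_x F (x, y)) &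
   \int[mu]_x (\int[mu]_y F (x, y)) = \int[mu]_y (\int[mu]_x F (x, y))].
Proof.
move=> IF.
have ae_x := ae_integrable1 IF; have ae_y := ae_integrable2 IF.
have I1 := integrable_fubini_F IF.
have mF : measurable_fun setT (EFin \o F) by exact/measurable_EFinP/intg_meas/IF.
have maF : measurable_fun setT (fun p => `|(F p)%:E|%E) by exact: measurableT_comp mF.
have I2 : (\int[leb N]_y \int[leb N]_x `|(F (x, y))%:E| < +oo)%E.
  by apply/(integrable21ltyP (leb N) (leb N) mF); exact: IF.
have m1 := @measurable_fubini_F _ _ _ _ _ _ _ _ IF.
have m2 := @measurable_fubini_G _ _ _ _ _ _ _ _ IF.
have J1 : intg (fun x => \int[mu]_y F (x, y)).
  apply/integrableP; split.
    by apply/measurable_EFinP; exact: (measurableT_comp (@fine_measurable R setT measurableT) m1).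
  case/integrableP : I1 => _; apply: le_lt_trans.
  apply: ae_ge0_le_integral => //.
  - apply: measurableT_comp => //.
    by apply/measurable_EFinP; exact: (measurableT_comp (@fine_measurable R setT measurableT) m1).
  - exact: measurableT_comp.
  by apply: filterS ae_x => x Ix _; rewrite [in leLHS]/comp -(@intE _ _ _ (leb N) (fun y => F (x, y))).
have J2 : intg (fun y => \int[mu]_x F (x, y)).
  apply/integrableP; split.
    by apply/measurable_EFinP; exact: (measurableT_comp (@fine_measurable R setT measurableT) m2).
  apply: le_lt_trans I2; apply: ae_ge0_le_integral => //.
  - apply: measurableT_comp => //.
    by apply/measurable_EFinP; exact: (measurableT_comp (@fine_measurable R setT measurableT) m2).
  - by move=> y _; exact: integral_ge0.
  - exact: (measurable_fun_fubini_tonelli_G (m1 := leb N) _ maF).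
  apply: filterS ae_y => y Iy _.
  have mFy : measurable_fun setT (fun x => (F (x, y))%:E).
    by case/integrableP : Iy.
  by rewrite [in leLHS]/comp -(@intE _ _ _ (leb N) (fun x => F (x, y)))//; exact: le_abse_integral.
split; [exact: J1|exact: J2|apply: EFin_inj].
rewrite -(intE J1) -(intE J2).
transitivity (\int[leb N]_x \int[leb N]_y (EFin \o F) (x, y))%E.
  apply: ae_eq_integral => //; first exact/measurable_EFinP/intg_meas/J1.
  by apply: filterS ae_x => x Ix _; rewrite -intE.
rewrite (Fubini IF).
apply: ae_eq_integral => //; first exact/measurable_EFinP/intg_meas/J2.
by apply: filterS ae_y => x Ix _; rewrite -intE.
Qed.

(** Integrating in x first, translation invariance turns the inner integral of |r(x - y)| into the
    L^1 norm of r. *)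
Lemma intg_kernel_snd f r : intg f -> intg r ->
  rintegrable m2 (fun p => f p.2 * r (p.1 - p.2)).
Proof.
move=> If Ir; have mf := intg_meas If; have mr := intg_meas Ir.
have mF : meas (fun p : E * E => f p.2 * r (p.1 - p.2)).
  by apply: measurable_funM; [exact: meas_snd|exact: meas_sub].
apply/integrable21ltyP; first exact/measurable_EFinP.
rewrite (eq_integral (fun y => `|(f y)|%:E * (\int[mu]_x `|r x|)%R%:E)%E); last first.
  move=> y _ /=.
  rewrite -(@int_shift R N (- y) (fun x => `|r x|)); last exact: intg_norm.
  rewrite -EFinM -intZ; last exact: (@intg_shift R N (- y) _ (intg_norm Ir)).
  rewrite -intE; last exact: (intgZ _ (@intg_shift R N (- y) _ (intg_norm Ir))).
  by apply: eq_integral => x _ /=; rewrite normrM.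
rewrite ge0_integralZr//=.
- by have /= -> := intE (intg_norm If); rewrite -EFinM ltry.
- by apply/measurable_EFinP; exact: measurableT_comp.
- by rewrite lee_fin int_ge0.
Qed.

(** Now f depends on x, so y is integrated first, and the inner integral is handled by reflection
    instead of translation. *)
Lemma intg_kernel_fst f r : intg f -> intg r ->
  rintegrable m2 (fun p => f p.1 * r (p.1 - p.2)).
Proof.
move=> If Ir; have mf := intg_meas If; have mr := intg_meas Ir.
have mF : meas (fun p : E * E => f p.1 * r (p.1 - p.2)).
  by apply: measurable_funM; [exact: meas_fst|exact: meas_sub].
apply/integrable12ltyP; first exact/measurable_EFinP.
rewrite (eq_integral (fun y => `|(f y)|%:E * (\int[mu]_x `|r x|)%R%:E)%E); last first.
  move=> y _ /=.
  rewrite -(@int_refl R N y (fun x => `|r x|)); last exact: intg_norm.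
  rewrite -EFinM -intZ; last exact: (@intg_refl R N y _ (intg_norm Ir)).
  rewrite -intE; last exact: (intgZ _ (@intg_refl R N y _ (intg_norm Ir))).
  by apply: eq_integral => x _ /=; rewrite normrM.
rewrite ge0_integralZr//=.
- by have /= -> := intE (intg_norm If); rewrite -EFinM ltry.
- by apply/measurable_EFinP; exact: measurableT_comp.
- by rewrite lee_fin int_ge0.
Qed.

Definition bounded_by (M : R) f := forall x, `|f x| <= M.

Lemma intg_mul_bounded M f k : intg f -> meas k -> bounded_by M k ->
  intg (fun x => f x * k x).
Proof.
move=> If mk kM; apply: (le_intg (g := fun x => M * `|f x|)).
- by apply: measurable_funM => //; exact: intg_meas If.
- by move=> x; rewrite normrM mulrC; apply: ler_wpM2r => //; exact: kM.
- exact/intgZ/intg_norm.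
Qed.

Lemma meas_refl r (x : E) : meas r -> meas (fun y : E => r (x - y)).
Proof. by move=> mr; apply: measurableT_comp mr (measurable_rV_refl x). Qed.

Lemma intg_conv_kernel M f r (x : E) : intg f -> meas r -> bounded_by M r ->
  intg (fun y => f y * r (x - y)).
Proof.
move=> If mr rM; apply: (intg_mul_bounded (M := M) If (meas_refl x mr)) => y.
exact: rM.
Qed.

Lemma intg_conv f r : intg f -> intg r -> intg (convol f r).
Proof. by move=> If Ir; have [] := fubini_real (intg_kernel_snd If Ir). Qed.

Lemma conv_bounded C M f r : intg f -> meas r -> bounded_by M r ->
  \int[mu]_y `|f y| <= C -> 0 <= M -> bounded_by (C * M) (convol f r).
Proof.
move=> If mr rM fC M0 x; rewrite /convol.
have I1 := intg_conv_kernel x If mr rM.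
rewrite (@le_trans _ _ (\int[mu]_y (M * `|f y|)))//.
  apply: norm_int_le => //; first exact/intgZ/intg_norm.
  by move=> y; rewrite normrM mulrC; apply: ler_wpM2r => //; exact: rM.
by rewrite intZ; [rewrite mulrC; exact: ler_wpM2r|exact: intg_norm].
Qed.

(* The pointwise bound on the product replaces any choice of conjugate
   exponents for f and k. *)
Section bilinear.
Variables (f k r F K : E -> R) (M : R).
Hypotheses (If : intg f) (mk : meas k) (r0 : forall x, 0 <= r x)
  (Ir : intg r) (rM : bounded_by M r) (IF : intg F) (IK : intg K)
  (fkFK : forall x y, `|f y * k x| <= F y + K x).

Let G (p : E * E) := f p.2 * r (p.1 - p.2) * k p.1.

Let IG : rintegrable m2 G.
Proof.
have mr := intg_meas Ir.
apply: (@le_intg _ _ _ m2 G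
  (fun p : E * E => F p.2 * r (p.1 - p.2) + K p.1 * r (p.1 - p.2))).
- apply: measurable_funM; last exact: meas_fst.
  by apply: measurable_funM; [exact: meas_snd (intg_meas If)|exact: meas_sub].
- move=> p; rewrite /G mulrAC normrM -mulrDl (ger0_norm (r0 _)).
  by apply: ler_wpM2r; [exact: r0|exact: fkFK].
- by apply: intgD; [exact: intg_kernel_snd|exact: intg_kernel_fst].
Qed.

Let convG x : convol f r x * k x = \int[mu]_y G (x, y).
Proof.
rewrite /convol mulrC -intZ; last by exact: intg_conv_kernel If (intg_meas Ir) rM.
by apply: eq_int => y; rewrite /G mulrC.
Qed.

Lemma intg_conv_mul : intg (fun x => convol f r x * k x).
Proof. by have [I1 _ _] := fubini_real IG; under eq_fun do rewrite convG. Qed.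

(** As r has mass one, the convolution of F with r has the integral of F, and K(x) is the integral
    of K(x) r(x - y) in y. Integrating the hypothesis against r(x - y) therefore gives the bound,
    whatever r is. *)
Lemma norm_int_conv_mul : \int[mu]_x r x = 1 ->
  `|\int[mu]_x (convol f r x * k x)| <= \int[mu]_x F x + \int[mu]_x K x.
Proof.
move=> r1; have mr := intg_meas Ir.
have [I1 I2 I12] := fubini_real (intg_kernel_snd IF Ir).
have [J1 J2 J12] := fubini_real (intg_kernel_fst IK Ir).
have IFr : intg (convol F r) by exact: intg_conv.
have convFk x : convol F r x = \int[mu]_y (F y * r (x - y)) by [].
have iF : \int[mu]_x convol F r x = \int[mu]_x F x.
  transitivity (\int[mu]_y (\int[mu]_x (F y * r (x - y)))); first exact: I12.
  apply: eq_int => y; rewrite intZ; last exact: (@intg_shift R N (- y) _ Ir).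
  by rewrite (@int_shift R N (- y) _ Ir) r1 mulr1.
rewrite -iF -(intD IFr IK).
apply: norm_int_le; first exact: intg_conv_mul.
  exact: intgD.
move=> x; rewrite convG.
rewrite (_ : K x = \int[mu]_y (K x * r (x - y))); last first.
  by rewrite (intZ _ (@intg_refl R N x _ Ir)) (@int_refl R N x _ Ir) r1 mulr1.
rewrite /convol -intD; last 2 first.
- exact: intg_conv_kernel IF mr rM.
- exact/intgZ/intg_refl.
apply: norm_int_le.
- have := intgZ (k x) (intg_conv_kernel x If mr rM).
  by under eq_fun do rewrite mulrC.
- by apply: intgD; [exact: intg_conv_kernel IF mr rM|exact/intgZ/intg_refl].
- move=> y; rewrite /G /= mulrAC normrM -mulrDl (ger0_norm (r0 _)).
  by apply: ler_wpM2r; [exact: r0|exact: fkFK].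
Qed.

End bilinear.

End convolution.

(** * Directional derivatives and mean value estimates along coordinates *)

Section directional_derivatives.
Context {R : realType} {N : nat}.
Local Notation E := 'rV[R]_N.
Local Notation e_ j := (delta_mx ord0 j : E).
Implicit Types (f g h : E -> R) (th : R -> R) (j : 'I_N) (x : E).

(** This equivalence makes one-variable results, such as the chain rule and the mean value theorem,
    available for directional derivatives. *)
Lemma is_derive_slice f x (v : E) (s d : R) :
  is_derive (s *: v + x) v f d <-> is_derive s (1 : R) (fun t : R => f (t *: v + x)) d.
Proof.
have E0 : (fun t : R => t^-1 *: ((f \o shift (s *: v + x)) (t *: v) - f (s *: v + x)))
  = (fun t : R => t^-1 *: (((fun t0 : R => f (t0 *: v + x)) \o shift s) (t *: (1 : R))
     - f (s *: v + x))).
  apply/funext => t /=; congr (_ *: (f _ - _)).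
  by rewrite addrA -scalerDl [_ *: 1]mulr1.
split => -[d1 d2]; split; rewrite /derivable /derive in d1 d2 *.
- by rewrite E0 in d1.
- by rewrite E0 in d2.
- by rewrite E0.
- by rewrite E0.
Qed.

Lemma is_derive_comp1 th f x (v : E) (d d' : R) :
  is_derive x v f d -> is_derive (f x) (1 : R) th d' ->
  is_derive x v (fun y => th (f y)) (d' * d).
Proof.
have sx : x = 0 *: v + x by rewrite scale0r add0r.
move=> df dth; rewrite sx; apply/is_derive_slice.
have {}df : is_derive (0 : R) (1 : R) (fun t : R => f (t *: v + x)) d.
  by apply/is_derive_slice; rewrite -sx.
rewrite {1}sx in dth.
have [df1 df2] := df; have [dth1 dth2] := dth.
split.
  apply: (derivable1_diffP (fun t : R => th (f (t *: v + x))) _).2.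
  apply: (@differentiable_comp _ _ _ _ (fun t : R => f (t *: v + x)) th).
    exact: (derivable1_diffP _ _).1 df1.
  exact: (derivable1_diffP _ _).1 dth1.
have := @derive1_comp _ (fun t : R => f (t *: v + x)) th 0 df1 dth1.
by rewrite !derive1E df2 dth2.
Qed.

Lemma is_derive_coord i x (v : E) : is_derive x v (fun y : E => y ord0 i) (v ord0 i).
Proof.
split; first exact/diff_derivable/differentiable_coord.
rewrite /derive; apply: lim_near_cst => //.
near=> t; rewrite /= !mxE addrK scalerA mulVf ?scale1r//.
near: t; exact: nbhs_dnbhs_neq.
Unshelve. all: by end_near. Qed.

Lemma ej_coord (i j : 'I_N) : (e_ j) ord0 i = (i == j)%:R :> R.
Proof. by rewrite mxE eqxx. Qed.

Lemma is_derive_reflV f x (v a : E) (d : R) : is_derive (a - x) v f d ->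
  is_derive x v (fun y => f (a - y)) (- d).
Proof.
move=> H; have sx : x = 0 *: v + x by rewrite scale0r add0r.
rewrite {1}sx; apply/is_derive_slice.
have {}H : is_derive (0 *: v + (a - x)) v f d by rewrite scale0r add0r.
move/is_derive_slice : H => H.
have n0 : (- (@id R) : R -> R) 0 = 0 by exact: oppr0.
have H' : is_derive ((- (@id R) : R -> R) 0) 1 (fun t : R => f (t *: v + (a - x))) d.
  by rewrite n0.
have [H1 H2] := H'.
have E0 : (fun t : R => f (a - (t *: v + x))) = (fun t : R => f (t *: v + (a - x))) \o (- (@id R) : R -> R).
  by apply/funext => t /=; rewrite scaleNr opprD addrCA.
rewrite E0.
have [No1 No2] : is_derive (0 : R) (1 : R) (- (@id R) : R -> R) (-1).
  exact: is_deriveN.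
split.
  apply: (derivable1_diffP _ _).2; apply: differentiable_comp.
    exact: (derivable1_diffP _ _).1 No1.
  exact: (derivable1_diffP _ _).1 H1.
have := @derive1_comp _ (- (@id R) : R -> R) (fun t : R => f (t *: v + (a - x))) 0 No1.
move=> /(_ H1).
by rewrite !derive1E H2 No2 mulrN1.
Qed.

Lemma coord_norm_le (x : E) i : `|x ord0 i| <= `|x|.
Proof.
rewrite [leRHS]mx_normrE.
exact: (le_bigmax _ (fun ij : 'I_1 * 'I_N => `|x ij.1 ij.2|) (ord0, i)).
Qed.

Section mean_value.

Lemma derive_mvt f x j (s : R) (M : R) :
  (forall y, derivable f y (e_ j)) ->
  (forall t : R, `|t| <= `|s| -> `|partial j f (t *: e_ j + x)| <= M) ->
  `|f (s *: e_ j + x) - f x| <= M * `|s|.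
Proof.
move=> df fM.
pose g t := f (t *: e_ j + x).
have dg t : is_derive t (1 : R) g (partial j f (t *: e_ j + x)).
  by apply/is_derive_slice; split.
have cg t : {for t, continuous g}.
  by apply: differentiable_continuous; apply/derivable1_diffP; have [] := dg t.
have g0 : g 0 = f x by rewrite /g scale0r add0r.
rewrite -/(g s) -g0.
have [s0|s0] := leP 0 s.
- have [c] := MVT_segment s0 (fun t _ => dg t) (continuous_subspaceT cg).
  rewrite in_itv/= => /andP[c0 cs] ->; rewrite subr0 normrM ler_wpM2r// fM//.
  by rewrite !ger0_norm.
- have [c] := MVT_segment (ltW s0) (fun t _ => dg t) (continuous_subspaceT cg).
  rewrite in_itv/= => /andP[c0 cs] gE.
  rewrite distrC gE sub0r normrM normrN ler_wpM2r// fM//.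
  by rewrite !ler0_norm ?lerN2// ltW.
Qed.

(** The path from x towards y changes one coordinate at a time. Every intermediate point takes each
    coordinate from x or from y, so it stays in any cube that contains both. *)
Lemma coord_path (x y : E) (s : seq 'I_N) f (C : R) :
  (forall (z : E) j, (forall i, z ord0 i = x ord0 i \/ z ord0 i = y ord0 i) ->
     `|f ((y ord0 j - x ord0 j) *: e_ j + z) - f z| <= C) ->
  uniq s ->
  `|f (\row_i (if i \in s then y ord0 i else x ord0 i)) - f x| <= C *+ size s.
Proof.
move=> H; elim: s => [_|j s IH /= /andP[js us]].
  rewrite (_ : \row_i _ = x) ?subrr ?normr0//.
  by apply/rowP => i; rewrite mxE.
pose z : E := \row_i (if i \in s then y ord0 i else x ord0 i).
rewrite (_ : \row_i _ = (y ord0 j - x ord0 j) *: e_ j + z); last first.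
  apply/rowP => i; rewrite !mxE inE eqxx/=; have [->|ij] := eqVneq i j.
    by rewrite (negbTE js) mulr1 subrK.
  by rewrite mulr0 add0r.
rewrite mulrS (le_trans (ler_distD (f z) _ _))// lerD ?IH//.
by apply: H => i; rewrite mxE; case: ifP; [right|left].
Qed.

Lemma lip_of_partials f (M : R) : (forall j y, derivable f y (e_ j)) ->
  (forall j y, `|partial j f y| <= M) ->
  forall x y, `|f y - f x| <= (M * `|y - x|) *+ N.
Proof.
move=> df fM x y; have := @coord_path x y (enum 'I_N) f (M * `|y - x|).
rewrite size_enum_ord (_ : \row_i _ = y); last first.
  by apply/rowP => i; rewrite mxE mem_enum.
apply; last exact: enum_uniq.
move=> z j _; apply: (@le_trans _ _ (M * `|y ord0 j - x ord0 j|)).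
  by apply: derive_mvt => [|t _]; [exact: df|exact: fM].
have M0 : 0 <= M by rewrite (le_trans _ (fM j 0)).
rewrite ler_wpM2l//; have := coord_norm_le (y - x) j.
by rewrite !mxE.
Qed.

Lemma lip_continuous f (M : R) : (forall x y, `|f y - f x| <= M * `|y - x|) ->
  continuous f.
Proof.
move=> H x; rewrite /continuous_at; apply/(cvgrPdist_le (F := nbhs x)) => e e0.
near=> y; rewrite distrC (le_trans (H x y))//.
have M1 : 0 < `|M| + 1 by rewrite ltr_wpDl.
rewrite (@le_trans _ _ ((`|M| + 1) * `|y - x|))//.
  by rewrite ler_wpM2r// (le_trans (ler_norm M))// lerDl.
rewrite -ler_pdivlMl// distrC; near: y.
by apply: cvgr_dist_le => //; rewrite mulr_gt0// invr_gt0.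
Unshelve. all: by end_near. Qed.

End mean_value.

End directional_derivatives.

(** * Calculus of smooth functions *)

Section smooth_functions.
Context {R : realType} {N : nat}.
Local Notation E := 'rV[R]_N.
Local Notation e_ j := (delta_mx ord0 j : E).
Implicit Types (f g h : E -> R) (th : R -> R) (j : 'I_N) (x : E).

Lemma continuous_add f g : continuous f -> continuous g ->
  continuous (fun x => f x + g x).
Proof. by move=> cf cg x; exact: (@continuousD R R^o _ f g x (cf x) (cg x)). Qed.

Lemma continuous_mul f g : continuous f -> continuous g ->
  continuous (fun x => f x * g x).
Proof. by move=> cf cg x; exact: (@continuousM R _ f g x (cf x) (cg x)). Qed.

(** Smoothness speaks of all iterated partials at once, so closure properties are proved by
    coinduction: it suffices to find a class given by a formula that survives differentiation. *)
Lemma smooth_coind (P : (E -> R) -> Prop) :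
  (forall h, P h -> continuous h /\
     forall j, (forall x, derivable h x (e_ j)) /\ P (partial j h)) ->
  forall h, P h -> smooth h.
Proof.
move=> HP h Ph js; suff /HP[ch dh] : P (partials js h).
  by split => // j x; have [] := dh j.
by elim: js => //= j js /HP[_ /(_ j)[]].
Qed.

Lemma smooth_continuous h : smooth h -> continuous h.
Proof. by move=> /(_ [::])[]. Qed.

Lemma smooth_derivable h x j : smooth h -> derivable h x (e_ j).
Proof. by move=> /(_ [::])[_]; exact. Qed.

Lemma partials_rcons js j h : partials (rcons js j) h = partials js (partial j h).
Proof. by rewrite /partials foldr_rcons. Qed.

Lemma smooth_partial j h : smooth h -> smooth (partial j h).
Proof. by move=> sh js; have := sh (rcons js j); rewrite partials_rcons. Qed.

Lemma smooth_is_derive h x j : smooth h -> is_derive x (e_ j) h (partial j h x).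
Proof. by move=> sh; split => //; exact: smooth_derivable. Qed.

Local Opaque smooth.

Lemma smooth_meas h : smooth h -> meas h.
Proof. by move=> /smooth_continuous; exact: continuous_meas. Qed.

Lemma is_derive_partial j h h' : (forall x, is_derive x (e_ j) h (h' x)) ->
  partial j h = h'.
Proof. by move=> H; apply/funext => x; have [] := H x. Qed.

Lemma smooth_cst (c : R) : smooth (fun _ : E => c).
Proof.
apply: (@smooth_coind (fun h => exists c, h = fun=> c)); last by exists c.
move=> _ [{}c ->]; split; first exact: cst_continuous.
move=> j; have H x : is_derive x (e_ j) (fun=> c) 0 by exact: is_derive_cst.
split; first by move=> x; have [] := H x.
by exists 0; exact: is_derive_partial.
Qed.

Lemma partialD j f g : smooth f -> smooth g ->
  partial j (fun x => f x + g x) = fun x => partial j f x + partial j g x.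
Proof.
move=> sf sg; apply: is_derive_partial => x.
exact: (is_deriveD (smooth_is_derive x j sf) (smooth_is_derive x j sg)).
Qed.

Lemma partialM j f g : smooth f -> smooth g ->
  partial j (fun x => f x * g x) =
  fun x => partial j f x * g x + f x * partial j g x.
Proof.
move=> sf sg; apply: is_derive_partial => x.
have := is_deriveM (smooth_is_derive x j sf) (smooth_is_derive x j sg).
by move/is_derive_eq; apply; rewrite /GRing.scale/=; ring.
Qed.

Lemma smoothD f g : smooth f -> smooth g -> smooth (fun x => f x + g x).
Proof.
move=> sf sg.
apply: (@smooth_coind (fun h => exists f g, [/\ smooth f, smooth g & h = fun x => f x + g x]));
  last by exists f, g.
move=> _ [{}f [{}g [{}sf {}sg ->]]]; split.
  exact: continuous_add (smooth_continuous sf) (smooth_continuous sg).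
move=> j; split.
  by move=> x; apply: derivableD; exact: smooth_derivable.
by exists (partial j f), (partial j g); split;
  [exact: smooth_partial..|exact: partialD].
Qed.

Lemma smooth_sum (I : Type) (s : seq I) (F : I -> E -> R) :
  (forall i, smooth (F i)) -> smooth (fun x => \sum_(i <- s) F i x).
Proof.
move=> sF; elim: s => [|i s IH].
  by under eq_fun do rewrite big_nil; exact: smooth_cst.
by under eq_fun do rewrite big_cons; exact: (smoothD (sF i) IH).
Qed.

(** Single products are not stable under differentiation, but finite sums of products are: Leibniz's
    rule replaces each pair (f, g) by (D f, g) and (f, D g). *)
Lemma smoothM f g : smooth f -> smooth g -> smooth (fun x => f x * g x).
Proof.
move=> sf sg.
apply: (@smooth_coind (fun h => exists s : seq ((E -> R) * (E -> R)),
   (forall p, List.In p s -> smooth p.1 /\ smooth p.2) /\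
   h = fun x => \sum_(p <- s) p.1 x * p.2 x)); last first.
  exists [:: (f, g)]; split; first by move=> p [<-|[]]; exact: (conj sf sg).
  by apply/funext => x; rewrite big_cons big_nil addr0.
move=> _ [s [Hs ->]]; split.
  elim: s Hs => [_|p s IH Hs].
    by under eq_fun do rewrite big_nil; exact: cst_continuous.
  under eq_fun do rewrite big_cons.
  have [s1 s2] := Hs p (or_introl erefl).
  have cs := IH (fun q qs => Hs q (or_intror qs)).
  apply: (continuous_add _ cs).
  exact: continuous_mul (smooth_continuous s1) (smooth_continuous s2).
move=> j.
pose s' := flatten [seq [:: (partial j p.1, p.2); (p.1, partial j p.2)] | p <- s].
have H x : is_derive x (e_ j) (fun x => \sum_(p <- s) p.1 x * p.2 x)
    (\sum_(p <- s') p.1 x * p.2 x).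
  rewrite /s'; elim: s Hs {s'} => [_|p s IH Hs].
    by under eq_fun do rewrite big_nil; rewrite big_nil; exact: is_derive_cst.
  under eq_fun do rewrite big_cons.
  rewrite /= !big_cons addrA.
  have [s1 s2] := Hs p (or_introl erefl).
  apply: is_deriveD; last exact: (IH (fun r rs => Hs r (or_intror rs))).
  have := is_deriveM (smooth_is_derive x j s1) (smooth_is_derive x j s2).
  by move/is_derive_eq; apply; rewrite /GRing.scale/=; ring.
split; first by move=> x; have [] := H x.
exists s'; split; last exact: is_derive_partial.
rewrite /s'; elim: s Hs {s' H} => [//|p s IH Hs] q /=.
have [s1 s2] := Hs p (or_introl erefl).
move=> [<-|[<-|qs]] /=.
- by split; [exact: smooth_partial|exact: s2].
- by split; [exact: s1|exact: smooth_partial].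
- by apply: (IH (fun r rs => Hs r (or_intror rs))).
Qed.

Lemma smoothZ (c : R) f : smooth f -> smooth (fun x => c * f x).
Proof. exact/smoothM/smooth_cst. Qed.

Lemma smoothN f : smooth f -> smooth (fun x => - f x).
Proof. by move=> /(smoothZ (-1)); under eq_fun do rewrite mulN1r. Qed.

Lemma smoothB f g : smooth f -> smooth g -> smooth (fun x => f x - g x).
Proof. by move=> sf sg; exact: (smoothD sf (smoothN sg)). Qed.

Lemma partialZ j c f : smooth f ->
  partial j (fun x => c * f x) = fun x => c * partial j f x.
Proof.
move=> sf; apply: is_derive_partial => x.
exact: (is_deriveZ c (smooth_is_derive x j sf)).
Qed.

Lemma partial_sum j (I : Type) (s : seq I) (F : I -> E -> R) :
  (forall i, smooth (F i)) ->
  partial j (fun x => \sum_(i <- s) F i x) = fun x => \sum_(i <- s) partial j (F i) x.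
Proof.
move=> sF; elim: s => [|i s IH].
  apply: is_derive_partial => x.
  by under eq_fun do rewrite big_nil; rewrite big_nil; exact: is_derive_cst.
under eq_fun do rewrite big_cons.
rewrite partialD//; last exact: smooth_sum.
by rewrite IH; apply/funext => x; rewrite big_cons.
Qed.

Lemma smooth_prod (I : Type) (s : seq I) (F : I -> E -> R) :
  (forall i, smooth (F i)) -> smooth (fun x => \prod_(i <- s) F i x).
Proof.
move=> sF; elim: s => [|i s IH].
  by under eq_fun do rewrite big_nil; exact: smooth_cst.
by under eq_fun do rewrite big_cons; exact: (smoothM (sF i) IH).
Qed.

Lemma continuous_refl (a : E) : continuous (fun x : E => a - x).
Proof. by move=> x; exact: (@continuousB R E E (cst a) id x (@cst_continuous _ _ a x) (@cvg_id _ _)). Qed.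

Lemma partial_refl j f (a : E) : smooth f ->
  partial j (fun x => f (a - x)) = fun x => - partial j f (a - x).
Proof.
move=> sf; apply: is_derive_partial => x.
exact: (is_derive_reflV (smooth_is_derive (a - x) j sf)).
Qed.

Lemma smooth_refl f (a : E) : smooth f -> smooth (fun x => f (a - x)).
Proof.
move=> sf.
apply: (@smooth_coind (fun h => exists f, smooth f /\ h = fun x => f (a - x)));
  last by exists f.
move=> _ [{}f [{}sf ->]]; split.
  move=> x; apply: (@continuous_comp _ _ _ (fun y : E => a - y) f).
    exact: continuous_refl.
  exact: (smooth_continuous sf).
move=> j; split.
  by move=> x; have [] := is_derive_reflV (smooth_is_derive (a - x) j sf).
exists (fun x => - partial j f x); split; last exact: partial_refl.
exact/smoothN/smooth_partial.
Qed.

Lemma smooth_partials js f : smooth f -> smooth (partials js f).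
Proof.
by move=> sf; elim: js => [|j js IH]; [exact: sf|exact: smooth_partial].
Qed.

Lemma partials_refl (js : seq 'I_N) f (a : E) x : smooth f ->
  partials js (fun x => f (a - x)) x = (-1) ^+ size js * partials js f (a - x).
Proof.
elim: js x => [|j js IH] x sf; first by rewrite mul1r.
rewrite /= (_ : partials js (fun _ => _) =
  fun x => (-1) ^+ size js * partials js f (a - x)); last first.
  by apply/funext => y; rewrite IH.
have sp := smooth_partials js sf.
rewrite partialZ; last exact: smooth_refl.
by rewrite partial_refl// exprS mulN1r mulNr mulrN.
Qed.

Definition smooth1 th := forall (n : nat) (x : R), derivable (derive1n n th) x 1.

Lemma smooth1_is_derive th n (x : R) : smooth1 th ->
  is_derive x (1 : R) (derive1n n th) (derive1n n.+1 th x).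
Proof. by move=> sth; split; [exact: sth|rewrite derive1nS derive1E]. Qed.

Lemma smooth_coord th (a b : R) (i : 'I_N) : smooth1 th ->
  smooth (fun x => th (a * x ord0 i + b)).
Proof.
move=> sth.
apply: (@smooth_coind (fun h => exists c n,
  h = fun x => c * derive1n n th (a * x ord0 i + b))); last first.
  by exists 1, 0%N; apply/funext => x; rewrite mul1r.
move=> _ [c [n ->]]; split.
  apply: continuous_mul; first exact: cst_continuous.
  move=> x; apply: (@continuous_comp _ _ _ (fun x : E => a * x ord0 i + b) (derive1n n th)).
    apply: continuous_add; last exact: cst_continuous.
    by apply: continuous_mul; [exact: cst_continuous|exact: coord_continuous].
  by apply: differentiable_continuous; apply/derivable1_diffP; exact: sth.
move=> j; have H x : is_derive x (e_ j)
    (fun x => c * derive1n n th (a * x ord0 i + b))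
    (c * (a * (i == j)%:R) * derive1n n.+1 th (a * x ord0 i + b)).
  have H1 : is_derive x (e_ j) (fun x : E => a * x ord0 i + b) (a *: (e_ j) ord0 i + 0).
    exact: (is_deriveD (is_deriveZ a (is_derive_coord i x (e_ j)))
      (@is_derive_cst R E R b x (e_ j))).
  have := is_deriveZ c (is_derive_comp1 H1 (smooth1_is_derive n _ sth)).
  by move/is_derive_eq; apply; rewrite ej_coord /GRing.scale/=; ring.
split; first by move=> x; have [] := H x.
by exists (c * (a * (i == j)%:R)), n.+1; exact: is_derive_partial.
Qed.

Lemma smooth_coordE (i : 'I_N) : smooth (fun x => x ord0 i).
Proof.
apply: (@smooth_coind (fun h => h = (fun x => x ord0 i) \/ exists c, h = fun=> c));
  last by left.
move=> _ [->|[c ->]].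
  split; first exact: coord_continuous.
  move=> j; split; first by move=> x; have [] := is_derive_coord i x (e_ j).
  right; exists (i == j)%:R; apply: is_derive_partial => x.
  by rewrite -ej_coord; exact: is_derive_coord.
split; first exact: cst_continuous.
move=> j; have H x : is_derive x (e_ j) (fun=> c) 0 by exact: is_derive_cst.
split; first by move=> x; have [] := H x.
by right; exists 0; exact: is_derive_partial.
Qed.

End smooth_functions.

(** * Real test functions supported in cubes *)

Section test_functions.
Context {R : realType} {N : nat}.
Local Opaque Rintegral integrable smooth.
Local Notation E := 'rV[R]_N.
Local Notation mu := (leb N : {measure set E -> \bar R}).
Local Notation intg := (rintegrable mu).
Local Notation e_ j := (delta_mx ord0 j : E).
Implicit Types (f g h r : E -> R) (j : 'I_N) (x : E).

Lemma dotvv_ge0 x : 0 <= dotv x x.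
Proof. by apply: sumr_ge0 => i _; rewrite -expr2 sqr_ge0. Qed.

Lemma enorm_ge0 x : 0 <= enorm x.
Proof. exact: sqrtr_ge0. Qed.

Lemma sqr_enorm x : enorm x ^+ 2 = dotv x x.
Proof. by rewrite sqr_sqrtr// dotvv_ge0. Qed.

Lemma coord_le_enorm x i : `|x ord0 i| <= enorm x.
Proof.
rewrite -(@ler_pXn2r _ 2)// ?nnegrE ?enorm_ge0//.
rewrite sqr_enorm real_normK ?num_real// /dotv (bigD1 i)//= expr2 lerDl.
by apply: sumr_ge0 => k _; rewrite -expr2 sqr_ge0.
Qed.

Lemma enorm_le_coords x (c : R) : 0 <= c -> (forall i, `|x ord0 i| <= c) ->
  enorm x <= N%:R * c.
Proof.
move=> c0 H.
rewrite -(@ler_pXn2r _ 2)// ?nnegrE ?enorm_ge0 ?mulr_ge0//.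
rewrite sqr_enorm /dotv (@le_trans _ _ (\sum_(j < N) c ^+ 2))//.
  apply: ler_sum => i _; rewrite -expr2 -real_normK ?num_real//.
  by rewrite ler_pXn2r// ?nnegrE.
rewrite sumr_const card_ord -[leLHS]mulr_natl exprMn ler_wpM2r ?sqr_ge0//.
by rewrite -natrX ler_nat; case: N => // n; rewrite expnS expn1 leq_pmulr.
Qed.

(* Supports are contained in cubes rather than balls, so that coordinates
   can be treated one at a time. *)
Definition supp_in (c : R) f := forall x i, c < `|x ord0 i| -> f x = 0.

Definition rtest h := smooth h /\ exists c, supp_in c h.

Lemma supp_in_le (c c' : R) f : c <= c' -> supp_in c f -> supp_in c' f.
Proof. by move=> cc' sf x i /(le_lt_trans cc'); exact: sf. Qed.

Lemma cRe_cOf h : cRe (cOf h) = h. Proof. by []. Qed.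
Lemma cIm_cOf h : cIm (cOf h) = fun=> 0. Proof. by []. Qed.

Lemma rtest_real_test h : rtest h -> real_test_fun h.
Proof.
move=> [sh [c sc]]; split.
  split; rewrite ?cRe_cOf ?cIm_cOf; [exact: sh|exact: smooth_cst].
exists (N%:R * `|c|) => x cx; rewrite /cOf.
suff [i xi] : exists i, c < `|x ord0 i| by rewrite (sc x i xi).
apply: contrapT => /forallNP H.
suff : enorm x <= N%:R * `|c| by rewrite leNgt cx.
apply: enorm_le_coords => // i; have /negP := H i.
by rewrite -leNgt => /le_trans; apply; exact: ler_norm.
Qed.

Lemma compact_cube (c : R) : compact [set x : E | forall i, `[- c, c]%classic (x ord0 i)].
Proof. by apply: (@rV_compact R N (fun=> `[- c, c]%classic)) => i; exact: segment_compact. Qed.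

Lemma continuous_supp_bounded h (c : R) : continuous h -> supp_in c h ->
  exists2 M, 0 <= M & bounded_by M h.
Proof.
move=> ch sh.
pose A := [set x : E | forall i, `[- c, c]%classic (x ord0 i)].
have outA x : ~ A x -> h x = 0.
  move=> nAx; have [i xi] : exists i, ~ `[- c, c]%classic (x ord0 i).
    by apply: contrapT => /forallNP H; apply: nAx => i; apply: contrapT; exact: H.
  by apply: (sh x i); rewrite ltNge; apply/negP; rewrite ler_norml; move: xi; rewrite /= in_itv.
(* For c < 0 and N > 0 the cube is empty and h vanishes identically; the extreme value theorem needs
   a point. *)
have [A0|nA0] := pselect (A !=set0); last first.
  by exists 0 => // x; rewrite outA ?normr0// => Ax; apply: nA0; exists x.
have cn : {within A, continuous (fun x => `|h x|)}.
  apply: continuous_subspaceT => x.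
  by apply: (@continuous_comp _ _ _ h (@Num.norm R R)); [exact: ch|exact: norm_continuous].
have [y Ay yM] := EVT_max_rV A0 (@compact_cube c) cn.
exists `|h y| => // x.
have [Ax|nAx] := pselect (A x); first by apply: yM; rewrite inE.
by rewrite outA ?normr0.
Qed.

Definition cube (c : R) := [set x : E | forall i, `|x ord0 i| <= c].

Lemma intg_indic_cube (c : R) : intg (\1_(cube c)).
Proof.
have mc : measurable (cube c) by exact: measurable_cube.
apply/integrableP; split; first exact/measurable_EFinP.
rewrite (eq_integral (fun x => (\1_(cube c) x)%:E)); last first.
  by move=> x _ /=; rewrite ger0_norm.
rewrite integral_indic// setIT.
apply: (@le_lt_trans _ _ (leb N (cube `|c|))).
  apply: le_measure; rewrite ?inE//; first exact: measurable_cube.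
  by move=> x H i; rewrite (le_trans (H i))// ler_norm.
by rewrite leb_cube// ltry.
Qed.

Lemma supp_bounded_intg h (c M : R) : meas h -> bounded_by M h -> supp_in c h ->
  intg h.
Proof.
move=> mh hM sh; apply: (@le_intg _ _ _ mu h (fun x => M * \1_(cube c) x) mh).
  move=> x; rewrite indicE; have [xc|/negP xc] := boolP (x \in cube c).
    by rewrite mulr1; exact: hM.
  rewrite mulr0 normr_le0; apply/eqP.
  apply: contrapT => hx; apply: xc; rewrite inE => i.
  by rewrite leNgt; apply/negP => /sh.
exact/intgZ/intg_indic_cube.
Qed.

Lemma rtest_bounded h : rtest h -> exists2 M, 0 <= M & bounded_by M h.
Proof.
by move=> [sh [c sc]]; exact: continuous_supp_bounded (smooth_continuous sh) sc.
Qed.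

Lemma rtest_intg h : rtest h -> intg h.
Proof.
move=> th; have [M _ hM] := rtest_bounded th; have [sh [c sc]] := th.
exact: supp_bounded_intg (smooth_meas sh) hM sc.
Qed.

Lemma partial_supp j h (c : R) : supp_in c h -> supp_in c (partial j h).
Proof.
move=> sc x i xi.
have nx : nbhs x [set y : E | c < `|y ord0 i|].
  have cn : (fun y : E => `|y ord0 i|) @ x --> `|x ord0 i|.
    by apply: (@continuous_comp _ _ _ (fun y : E => y ord0 i) (@Num.norm R R));
      [exact: coord_continuous|exact: norm_continuous].
  exact: cvgr_gt cn _ xi.
rewrite /partial -(@near_eq_derive R E R (fun=> 0)) ?derive_cst//.
by apply: filterS nx => y yi; rewrite (sc y i yi).
Qed.

Lemma rtest_partial j h : rtest h -> rtest (partial j h).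
Proof.
move=> [sh [c sc]]; split; first exact: smooth_partial.
by exists c; exact: partial_supp.
Qed.

Lemma rtestM_smooth f h : smooth f -> rtest h -> rtest (fun x => f x * h x).
Proof.
move=> sf [sh [c sc]]; split; first exact: smoothM.
by exists c => x i xi; rewrite (sc x i xi) mulr0.
Qed.

Lemma rtestZ (c : R) h : rtest h -> rtest (fun x => c * h x).
Proof. by move=> th; apply: (rtestM_smooth _ th); exact: smooth_cst. Qed.

Lemma rtest_refl f (a : E) : rtest f -> rtest (fun x => f (a - x)).
Proof.
move=> [sf [c sc]]; split; first exact: smooth_refl.
exists (c + `|a|) => x i xi; apply: (sc _ i).
have ai := coord_norm_le a i; rewrite !mxE.
have := ler_normB (a ord0 i - x ord0 i) (a ord0 i).
rewrite addrAC subrr add0r normrN => xai.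
rewrite -(ltrD2r `|a|); apply: (lt_le_trans xi); apply: (le_trans xai).
by rewrite lerD2l.
Qed.

End test_functions.

(** * Smooth convolutions and one-sided mollifiers *)

Section mollifiers.
Context {R : realType} {N : nat}.
Local Notation E := 'rV[R]_N.
Local Notation mu := (leb N : {measure set E -> \bar R}).
Local Notation intg := (rintegrable mu).
Local Notation e_ j := (delta_mx ord0 j : E).
Implicit Types (f g h r : E -> R) (j : 'I_N) (x : E).

Lemma rtest_supp_conv f r (c c' : R) x i : supp_in c f -> supp_in c' r ->
  c + c' < `|x ord0 i| -> forall y, f y * r (x - y) = 0.
Proof.
move=> sf sr xi y.
have [yi|yi] := leP `|y ord0 i| c; last by rewrite (sf y i yi) mul0r.
rewrite (sr _ i) ?mulr0// !mxE.
have := ler_normD (x ord0 i - y ord0 i) (y ord0 i); rewrite subrK => h.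
by have := lt_le_trans xi h; lra.
Qed.

Lemma conv_supp f r (c c' : R) : supp_in c f -> supp_in c' r ->
  supp_in (c + c') (convol f r).
Proof.
move=> sf sr x i xi; rewrite /convol.
under eq_int do rewrite (rtest_supp_conv sf sr xi).
exact: int0.
Qed.

(** Along e_j the convolution is an integral depending on a parameter s, and the derivative of its
    integrand is dominated by M |f| uniformly in s, so it may be differentiated under the
    integral. *)
Lemma conv_is_derive f r x j : intg f -> rtest r ->
  is_derive x (e_ j) (convol f r) (convol f (partial j r) x).
Proof.
move=> If tr; have [sr _] := tr.
have [M0 _ rM0] := rtest_bounded tr.
have [M M_ge0 rM] := rtest_bounded (rtest_partial j tr).
have sx : x = 0 *: e_ j + x by rewrite scale0r add0r.
rewrite {1}sx; apply/is_derive_slice.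
pose F (s : R) (y : E) := f y * r (s *: e_ j + (x - y)).
have FE (s : R) : convol f r (s *: e_ j + x) = \int[mu]_y F s y.
  by rewrite /convol; apply: eq_int => y; rewrite /F addrA.
have dF (s : R) y : is_derive s (1 : R) (F ^~ y) (f y * partial j r (s *: e_ j + (x - y))).
  have H : is_derive s (1 : R) (fun s : R => r (s *: e_ j + (x - y)))
      (partial j r (s *: e_ j + (x - y))).
    by apply/is_derive_slice; exact: smooth_is_derive.
  exact: (is_deriveZ (f y) H).
have dFE s y : partial1of2 F s y = f y * partial j r (s *: e_ j + (x - y)).
  by rewrite partial1of2E; have [] := dF s y.
have IF s : -1 < s < 1 -> (leb N).-integrable setT (EFin \o F s).
  move=> _; have := intg_conv_kernel (s *: e_ j + x) If (smooth_meas sr) rM0.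
  by under eq_fun do rewrite -addrA.
have IG : (leb N).-integrable setT (EFin \o (fun y => M * `|f y|)).
  exact: intgZ (intg_norm If).
have h0 : `]-1, 1[%classic (0 : R) by rewrite /= in_itv/= ltrN10 ltr01.
have dF1 s y : `]-1, 1[%classic s -> setT y -> derivable (F ^~ y) s 1.
  by move=> _ _; have [] := dF s y.
have IF1 s : `]-1, 1[%classic s -> (leb N).-integrable setT (EFin \o F s).
  by rewrite /= in_itv; exact: IF.
have G0 y : 0 <= M * `|f y| by rewrite mulr_ge0.
have bd s y : `]-1, 1[%classic s -> setT y -> `|partial1of2 F s y| <= M * `|f y|.
  move=> _ _; rewrite dFE normrM mulrC; apply: ler_wpM2r => //; exact: rM.
have D := @derivable_under_integral R _ E (leb N) F setT measurableT 0 (-1) 1 h0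
  IF1 dF1 _ G0 IG bd.
have V := @differentiation_under_integral R _ E (leb N) F setT measurableT 0 (-1) 1 h0
  IF1 dF1 _ G0 IG bd.
rewrite (_ : (fun t : R => convol f r (t *: e_ j + x)) = fun t => \int[mu]_y F t y);
  last by apply/funext => s; exact: FE.
split; first exact: D.
rewrite -derive1E V /convol; apply: eq_int => y.
by rewrite dFE scale0r add0r.
Qed.

Lemma partial_conv f r j : intg f -> rtest r ->
  partial j (convol f r) = convol f (partial j r).
Proof.
by move=> If tr; apply: is_derive_partial => x; exact: conv_is_derive.
Qed.

(** The partial derivatives are convolutions of f with bounded functions, hence bounded, so the
    convolution is Lipschitz. *)
Lemma conv_continuous f r : intg f -> rtest r -> continuous (convol f r).
Proof.
move=> If tr.
have bd j : exists M, bounded_by M (partial j (convol f r)).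
  have tp := rtest_partial j tr; have [M M0 rM] := rtest_bounded tp.
  rewrite partial_conv//; exists ((\int[mu]_y `|f y|) * M).
  exact: (conv_bounded If (intg_meas (rtest_intg tp)) rM _ M0).
have [C hC] := choice bd.
pose M := \sum_(j < N) `|C j|.
apply: (@lip_continuous _ _ _ (M *+ N)) => x y.
rewrite mulrnAl; apply: lip_of_partials => [j z|j z].
  by have [] := conv_is_derive z j If tr.
rewrite (le_trans (hC j z))// (le_trans (ler_norm _))// /M (bigD1 j)//= lerDl.
exact: sumr_ge0.
Qed.

Lemma conv_smooth f r : intg f -> rtest r -> smooth (convol f r).
Proof.
move=> If tr.
apply: (@smooth_coind _ _ (fun h => exists2 r, rtest r & h = convol f r)); last by exists r.
move=> _ [{tr}r tr ->]; split; first exact: conv_continuous.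
move=> j; split; first by move=> x; have [] := conv_is_derive x j If tr.
by exists (partial j r); [exact: rtest_partial|exact: partial_conv].
Qed.

Lemma conv_rtest f r (c : R) : intg f -> supp_in c f -> rtest r ->
  rtest (convol f r).
Proof.
move=> If sf tr; split; first exact: conv_smooth.
by have [_ [c' sr]] := tr; exists (c + c'); exact: conv_supp.
Qed.

(* The one-sided support makes the mollified indicator of the orthant
   {x | a <= x} equal to 1 on the orthant itself. *)
Definition mollifier (rho : nat -> E -> R) := forall n,
  [/\ rtest (rho n), forall x, 0 <= rho n x, \int[mu]_x rho n x = 1 &
      forall x, rho n x != 0 ->
        forall i, - 5 / n.+1%:R < x ord0 i < 0].

Lemma mollifier_exists (th : R -> R) : smooth1 th ->
  (forall s : R, `|s| <= 1 -> th s = 1) -> (forall s : R, 2 <= `|s| -> th s = 0) ->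
  exists rho, mollifier rho.
Proof.
move=> sth th1 th0.
(* As [th] vanishes off ]-2, 2[, a factor is nonzero only for (n + 1) x_i in ]-5, -1[: the shift by
   3 makes the support one-sided. The square is there because [th] may change sign. *)
pose kap (n : nat) x := \prod_(i < N) th (n.+1%:R * x ord0 i + 3) ^+ 2.
have kap0 n x : 0 <= kap n x.
  by apply: prodr_ge0 => i _; exact: sqr_ge0.
have kapx n x : kap n x != 0 -> forall i, - 5 / n.+1%:R < x ord0 i < 0.
  move=> kx i.
  have : th (n.+1%:R * x ord0 i + 3) != 0.
    by apply: contra_neq kx => ti; rewrite /kap (bigD1 i)//= ti expr0n mul0r.
  have n0 : (0 : R) < n.+1%:R by [].
  have [/th0 ->|lt2 _] := leP 2 `|n.+1%:R * x ord0 i + 3|; first by rewrite eqxx.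
  move: lt2; rewrite ltr_norml => /andP[h1 h2]; apply/andP; split.
    by rewrite ltr_pdivrMr// mulrC; lra.
  by rewrite -(pmulr_rlt0 _ n0); lra.
have tk n : rtest (kap n).
  split.
    rewrite /kap; apply: smooth_prod => i; under eq_fun do rewrite expr2.
    by apply: smoothM; exact: smooth_coord.
  exists 5 => x i xi; apply: contrapT => /eqP/kapx/(_ i)/andP[h1 h2].
  move: xi; rewrite ltr0_norm// => xi.
  suff H5 : - 5 <= - 5 / n.+1%:R :> R.
    by have := le_lt_trans H5 h1; rewrite ltrNl ltNge (ltW xi).
  rewrite -[leLHS]mulr1; apply: ler_wnM2l; first by rewrite oppr_le0.
  by rewrite invf_le1 ?ler1n.
(* [kap n] equals 1 on the cube of half-side 1 / (n + 1) about the point with all coordinates -3 /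
   (n + 1), so its integral is at least the volume of that cube. *)
have ck n : 0 < \int[mu]_x kap n x.
  have n0 : (0 : R) < n.+1%:R by [].
  pose a : E := const_mx (- 3 / n.+1%:R).
  pose B := cube (n.+1%:R^-1 : R).
  have Ia := intg_shift (- a) (@intg_indic_cube R N n.+1%:R^-1).
  apply: (@lt_le_trans _ _ (\int[mu]_x \1_(cube (n.+1%:R^-1 : R)) (x - a))); last first.
    apply: le_int => [//||x]; first exact/rtest_intg/tk.
    rewrite indicE; have [|_] := boolP (x - a \in _); last exact: kap0.
    rewrite inE => H; rewrite /kap big1// => i _.
    rewrite th1 ?expr1n//.
    have := H i; rewrite !mxE => Hi.
    rewrite (_ : _ + 3 = n.+1%:R * (x ord0 i - - 3 / n.+1%:R)); last first.
      by field; rewrite ?gt_eqF//.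
    by rewrite normrM gtr0_norm// mulrC -ler_pdivlMr// mul1r.
  rewrite (int_shift (- a) (@intg_indic_cube R N n.+1%:R^-1)).
  have -> : \int[mu]_x (\1_(cube n.+1%:R^-1) x : R) = (2 * n.+1%:R^-1) ^+ N.
    apply: EFin_inj; rewrite -intE; last exact: intg_indic_cube.
    rewrite integral_indic//; last exact: measurable_cube.
    by rewrite setIT; apply: leb_cube; rewrite invr_ge0.
  by rewrite exprn_gt0// mulr_gt0// invr_gt0.
exists (fun n x => (\int[mu]_x kap n x)^-1 * kap n x) => n; split.
- exact: rtestZ.
- by move=> x; rewrite mulr_ge0// invr_ge0 ltW.
- by rewrite intZ ?mulVf ?gt_eqF//; exact: rtest_intg.
- by move=> x; rewrite mulf_eq0 negb_or => /andP[_ /kapx].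
Qed.

End mollifiers.

(** * Weak convergence of mollified functions *)

Lemma dist_third (R : realFieldType) (a b a' b' e : R) : `|a - a'| <= e / 3 ->
  `|a - b| <= e / 3 -> `|a' - b'| <= e / 3 -> `|b - b'| <= e.
Proof.
rewrite !ler_norml => /andP[? ?] /andP[? ?] /andP[? ?].
by apply/andP; split; lra.
Qed.

Lemma small_shift (R : realFieldType) (a x y t : R) : - 5 * t < x - y ->
  t < (a - x) / 5 -> a <= y -> False.
Proof. by lra. Qed.

Section orthants.
Context {R : realType} {N : nat}.
Local Notation E := 'rV[R]_N.

(** Upper orthants form a pi-system generating the measurable sets, and their shape is matched to
    the one-sided support of the mollifiers. *)
Definition orthant (a : E) := [set x : E | forall i, a ord0 i <= x ord0 i].
Definition orthants : set (set E) := range orthant.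

Lemma orthantsI : setI_closed orthants.
Proof.
move=> _ _ [a _ <-] [b _ <-].
exists (\row_i Num.max (a ord0 i) (b ord0 i)) => //.
apply/seteqP; split => x /=.
  by move=> H; split => i; have := H i; rewrite mxE ge_max => /andP[].
by move=> [H1 H2] i; rewrite mxE ge_max H1 H2.
Qed.

(** A half-space b <= x_i is the union over m of the orthants whose corner has i-th coordinate b and
    all others equal to - m; half-spaces generate the cylinders. *)
Lemma measurable_orthants (A : set E) : measurable A -> <<s orthants >> A.
Proof.
apply: smallest_sub; first exact: smallest_sigma_algebra.
move=> _ [i [B [mB ->]]].
pose T := g_sigma_algebraType orthants.
have mf : measurable_fun [set: T] (fun x : T => (x : E) ord0 i : measurableTypeR R).
  apply: (@measurability _ _ T (measurableTypeR R) setT _ (@RGenCInfty.G R)).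
    exact: RGenCInfty.measurableE.
  move=> _ [_ [b ->] <-]; rewrite setTI.
  rewrite (_ : _ @^-1` _ = \bigcup_(m : nat)
     orthant (\row_j if j == i then b else - m%:R)).
    apply: bigcupT_measurable => m; apply: sub_sigma_algebra.
    by eexists.
  apply/seteqP; split => x /=.
    rewrite in_itv/= andbT => bx.
    have [m xm] : exists m : nat, forall j, `|x ord0 j| <= m%:R.
      exists (Num.truncn `|x|).+1 => j.
      by rewrite (le_trans (coord_norm_le x j))// ltW// truncnS_gt.
    exists m => // j; rewrite mxE; case: eqP => [->//|_].
    by have := xm j; rewrite ler_norml => /andP[].
  by move=> [m _ /(_ i)]; rewrite mxE eqxx in_itv/= andbT.
by have := mf measurableT B mB; rewrite setTI.
Qed.

End orthants.

Section weak_convergence.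
Context {R : realType} {N : nat}.
Local Notation E := 'rV[R]_N.
Local Notation mu := (leb N : {measure set E -> \bar R}).
Local Notation intg := (rintegrable mu).
Implicit Types (f g h k r : E -> R) (x : E).

Lemma convolD f g r (M : R) : intg f -> intg g -> meas r -> bounded_by M r ->
  convol (fun x => f x + g x) r = fun x => convol f r x + convol g r x.
Proof.
move=> If Ig mr rM; apply/funext => x.
rewrite /convol -intD; [|exact: intg_conv_kernel If mr rM|exact: intg_conv_kernel Ig mr rM].
by apply: eq_int => y; rewrite mulrDl.
Qed.

Lemma convolZ (c : R) f r (M : R) : intg f -> meas r -> bounded_by M r ->
  convol (fun x => c * f x) r = fun x => c * convol f r x.
Proof.
move=> If mr rM; apply/funext => x.
rewrite /convol -intZ; last exact: intg_conv_kernel If mr rM.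
by apply: eq_int => y; rewrite mulrA.
Qed.

Variables (rho : nat -> E -> R).
Hypothesis Hrho : mollifier rho.

Let trho n : rtest (rho n). Proof. by have [] := Hrho n. Qed.
Let rho0 n x : 0 <= rho n x. Proof. by have [] := Hrho n. Qed.
Let rho1 n : \int[mu]_x rho n x = 1. Proof. by have [] := Hrho n. Qed.
Let rhos n x : rho n x != 0 -> forall i, - 5 / n.+1%:R < x ord0 i < 0.
Proof. by have [_ _ _] := Hrho n; apply. Qed.
Let mrho n : meas (rho n). Proof. exact: intg_meas (rtest_intg (trho n)). Qed.
Let Irho n : intg (rho n). Proof. exact: rtest_intg. Qed.

Section fixed_test.
Variables (k : E -> R) (M c : R).
Hypotheses (mk : meas k) (M0 : 0 <= M) (kM : bounded_by M k) (sk : supp_in c k).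

(** Convergence is tested against the one bounded, compactly supported k. The class of such f
    contains indicators of orthants and is closed under linear combinations and L^1 limits, and in
    the end it contains every integrable function. *)
Definition wcv f := intg f /\
  (fun n => \int[mu]_x (convol f (rho n) x * k x)) @ \oo --> \int[mu]_x (f x * k x).

Let I0 : intg (fun=> 0). Proof. exact: intg0. Qed.

Let Ifk f n : intg f -> intg (fun x => convol f (rho n) x * k x).
Proof.
move=> If; have [B _ rB] := rtest_bounded (trho n).
apply: (@intg_conv_mul R N f k (rho n) (fun x => M * `|f x|) (fun=> 0) B) => //.
  exact/intgZ/intg_norm.
by move=> x y; rewrite addr0 normrM mulrC; apply: ler_wpM2r => //; exact: kM.
Qed.

Let bound f n : intg f ->
  `|\int[mu]_x (convol f (rho n) x * k x)| <= M * \int[mu]_x `|f x|.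
Proof.
move=> If; have [B _ rB] := rtest_bounded (trho n).
have := @norm_int_conv_mul R N f k (rho n) (fun x => M * `|f x|) (fun=> 0) B If mk
  (rho0 n) (Irho n) rB (intgZ M (intg_norm If)) I0 _ (rho1 n).
rewrite int0 addr0 (intZ M (intg_norm If)); apply.
by move=> x y; rewrite addr0 normrM mulrC; apply: ler_wpM2r => //; exact: kM.
Qed.

Lemma wcvD f g : wcv f -> wcv g -> wcv (fun x => f x + g x).
Proof.
move=> [If cf] [Ig cg]; split; first exact: intgD.
rewrite (_ : (fun n => _) = (fun n => \int[mu]_x (convol f (rho n) x * k x) +
  \int[mu]_x (convol g (rho n) x * k x))).
  rewrite (_ : \int[mu]_x _ = \int[mu]_x (f x * k x) + \int[mu]_x (g x * k x)).
    exact: cvgD cf cg.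
  rewrite -intD; last 2 first.
  - exact: intg_mul_bounded If mk kM.
  - exact: intg_mul_bounded Ig mk kM.
  by apply: eq_int => x; rewrite mulrDl.
apply/funext => n; rewrite -intD; [|exact: Ifk..].
have [B _ rB] := rtest_bounded (trho n).
by rewrite (convolD If Ig (mrho n) rB); apply: eq_int => x; rewrite mulrDl.
Qed.

Lemma wcvZ a f : wcv f -> wcv (fun x => a * f x).
Proof.
move=> [If cf]; split; first exact: intgZ.
rewrite (_ : (fun n => _) = (fun n => a * \int[mu]_x (convol f (rho n) x * k x))).
  rewrite (_ : \int[mu]_x _ = a * \int[mu]_x (f x * k x)).
    by apply: cvgM cf; exact: cvg_cst.
  rewrite -intZ; last exact: intg_mul_bounded If mk kM.
  by apply: eq_int => x; rewrite mulrA.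
apply/funext => n; rewrite -intZ; last exact: Ifk.
have [B _ rB] := rtest_bounded (trho n).
by rewrite (convolZ a If (mrho n) rB); apply: eq_int => x; rewrite mulrA.
Qed.

(** The pairing with k is at most M times the L^1 norm, uniformly in n, so an L^1 approximation
    transfers the limit by a three-epsilon argument. *)
Lemma wcv_lim (f_ : nat -> E -> R) f : intg f -> (forall m, wcv (f_ m)) ->
  (fun m => \int[mu]_x `|f_ m x - f x|) @ \oo --> 0 -> wcv f.
Proof.
move=> If cf c0; split => //.
apply/cvgrPdist_le => e e0.
have M1 : 0 < M + 1 by rewrite ltr_wpDl.
have e3 : 0 < e / 3 / (M + 1) by rewrite !divr_gt0.
have [m _ /(_ m (leqnn m)) /= Hm] := (cvgrPdist_le _ _).1 c0 _ e3.
rewrite sub0r normrN ger0_norm ?int_ge0// in Hm.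
have [Im cm] := cf m.
have Id : intg (fun x => f_ m x - f x) by exact: intgB.
have dM : M * (\int[mu]_x `|f_ m x - f x|) <= e / 3.
  rewrite (@le_trans _ _ ((M + 1) * (\int[mu]_x `|f_ m x - f x|)))//.
    by rewrite ler_wpM2r ?int_ge0// lerDl.
  by rewrite mulrC -ler_pdivlMr.
have e30 : 0 < e / 3 by rewrite divr_gt0.
apply: filterS ((cvgrPdist_le _ _).1 cm _ e30) => n Hn.
have fE : \int[mu]_x (f_ m x * k x) - \int[mu]_x (f x * k x) =
    \int[mu]_x ((f_ m x - f x) * k x).
  rewrite -intB; [|exact: intg_mul_bounded Im mk kM|exact: intg_mul_bounded If mk kM].
  by apply: eq_int => x; rewrite mulrBl.
have fB : `|\int[mu]_x ((f_ m x - f x) * k x)| <= e / 3.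
  apply: le_trans dM; rewrite -(intZ M (intg_norm Id)).
  apply: norm_int_le; first exact: intg_mul_bounded Id mk kM.
    exact: intgZ (intg_norm Id).
  by move=> x; rewrite normrM mulrC; apply: ler_wpM2r => //; exact: kM.
have gE : \int[mu]_x (convol (f_ m) (rho n) x * k x) - \int[mu]_x (convol f (rho n) x * k x) =
    \int[mu]_x (convol (fun x => f_ m x - f x) (rho n) x * k x).
  rewrite -intB; [|exact: Ifk..].
  have [B _ rB] := rtest_bounded (trho n).
  rewrite (_ : (fun x => f_ m x - f x) = fun x => f_ m x + -1 * f x); last first.
    by apply/funext => x; rewrite mulN1r.
  rewrite (convolD Im (intgZ (-1) If) (mrho n) rB) (convolZ (-1) If (mrho n) rB).
  by apply: eq_int => x; rewrite mulN1r mulrBl.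
have gB := le_trans (bound n Id) dM.
rewrite -gE in gB; rewrite -fE in fB.
exact: dist_third Hn fB gB.
Qed.

(** k lives in the cube c and every [rho n] in the cube 5, so only the values of f on Q influence
    the pairing. *)
Let Q := cube (c + 5) : set E.

Let mQ : measurable Q. Proof. exact: measurable_cube. Qed.

Let I1 A : measurable A -> intg (\1_(A `&` Q)).
Proof.
move=> mA; apply: (@le_intg _ _ _ mu _ (\1_Q)).
- by apply: measurable_indic; exact: measurableI.
- move=> x; rewrite !indicE in_setI ger0_norm ?ler0n// ler_nat.
  by case: (_ \in A); case: (_ \in Q).
- exact: intg_indic_cube.
Qed.

(** If [rho n] is nonzero at x - y, then y exceeds x in each coordinate by less than 5 / (n + 1).
    For x in A such y are in A, and the mollified indicator is exactly 1. If x_i < a_i for some i,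
    then y_i < a_i once n is large, and it is exactly 0. So it converges at every point of the cube
    c, with no exceptional null set, and dominated convergence applies. *)
Lemma wcv_orthant A : orthants A -> wcv (\1_(A `&` Q)).
Proof.
move=> OA; have mA : measurable A.
  case: OA => a _ <-.
  rewrite (_ : orthant a = \bigcap_(i in [set: 'I_N])
    ((fun x : E => x ord0 i : measurableTypeR R) @^-1` `[a ord0 i, +oo[%classic)).
    apply: fin_bigcap_measurable => [|i _]; first exact: finite_finset.
    rewrite -[X in measurable X]setTI.
    by apply: measurable_rV_coord.
  apply/seteqP; split => x /= H.
    by move=> i _ /=; rewrite in_itv/= andbT.
  by move=> i; have := H i I; rewrite /= in_itv/= andbT.
split; first exact: I1.
pose p n x := convol (\1_(A `&` Q)) (rho n) x.
have pE n x : p n x = \int[mu]_y (\1_(A `&` Q) y * rho n (x - y)) by [].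
have Ir n x : intg (fun y => rho n (x - y)) by exact: intg_refl.
have ir n x : \int[mu]_y rho n (x - y) = 1 by rewrite (int_refl x (Irho n)).
have p01 n x : `|p n x| <= 1.
  have [B _ rB] := rtest_bounded (trho n).
  rewrite -(ir n x) pE; apply: norm_int_le; [|exact: Ir|].
    exact: intg_conv_kernel (I1 mA) (mrho n) rB.
  move=> y; rewrite normrM (ger0_norm (rho0 _ _)) indicE normr_nat.
  by case: (_ \in _); rewrite ?mul1r// mul0r.
have xQ n x y : cube c x -> rho n (x - y) != 0 -> Q y.
  move=> xc /rhos H i; have := H i; have := xc i; rewrite !mxE.
  rewrite !ler_norml => /andP[x1 x2] /andP[h1 h2].
  have n5 : - 5 <= - 5 / n.+1%:R :> R.
    rewrite -[leLHS]mulr1; apply: ler_wnM2l; first by rewrite oppr_le0.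
    by rewrite invf_le1 ?ler1n.
  have h3 := le_lt_trans n5 h1.
  by apply/andP; split; lra.
have cp x : cube c x -> p^~ x @ \oo --> (\1_A x : R).
  move=> xc; rewrite indicE; case: OA => a _ aA.
  have [xA|xA] := boolP (x \in A).
    apply: cvg_near_cst; apply: nearW => n; rewrite pE -[RHS](ir n x).
    apply: eq_int => y; rewrite indicE.
    have [->|ry] := eqVneq (rho n (x - y)) 0; first by rewrite mulr0.
    rewrite mem_set ?mul1r//; split; last exact: (xQ n x).
    rewrite -aA => i; have /andP[_] := rhos ry i; rewrite !mxE => xy.
    move: xA; rewrite inE -aA => /(_ i) ax.
    by rewrite (le_trans ax)// ltW// -subr_lt0.
  have [i xi] : exists i, x ord0 i < a ord0 i.
    apply: contrapT => /forallNP H; move/negP: xA; apply; rewrite inE -aA => i.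
    by rewrite leNgt; apply/negP; exact: H.
  have d0 : 0 < (a ord0 i - x ord0 i) / 5 by rewrite divr_gt0// subr_gt0.
  apply: cvg_near_cst.
  near=> n; rewrite pE; rewrite -[RHS](@int0 _ _ _ mu); apply: eq_int => y.
  rewrite indicE; have [->|ry] := eqVneq (rho n (x - y)) 0; first by rewrite mulr0.
  rewrite memNset ?mul0r// => -[Ay _]; move: Ay; rewrite -aA => /(_ i) ay.
  have /andP[+ _] := rhos ry i; rewrite !mxE => xy.
  have : n.+1%:R^-1 < (a ord0 i - x ord0 i) / 5.
    by near: n; exact: near_infty_natSinv_lt (PosNum d0).
  by move=> nn; exact: (small_shift xy nn ay).
have d1 n x : `|p n x * k x| <= M * \1_(cube c) x.
  rewrite normrM indicE; have [xc|xc] := boolP (x \in cube c).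
    by rewrite mulr1 -[leRHS]mul1r ler_pM//; exact: kM.
  rewrite (_ : k x = 0) ?normr0 ?mulr0//.
  apply: contrapT => kx; move/negP : xc; apply; rewrite inE => i.
  by rewrite leNgt; apply/negP => /sk.
have d2 x : p^~ x \* (fun=> k x) @ \oo --> \1_(A `&` Q) x * k x.
  have [->|kx] := eqVneq (k x) 0.
    by rewrite mulr0; apply: cvg_near_cst; apply: nearW => n /=; rewrite mulr0.
  have xc : cube c x.
    by move=> i; rewrite leNgt; apply/negP => /sk kx0; rewrite kx0 eqxx in kx.
  have -> : (\1_(A `&` Q) x : R) = \1_A x.
    rewrite !indicE in_setI (_ : x \in Q) ?andbT// inE => i.
    by rewrite (le_trans (xc i))// lerDl.
  by apply: cvgM; [exact: cp|exact: cvg_cst].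
by have [_] := @dominated_int _ _ _ mu (fun n x => p n x * k x) (fun x => \1_(A `&` Q) x * k x)
  (fun x => M * \1_(cube c) x) (fun n => intg_meas (Ifk n (I1 mA)))
  (measurable_funM (intg_meas (I1 mA)) mk) (intgZ M (@intg_indic_cube R N c)) d1 d2.
Unshelve. all: by end_near. Qed.

Lemma wcvB f g : wcv f -> wcv g -> wcv (fun x => f x - g x).
Proof.
move=> cf cg; have := wcvD cf (wcvZ (-1) cg).
by congr wcv; apply/funext => x; rewrite mulN1r.
Qed.

(** Inside the bounded set Q the indicators converge in L^1 by domination, so [wcv_lim] applies. *)
Lemma wcv_ndseq (F : (set E)^nat) : nondecreasing_seq F ->
  (forall m, measurable (F m)) -> (forall m, wcv (\1_(F m `&` Q))) ->
  wcv (\1_((\bigcup_m F m) `&` Q)).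
Proof.
move=> ndF mF cF; set U := \bigcup_m F m.
have mU : measurable U by exact: bigcupT_measurable.
apply: (@wcv_lim (fun m => \1_(F m `&` Q))) => //; first exact: I1.
have mD m : meas (fun x => `|\1_(F m `&` Q) x - \1_(U `&` Q) x : R|).
  by apply: intg_meas (intg_norm (intgB (I1 (mF m)) (I1 mU))).
have d1 m x : `| `|\1_(F m `&` Q) x - \1_(U `&` Q) x| | <= \1_Q x :> R.
  rewrite normr_id !indicE !in_setI.
  case: (x \in Q); rewrite ?andbT ?andbF ?subrr ?normr0//.
  by case: (x \in F m); case: (x \in U); rewrite ?subrr ?subr0 ?sub0r ?normrN ?normr0 ?normr1.
have d2 x : (fun m => `|\1_(F m `&` Q) x - \1_(U `&` Q) x| : R) @ \oo --> (0 : R).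
  apply: cvg_near_cst.
  have [xU|xU] := boolP (x \in U).
    move: (xU); rewrite inE => -[m0 _ Fx].
    exists m0 => // m /= m0m; rewrite !indicE !in_setI xU (_ : x \in F m) ?subrr ?normr0//.
    by rewrite inE; move: x Fx {xU}; apply/subsetPset/ndF.
  apply: nearW => m; rewrite !indicE !in_setI (negbTE xU) (_ : x \in F m = false) ?subrr ?normr0//.
  by apply/negbTE; apply: contra xU; rewrite !inE => Fx; exists m.
have [_] := @dominated_int _ _ _ mu _ (fun=> 0) (\1_Q) mD (measurable_cst _)
  (@intg_indic_cube R N (c + 5)) d1 d2.
by rewrite int0.
Qed.

(** Dynkin's argument: the measurable sets with this property form a lambda-system, by linearity for
    proper differences and by [wcv_ndseq] for increasing unions, and it contains the pi-system of
    orthants. *)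
Lemma wcv_measurable A : measurable A -> wcv (\1_(A `&` Q)).
Proof.
pose H := [set A : set E | measurable A /\ wcv (\1_(A `&` Q))].
have HG : orthants `<=` H.
  move=> B OB; split; last exact: wcv_orthant.
  case: OB => a _ <-.
  rewrite (_ : orthant a = \bigcap_(i in [set: 'I_N])
    ((fun x : E => x ord0 i : measurableTypeR R) @^-1` `[a ord0 i, +oo[%classic)).
    apply: fin_bigcap_measurable => [|i _]; first exact: finite_finset.
    rewrite -[X in measurable X]setTI.
    by apply: measurable_rV_coord.
  apply/seteqP; split => x /= h.
    by move=> i _ /=; rewrite in_itv/= andbT.
  by move=> i; have := h i I; rewrite /= in_itv/= andbT.
have HT : H setT.
  have UT : [set: E] = \bigcup_m orthant (const_mx (- m%:R)).
    apply/seteqP; split => x // _.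
    exists (Num.truncn `|x|).+1 => // i; rewrite mxE.
    have := coord_norm_le x i; rewrite ler_norml => /andP[+ _]; apply: le_trans.
    by rewrite lerN2 ltW// truncnS_gt.
  split => //; rewrite UT; apply: wcv_ndseq.
  - move=> m n mn; apply/subsetPset => x h i; have := h i; rewrite !mxE.
    by apply: le_trans; rewrite lerN2 ler_nat.
  - by move=> m; have [] := HG (orthant (const_mx (- m%:R))); first by eexists.
  - by move=> m; have [] := HG (orthant (const_mx (- m%:R))); first by eexists.
have HL : lambda_system setT H.
  split => //.
  - move=> B C CB [mB wB] [mC wC]; split; first exact: measurableD.
    have := wcvB wB wC; congr wcv; apply/funext => x.
    rewrite !indicE [x \in (_ `\` _) `&` _]in_setI in_setD !in_setI.
    have : x \in C -> x \in B by rewrite !inE; exact: CB.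
    case: (x \in C); case: (x \in B); case: (x \in Q) => //=; rewrite ?subrr ?subr0//;
      by move=> /(_ isT).
  - move=> F ndF HF; split.
      by apply: bigcupT_measurable => m; have [] := HF m.
    by apply: wcv_ndseq => // m; have [] := HF m.
move=> mA; have := @lambda_system_subset _ orthants (@orthantsI R N) setT H HL HG.
by move=> /(_ (fun _ _ _ _ => I)) /(_ _ (measurable_orthants mA))[].
Qed.

Lemma wcv_eq_cube f g : intg g -> (forall x, Q x -> f x = g x) -> wcv f -> wcv g.
Proof.
move=> Ig fg [If cf]; split => //.
have fgx x y n : k x != 0 -> f y * rho n (x - y) = g y * rho n (x - y).
  move=> kx; have [->|ry] := eqVneq (rho n (x - y)) 0; first by rewrite !mulr0.
  rewrite fg// => i; have /andP[h1 h2] := rhos ry i.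
  have xc : `|x ord0 i| <= c by rewrite leNgt; apply/negP => /sk kx0; rewrite kx0 eqxx in kx.
  move: h1 h2 xc; rewrite !mxE !ler_norml => h1 h2 /andP[x1 x2].
  have n5 : - 5 <= - 5 / n.+1%:R :> R.
    rewrite -[leLHS]mulr1; apply: ler_wnM2l; first by rewrite oppr_le0.
    by rewrite invf_le1 ?ler1n.
  have h3 := le_lt_trans n5 h1.
  by apply/andP; split; lra.
rewrite (_ : \int[mu]_x (g x * k x) = \int[mu]_x (f x * k x)); last first.
  apply: eq_int => x; have [->|kx] := eqVneq (k x) 0; first by rewrite !mulr0.
  rewrite fg// => i; have xc : `|x ord0 i| <= c.
    by rewrite leNgt; apply/negP => /sk kx0; rewrite kx0 eqxx in kx.
  by rewrite (le_trans xc)// lerDl.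
rewrite (_ : (fun n : nat => \int[mu]_x (convol g (rho n) x * k x)) =
  fun n => \int[mu]_x (convol f (rho n) x * k x)); first exact: cf.
apply/funext => n; apply: eq_int => x.
have [->|kx] := eqVneq (k x) 0; first by rewrite !mulr0.
by congr (_ * _); apply: eq_int => y; rewrite fgx.
Qed.

Import HBSimple.

(** Simple functions are dense in L^1, and on Q a simple function is a finite combination of
    indicators of measurable sets; its values outside Q do not affect the pairing. *)
Lemma wcv_intg f : intg f -> wcv f.
Proof.
move=> If.
have [g_ [Ig _ cg]] := approximation_sfun_integrable measurableT If.
have W := @wcv_lim (fun m => (g_ m : E -> R)) f If.
apply: W => [m|]; last first.
  rewrite (_ : (fun m : nat => \int[mu]_x `|g_ m x - f x|) =
    fun n => fine (\int[mu]_z `|(EFin \o f) z - (g_ n z)%:E|)%E).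
    exact: fine_cvg cg.
  apply/funext => m; rewrite /Rintegral; congr fine.
  by apply: eq_integral => x _ /=; rewrite distrC.
have Hs (s : seq R) : wcv (fun x => (\sum_(y <- s) y * \1_(g_ m @^-1` [set y] `&` Q) x)).
  elim: s => [|y s IH].
    under eq_fun do rewrite big_nil.
    have := wcvZ 0 (wcv_measurable measurableT).
    by congr wcv; apply/funext => x; rewrite mul0r.
  under eq_fun do rewrite big_cons.
  by apply: wcvD => //; apply: wcvZ; exact: wcv_measurable.
have W2 := @wcv_eq_cube _ (g_ m : E -> R) (Ig m) _ (Hs (finmap.enum_fset (fset_set (range (g_ m))))).
apply: W2 => x Qx.
rewrite fimfunE fsbig_finite//=; apply: eq_bigr => y _; congr (_ * _).
by rewrite !indicE in_setI (_ : x \in Q) ?andbT ?inE.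
Qed.

End fixed_test.

End weak_convergence.

Lemma dist_sum_third (R : realFieldType) (a b c d e : R) : `|a - c| <= e / 3 ->
  `|b| <= e / 3 -> `|d| <= e / 3 -> `|a + b - (c + d)| <= e.
Proof.
rewrite !ler_norml => /andP[? ?] /andP[? ?] /andP[? ?].
by apply/andP; split; lra.
Qed.

Lemma young2 (R : realFieldType) (a b e : R) : 0 < e ->
  `|a * b| <= e * a ^+ 2 + e^-1 * b ^+ 2.
Proof.
move=> e0; have H s : s ^+ 2 = 1 -> 0 <= e * a ^+ 2 + e^-1 * b ^+ 2 + s * (a * b).
  (* Completing the square with a sign s treats a b and - a b at once; the last summand disappears
     because s^2 = 1. *)
  move=> s1; rewrite (_ : _ + _ = e^-1 * ((e * a + s * b / 2) ^+ 2) + 3 / 4 * e^-1 * b ^+ 2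
    + e^-1 * (1 - s ^+ 2) * b ^+ 2 / 4); last by field; rewrite gt_eqF.
  rewrite s1 subrr mulr0 !mul0r addr0 addr_ge0// mulr_ge0 ?sqr_ge0 ?invr_ge0 ?(ltW e0)//.
  by rewrite mulr_ge0 ?invr_ge0 ?(ltW e0)//; lra.
rewrite ler_norml; apply/andP; split.
  by have := H 1 (expr1n _ _); rewrite mul1r; lra.
by have := H (-1) (sqrr_sign _ 1%N); rewrite mulN1r; lra.
Qed.

(** * Mollification of square-integrable functions *)

Section mollification.
Context {R : realType} {N : nat}.
Local Notation E := 'rV[R]_N.
Local Notation mu := (leb N : {measure set E -> \bar R}).
Local Notation intg := (rintegrable mu).
Local Notation e_ j := (delta_mx ord0 j : E).
Implicit Types (f g h k r : E -> R) (x : E) (j : 'I_N).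

Lemma int_convol f r : intg f -> intg r ->
  \int[mu]_x convol f r x = (\int[mu]_x f x) * \int[mu]_x r x.
Proof.
move=> If Ir; have [_ _ I12] := fubini_real (intg_kernel_snd If Ir).
transitivity (\int[mu]_y (\int[mu]_x (f y * r (x - y)))); first exact: I12.
rewrite mulrC -(intZ _ If); apply: eq_int => y.
rewrite intZ; last exact: (@intg_shift R N (- y) _ Ir).
by rewrite (@int_shift R N (- y) _ Ir) mulrC.
Qed.

Variables (rho : nat -> E -> R).
Hypothesis Hrho : mollifier rho.

Let trho n : rtest (rho n). Proof. by have [] := Hrho n. Qed.
Let rho0 n x : 0 <= rho n x. Proof. by have [] := Hrho n. Qed.
Let rho1 n : \int[mu]_x rho n x = 1. Proof. by have [] := Hrho n. Qed.
Let rhos n x : rho n x != 0 -> forall i, - 5 / n.+1%:R < x ord0 i < 0.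
Proof. by have [_ _ _] := Hrho n; apply. Qed.
Let mrho n : meas (rho n). Proof. exact: intg_meas (rtest_intg (trho n)). Qed.
Let Irho n : intg (rho n). Proof. exact: rtest_intg. Qed.

(** Jensen's inequality for the probability density y -> rho n (x - y): with c the mean of f, the
    integral of (f(y) - c)^2 against it is non-negative, and expanding the square gives the
    pointwise bound. *)
Lemma mollify_sqr n f : intg f -> intg (fun x => f x ^+ 2) ->
  intg (fun x => convol f (rho n) x ^+ 2) /\
  \int[mu]_x (convol f (rho n) x ^+ 2) <= \int[mu]_x (f x ^+ 2).
Proof.
move=> If If2; have [B _ rB] := rtest_bounded (trho n).
have pt x : convol f (rho n) x ^+ 2 <= convol (fun y => f y ^+ 2) (rho n) x.
  set c := convol f (rho n) x.
  have Ir : intg (fun y => rho n (x - y)) by exact: intg_refl.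
  have I1 := intg_conv_kernel x If (mrho n) rB.
  have I2 := intg_conv_kernel x If2 (mrho n) rB.
  have : 0 <= \int[mu]_y (f y ^+ 2 * rho n (x - y) - (2 * c) * (f y * rho n (x - y)) +
      c ^+ 2 * rho n (x - y)).
    apply: int_ge0 => y.
    rewrite (_ : _ + _ = (f y - c) ^+ 2 * rho n (x - y)); last by ring.
    by rewrite mulr_ge0 ?sqr_ge0.
  rewrite (intD (intgB I2 (intgZ (2 * c) I1)) (intgZ (c ^+ 2) Ir)).
  rewrite (intB I2 (intgZ (2 * c) I1)) (intZ (2 * c) I1) (intZ (c ^+ 2) Ir).
  rewrite (int_refl x (Irho n)) rho1 mulr1 -/(convol f (rho n) x) -/c.
  rewrite -/(convol (fun y => f y ^+ 2) (rho n) x).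
  move=> h; rewrite -subr_ge0; move: h; congr (0 <= _).
  by rewrite expr2; ring.
have Ic : intg (convol (fun y => f y ^+ 2) (rho n)) by exact: intg_conv.
have Ic2 : intg (fun x => convol f (rho n) x ^+ 2).
  apply: (le_intg _ _ Ic).
    under eq_fun do rewrite expr2.
    by apply: measurable_funM; exact: intg_meas (intg_conv If (Irho n)).
  by move=> x; rewrite ger0_norm ?sqr_ge0.
split => //; rewrite -[leRHS]mulr1 -(rho1 n) -(int_convol If2 (Irho n)).
exact: le_int.
Qed.

Section weak_limit.
Variables (f k F : E -> R).
Hypotheses (If : intg f) (mk : meas k) (IF : intg F) (F0 : forall x, 0 <= F x).
Hypothesis fkFK : forall e : R, 0 < e ->
  exists2 K : E -> R, intg K & forall x y, `|f y * k x| <= e * F y + K x.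

Let G (m : nat) : set E := cube m%:R `&` (k @^-1` `[- m%:R, m%:R]%classic).

Let mG m : measurable (G m).
Proof.
apply: measurableI; first exact: measurable_cube.
by rewrite -[X in measurable X]setTI; apply: mk.
Qed.

Let kin m x := k x * \1_(G m) x.
Let kout m x := k x * \1_(~` G m) x.

Let kE m x : k x = kin m x + kout m x.
Proof.
rewrite /kin /kout -mulrDr !indicE in_setC.
by case: (x \in G m); rewrite ?addr0 ?add0r mulr1.
Qed.

Let mkin m : meas (kin m).
Proof. by apply: measurable_funM => //; exact: measurable_indic. Qed.

Let mkout m : meas (kout m).
Proof.
by apply: measurable_funM => //; apply: measurable_indic; exact: measurableC.
Qed.

Let kinM m : bounded_by m%:R (kin m).
Proof.
move=> x; rewrite /kin indicE; have [|_] := boolP (x \in G m).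
  by rewrite inE mulr1 => -[_]; rewrite /= in_itv/= ler_norml.
by rewrite mulr0 normr0.
Qed.

Let kins m : supp_in m%:R (kin m).
Proof.
move=> x i xi; rewrite /kin indicE memNset ?mulr0// => -[/(_ i)].
by rewrite leNgt xi.
Qed.

Let koutFK m e (K : E -> R) : 0 < e -> (forall x y, `|f y * k x| <= e * F y + K x) ->
  forall x y, `|f y * kout m x| <= e * F y + `|K x| * \1_(~` G m) x.
Proof.
move=> e0 H x y; rewrite /kout indicE.
case: (x \in ~` G m).
  by rewrite !mulr1 (le_trans (H x y))// lerD2l ler_norm.
by rewrite !mulr0 normr0 addr0 mulr_ge0// ltW.
Qed.

Let Ktail (K : E -> R) : intg K ->
  (fun m => \int[mu]_x (`|K x| * \1_(~` G m) x)) @ \oo --> 0.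
Proof.
move=> IK.
have mf m : meas (fun x => `|K x| * \1_(~` G m) x).
  apply: measurable_funM; first exact: intg_meas (intg_norm IK).
  by apply: measurable_indic; exact: measurableC.
have d1 m x : `| `|K x| * \1_(~` G m) x | <= `|K x|.
  rewrite normrM normr_id -[leRHS]mulr1 ler_wpM2l// indicE normr_nat.
  by case: (_ \in _).
have d2 x : (fun m => `|K x| * \1_(~` G m) x) @ \oo --> (0 : R).
  apply: cvg_near_cst; near=> m.
  rewrite indicE in_setC mem_set ?mulr0//; split => /=.
    move=> i; rewrite (le_trans (coord_norm_le x i))//.
    by near: m; exact: nbhs_infty_ger.
  rewrite in_itv/= -ler_norml.
  by near: m; exact: nbhs_infty_ger.
have [_] := @dominated_int _ _ _ mu _ (fun=> 0) _ mf (measurable_cst _) (intg_norm IK) d1 d2.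
by rewrite int0.
Unshelve. all: by end_near. Qed.

(** The bounded, compactly supported part [kin] of k is covered by [wcv_intg]. The part [kout]
    contributes at most d times the integral of F plus the integral of |K| outside [G m], uniformly
    in n. Since K depends on d, d is chosen first and m afterwards. *)
Lemma mollify_weak_cvg :
  (fun n => \int[mu]_x (convol f (rho n) x * k x)) @ \oo --> \int[mu]_x (f x * k x).
Proof.
apply/cvgrPdist_le => e e0.
set J := \int[mu]_x F x; have J0 : 0 <= J by exact: int_ge0.
pose d := e / 6 / (J + 1).
have d0 : 0 < d by rewrite !divr_gt0// ltr_wpDl.
have [K IK H] := fkFK d0.
have e6 : 0 < e / 6 by rewrite divr_gt0.
have [m _ /(_ m (leqnn m)) /= Hm] := (cvgrPdist_le _ _).1 (Ktail IK) _ e6.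
have IKG : intg (fun x => `|K x| * \1_(~` G m) x).
  apply: (intg_mul_bounded (M := 1) (intg_norm IK)).
    by apply: measurable_indic; exact: measurableC.
  by move=> x; rewrite indicE normr_nat; case: (_ \in _).
have HKG : \int[mu]_x (`|K x| * \1_(~` G m) x) <= e / 6.
  apply: le_trans Hm; rewrite sub0r normrN; exact: ler_norm.
have HF : d * J + \int[mu]_x (`|K x| * \1_(~` G m) x) <= e / 3.
  have dJ : d * J <= e / 6.
    rewrite /d mulrAC ler_pdivrMr; last by rewrite ltr_wpDl.
    by rewrite ler_wpM2l ?ltW// ltr_pwDr.
  by rewrite (le_trans (lerD dJ HKG))//; lra.
have Ikin := @intg_mul_bounded _ _ _ _ _ If (mkin m) (@kinM m).
have Ikout : intg (fun x => f x * kout m x).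
  apply: (@le_intg _ _ _ mu _ (fun x => d * F x + `|K x| * \1_(~` G m) x)).
  - by apply: measurable_funM; [exact: intg_meas If|exact: mkout].
  - by move=> x; exact: koutFK.
  - by apply: intgD => //; exact: intgZ.
have [_ cin] := wcv_intg Hrho (mkin m) (ler0n _ m) (@kinM m) (@kins m) If.
have e3 : 0 < e / 3 by rewrite divr_gt0.
apply: filterS ((cvgrPdist_le _ _).1 cin _ e3) => n Hn.
have [B _ rB] := rtest_bounded (trho n).
have Icin : intg (fun x => convol f (rho n) x * kin m x).
  exact: (@intg_mul_bounded _ _ _ _ _ (intg_conv If (Irho n)) (mkin m) (@kinM m)).
have Icout : intg (fun x => convol f (rho n) x * kout m x).
  exact: (@intg_conv_mul R N f (kout m) (rho n) (fun x => d * F x)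
    (fun x => `|K x| * \1_(~` G m) x) B If (mkout m) (rho0 n) (Irho n) rB (intgZ d IF) IKG
    (koutFK m d0 H)).
have b1 : `|\int[mu]_x (f x * kout m x)| <= e / 3.
  apply: le_trans HF; rewrite /J -(intZ d IF) -(intD (intgZ d IF) IKG).
  apply: (norm_int_le Ikout (intgD (intgZ d IF) IKG)) => x; exact: koutFK.
have b2 : `|\int[mu]_x (convol f (rho n) x * kout m x)| <= e / 3.
  apply: le_trans HF; rewrite /J -(intZ d IF).
  exact: (@norm_int_conv_mul R N f (kout m) (rho n) (fun x => d * F x)
    (fun x => `|K x| * \1_(~` G m) x) B If (mkout m) (rho0 n) (Irho n) rB (intgZ d IF) IKG
    (koutFK m d0 H) (rho1 n)).
have -> : \int[mu]_x (f x * k x) = \int[mu]_x (f x * kin m x) + \int[mu]_x (f x * kout m x).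
  by rewrite -(intD Ikin Ikout); apply: eq_int => x; rewrite (kE m x) mulrDr.
have -> : \int[mu]_x (convol f (rho n) x * k x) =
    \int[mu]_x (convol f (rho n) x * kin m x) + \int[mu]_x (convol f (rho n) x * kout m x).
  by rewrite -(intD Icin Icout); apply: eq_int => x; rewrite (kE m x) mulrDr.
exact: dist_sum_third Hn b1 b2.
Qed.

End weak_limit.

Lemma mollify_weak_cvg_sqr f k : intg f -> meas k -> intg (fun x => f x ^+ 2) ->
  intg (fun x => k x ^+ 2) ->
  (fun n => \int[mu]_x (convol f (rho n) x * k x)) @ \oo --> \int[mu]_x (f x * k x).
Proof.
move=> If mk If2 Ik2; apply: (mollify_weak_cvg If mk If2); first by move=> x; exact: sqr_ge0.
move=> e e0; exists (fun x => e^-1 * k x ^+ 2); first exact: intgZ.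
by move=> x y; exact: young2.
Qed.

End mollification.

(** * Weak derivatives *)

Lemma near_cube (R : realFieldType) (n : nat) (x y c : R) : - 5 / n.+1%:R < x - y ->
  x - y < 0 -> `|x| <= c -> `|y| <= c + 5.
Proof.
move=> h1 h2; rewrite !ler_norml => /andP[x1 x2].
have n5 : - 5 <= - 5 / n.+1%:R :> R.
  rewrite -[leLHS]mulr1; apply: ler_wnM2l; first by rewrite oppr_le0.
  by rewrite invf_le1 ?ler1n.
have h3 := le_lt_trans n5 h1.
by apply/andP; split; lra.
Qed.

Lemma norm_le_sqrD1 (R : realFieldType) (a : R) : `|a| <= a ^+ 2 + 1.
Proof.
rewrite -(@real_normK _ a) ?num_real//; have := sqr_ge0 (`|a| - 1).
by have := normr_ge0 a; move: `|a| => b b0; nra.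
Qed.

Section weak_derivatives.
Context {R : realType} {N : nat}.
Local Notation E := 'rV[R]_N.
Local Notation mu := (leb N : {measure set E -> \bar R}).
Local Notation intg := (rintegrable mu).
Local Notation e_ j := (delta_mx ord0 j : E).
Implicit Types (f g h k r : E -> R) (x : E) (j : 'I_N).

Definition locint f := meas f /\ forall c : R, intg (fun x => f x * \1_(cube c) x).

Lemma mul_cube_supp (c : R) f h : supp_in c h ->
  (fun x => f x * h x) = (fun x => f x * \1_(cube c) x * h x).
Proof.
move=> sh; apply/funext => x; rewrite indicE.
have [_|xc] := boolP (x \in cube c); first by rewrite mulr1.
rewrite (_ : h x = 0) ?mulr0//.
apply: contrapT => hx; move/negP : xc; apply; rewrite inE => i.
by rewrite leNgt; apply/negP => /sh.
Qed.

Lemma locint_mul (c M : R) f h : locint f -> meas h -> bounded_by M h -> supp_in c h ->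
  intg (fun x => f x * h x).
Proof.
move=> [mf If] mh hM sh; rewrite (mul_cube_supp f sh).
exact: (intg_mul_bounded (If c) mh hM).
Qed.

Lemma locint_mul_rtest f h : locint f -> rtest h -> intg (fun x => f x * h x).
Proof.
move=> lf th; have [M _ hM] := rtest_bounded th.
have [sh [c sc]] := th.
exact: (locint_mul lf (smooth_meas sh) hM sc).
Qed.

Lemma locintD f g : locint f -> locint g -> locint (fun x => f x + g x).
Proof.
move=> [mf If] [mg Ig]; split; first exact: measurable_funD.
move=> c; under eq_fun do rewrite mulrDl; exact: (intgD (If c) (Ig c)).
Qed.

Lemma locintZ (a : R) f : locint f -> locint (fun x => a * f x).
Proof.
move=> [mf If]; split; first by apply: measurable_funM.
move=> c; under eq_fun do rewrite -mulrA; exact: intgZ.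
Qed.

Lemma intg_locint f : intg f -> locint f.
Proof.
move=> If; split; first exact: intg_meas If.
move=> c; apply: (intg_mul_bounded (M := 1) If).
  by apply: measurable_indic; exact: measurable_cube.
by move=> x; rewrite indicE normr_nat; case: (_ \in _).
Qed.

Lemma bounded_locint (M : R) f : meas f -> bounded_by M f -> locint f.
Proof.
move=> mf fM; split => // c; rewrite (_ : (fun x => _) = fun x => \1_(cube c) x * f x).
  exact: (intg_mul_bounded (@intg_indic_cube R N c) mf fM).
by apply/funext => x; rewrite mulrC.
Qed.

Section du_bois_reymond.
Variables (rho : nat -> E -> R).
Hypothesis Hrho : mollifier rho.

(** The mollification of g at x is g paired with the test function y -> rho n (x - y), hence zero.
    The weak limit against k, the sign of g cut off to a cube, is the integral of |g| over that
    cube. *)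
Lemma du_bois_reymond g : locint g ->
  (forall psi, rtest psi -> \int[mu]_x (g x * psi x) = 0) ->
  {ae mu, forall x, g x = 0}.
Proof.
move=> [mg Ig] H.
suff : forall m : nat, {ae mu, forall x, `|g x * \1_(cube m%:R) x| = 0}.
  move/ae_foralln; apply: filterS => x gx.
  have := gx (Num.truncn `|x|).+1; rewrite indicE mem_set.
    by rewrite mulr1 => /normr0_eq0.
  by move=> i; rewrite (le_trans (coord_norm_le x i))// ltW// truncnS_gt.
move=> m; set c : R := m%:R.
(* The truncation makes g integrable; the margin 5 covers the supports of the mollifiers, so nothing
   changes at points of the cube c. *)
pose f x := g x * \1_(cube (c + 5)) x.
have If : intg f by exact: Ig.
pose sg x : R := if g x < 0 then -1 else 1.
pose k x := sg x * \1_(cube c) x.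
have mk : meas k.
  apply: measurable_funM; last by apply: measurable_indic; exact: measurable_cube.
  apply: measurable_fun_ifT; [|exact: measurable_cst|exact: measurable_cst].
  by apply: measurable_fun_ltr => //; exact: measurable_cst.
have kM : bounded_by 1 k.
  move=> x; rewrite /k /sg indicE normrM normr_nat.
  by case: (_ < _); case: (_ \in _); rewrite ?normrN normr1 ?mulr0 ?mulr1.
have sk : supp_in c k.
  move=> x i xi; rewrite /k indicE memNset ?mulr0// => /(_ i).
  by rewrite leNgt xi.
have [_ cf] := wcv_intg Hrho mk ler01 kM sk If.
have z n : \int[mu]_x (convol f (rho n) x * k x) = 0.
  rewrite -[RHS](@int0 _ _ _ mu); apply: eq_int => x.
  have [->|kx] := eqVneq (k x) 0; first by rewrite mulr0.
  have [tr _ _ rs] := Hrho n.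
  rewrite (_ : convol f _ _ = 0) ?mul0r// /convol -[RHS](H _ (rtest_refl x tr)).
  apply: eq_int => y; rewrite /f indicE.
  have [->|ry] := eqVneq (rho n (x - y)) 0; first by rewrite !mulr0.
  rewrite mem_set ?mulr1// => i; have /andP[h1 h2] := rs _ ry i.
  have xc : `|x ord0 i| <= c by rewrite leNgt; apply/negP => /sk kx0; rewrite kx0 eqxx in kx.
  by move: h1 h2; rewrite !mxE => h1 h2; exact: near_cube h1 h2 xc.
have {cf z}fk0 : \int[mu]_x (f x * k x) = 0.
  rewrite (_ : (fun n => _) = fun=> 0) in cf; last by apply/funext => n; exact: z.
  by have <- := cvg_lim (@Rhausdorff R) cf; rewrite lim_cst//; exact: Rhausdorff.
have fkE x : f x * k x = `|g x * \1_(cube c) x|.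
  rewrite /f /k !indicE; have [xc|xc] := boolP (x \in cube c); last by rewrite !mulr0 normr0.
  rewrite mem_set; last by move: xc; rewrite inE => xc i; rewrite (le_trans (xc i))// lerDl.
  rewrite !mulr1 /sg; case: ltP => g0; first by rewrite mulrN1 ltr0_norm.
  by rewrite mulr1 ger0_norm.
apply: int_ge0_eq0.
- exact: intg_norm.
- by [].
- by rewrite -fk0; apply: eq_int => x; rewrite fkE.
Qed.

End du_bois_reymond.

Definition rweak j f g := [/\ locint f, locint g &
  forall psi, rtest psi ->
    \int[mu]_x (f x * partial j psi x) = - \int[mu]_x (g x * psi x)].

Lemma rweakD j f f' g g' : rweak j f g -> rweak j f' g' ->
  rweak j (fun x => f x + f' x) (fun x => g x + g' x).
Proof.
move=> [lf lg H] [lf' lg' H']; split; [exact: locintD|exact: locintD|].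
move=> psi tp; have tpj := rtest_partial j tp.
rewrite (@eq_int _ _ _ mu _ (fun x => f x * partial j psi x + f' x * partial j psi x)); last first.
  by move=> x; rewrite mulrDl.
rewrite (intD (locint_mul_rtest lf tpj) (locint_mul_rtest lf' tpj)) H// H'//.
rewrite [in RHS](@eq_int _ _ _ mu _ (fun x => g x * psi x + g' x * psi x)); last first.
  by move=> x; rewrite mulrDl.
by rewrite (intD (locint_mul_rtest lg tp) (locint_mul_rtest lg' tp)) opprD.
Qed.

Lemma rweakZ j (a : R) f g : rweak j f g -> rweak j (fun x => a * f x) (fun x => a * g x).
Proof.
move=> [lf lg H]; split; [exact: locintZ|exact: locintZ|].
move=> psi tp; have tpj := rtest_partial j tp.
rewrite (@eq_int _ _ _ mu _ (fun x => a * (f x * partial j psi x))); last first.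
  by move=> x; rewrite mulrA.
rewrite (intZ a (locint_mul_rtest lf tpj)) H//.
rewrite [in RHS](@eq_int _ _ _ mu _ (fun x => a * (g x * psi x))); last first.
  by move=> x; rewrite mulrA.
by rewrite (intZ a (locint_mul_rtest lg tp)) mulrN.
Qed.

Lemma rweakB j f f' g g' : rweak j f g -> rweak j f' g' ->
  rweak j (fun x => f x - f' x) (fun x => g x - g' x).
Proof.
move=> H /(rweakZ (-1)) H'; have := rweakD H H'.
by congr rweak; apply/funext => x; rewrite mulN1r.
Qed.

Lemma rweak_unique (rho : nat -> E -> R) j f g g' : mollifier rho -> rweak j f g -> rweak j f g' ->
  {ae mu, forall x, g x = g' x}.
Proof.
move=> Hrho [_ lg H] [_ lg' H'].
have ld : locint (fun x => g x + -1 * g' x) by apply: locintD => //; exact: locintZ.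
have : {ae mu, forall x, g x + -1 * g' x = 0}.
  apply: (du_bois_reymond Hrho ld) => psi tp.
  rewrite (@eq_int _ _ _ mu _ (fun x => g x * psi x - g' x * psi x)); last first.
    by move=> x; rewrite mulN1r mulrBl.
  rewrite (intB (locint_mul_rtest lg tp) (locint_mul_rtest lg' tp)).
  by apply/eqP; rewrite subr_eq0 -eqr_opp -H// -H'.
by apply: filterS => x; rewrite mulN1r => /eqP; rewrite subr_eq0 => /eqP.
Qed.

Lemma ae_rweak j f f' g g' : {ae mu, forall x, f x = f' x} ->
  {ae mu, forall x, g x = g' x} -> meas f' -> meas g' ->
  rweak j f g -> rweak j f' g'.
Proof.
move=> ff gg mf' mg' [lf lg H].
have li k k' : {ae mu, forall x, k x = k' x} -> meas k' -> locint k -> locint k'.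
  move=> kk mk' [mk Ik]; split => // c; apply: ae_intg (Ik c).
    by apply: measurable_funM => //; apply: measurable_indic; exact: measurable_cube.
  by apply: filterS kk => x ->.
split; [exact: li ff _ _|exact: li gg _ _|].
have ei k k' psi : {ae mu, forall x, k x = k' x} -> meas k -> meas k' -> rtest psi ->
    \int[mu]_x (k' x * psi x) = \int[mu]_x (k x * psi x).
  move=> kk mk mk' [sp _]; have mp := smooth_meas sp.
  apply: ae_eq_int; [exact: measurable_funM|exact: measurable_funM|].
  by apply: filterS kk => x ->.
move=> psi tp; rewrite (ei _ _ _ ff (proj1 lf) mf' (rtest_partial j tp)).
by rewrite (ei _ _ _ gg (proj1 lg) mg' tp) H.
Qed.

Lemma rweakM j f g eta : rtest eta -> rweak j f g ->
  rweak j (fun x => f x * eta x) (fun x => g x * eta x + f x * partial j eta x).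
Proof.
move=> te [lf lg H]; have tej := rtest_partial j te; have [se _] := te.
have I1 := locint_mul_rtest lf te.
have I2 := locint_mul_rtest lg te.
have I3 := locint_mul_rtest lf tej.
split; [exact: intg_locint|exact: intg_locint (intgD I2 I3)|].
move=> psi tp; have [sp _] := tp; have tpj := rtest_partial j tp.
have t1 : rtest (fun x => eta x * psi x) by exact: rtestM_smooth.
have t2 : rtest (fun x => partial j eta x * psi x).
  exact: (rtestM_smooth (smooth_partial j se) tp).
have t3 : rtest (fun x => eta x * partial j psi x).
  exact: rtestM_smooth se tpj.
have := H _ t1; rewrite partialM//.
rewrite (@eq_int _ _ _ mu _ (fun x => f x * (partial j eta x * psi x) +
  f x * (eta x * partial j psi x))); last by move=> x; rewrite mulrDr.
rewrite (intD (locint_mul_rtest lf t2) (locint_mul_rtest lf t3)) => Hs.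
rewrite (@eq_int _ _ _ mu _ (fun x => f x * (eta x * partial j psi x))); last first.
  by move=> x; rewrite mulrA.
rewrite [in RHS](@eq_int _ _ _ mu _ (fun x => g x * (eta x * psi x) +
  f x * (partial j eta x * psi x))); last by move=> x; rewrite mulrDl !mulrA.
rewrite (intD (locint_mul_rtest lg t1) (locint_mul_rtest lf t2)) opprD -Hs.
by rewrite addrAC subrr add0r.
Qed.

(** The integral of psi(x - y) in y does not depend on x. For |x| < 1 it is the convolution of psi
    with the indicator of a cube exceeding its support by 1, so the derivative of this convolution
    at 0 vanishes; that derivative is the integral in question. *)
Lemma int_partial_rtest j psi : rtest psi -> \int[mu]_x partial j psi x = 0.
Proof.
move=> tp; have tpj := rtest_partial j tp; have [sp [c sc]] := tp.
pose Q := cube (`|c| + 1) : set E.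
have IQ : intg (\1_Q) by exact: intg_indic_cube.
have EQ h x : supp_in c h -> intg h -> `|x| < 1 ->
    convol \1_Q h x = \int[mu]_y h y.
  move=> sh Ih x1; rewrite /convol -(int_refl x Ih); apply: eq_int => y.
  have [->|hy] := eqVneq (h (x - y)) 0; first by rewrite mulr0.
  rewrite indicE mem_set ?mul1r// => i.
  have yc : `|(x - y) ord0 i| <= `|c|.
    rewrite leNgt; apply/negP => cy.
    by rewrite (sh _ i (le_lt_trans (ler_norm c) cy)) eqxx in hy.
  have xi := le_lt_trans (coord_norm_le x i) x1.
  rewrite (_ : y ord0 i = x ord0 i - (x - y) ord0 i); last by rewrite !mxE subKr.
  by rewrite (le_trans (ler_normB _ _))// addrC lerD// ltW.
have scj : supp_in c (partial j psi).
  move=> x i xi.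
  have [_ [c' _]] := tpj.
  exact: partial_supp sc _ _ xi.
have D := conv_is_derive 0 j IQ tp.
rewrite -(EQ _ 0 scj (rtest_intg tpj)) ?normr0//.
have [_ <-] := D.
rewrite -(@near_eq_derive R E R (fun=> \int[mu]_y psi y)) ?derive_cst//.
have : nbhs (0 : E) [set x : E | `|x| < 1].
  apply/nbhs_ballP; exists 1 => //= x; rewrite -ball_normE /ball_/=.
  by rewrite sub0r normrN.
by apply: filterS => x x1; rewrite EQ//; exact: rtest_intg.
Qed.

Lemma rweak_rtest j psi : rtest psi -> rweak j psi (partial j psi).
Proof.
move=> tp; have [sp _] := tp; have tpj := rtest_partial j tp.
split; [exact/intg_locint/rtest_intg|exact/intg_locint/rtest_intg|].
move=> h th; have [sh _] := th; have thj := rtest_partial j th.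
have t1 : rtest (fun x => psi x * h x) by exact: rtestM_smooth.
have I1 : intg (fun x => partial j psi x * h x).
  exact: (rtest_intg (rtestM_smooth (smooth_partial j sp) th)).
have I2 : intg (fun x => psi x * partial j h x).
  exact: (rtest_intg (rtestM_smooth sp thj)).
have := int_partial_rtest j t1; rewrite partialM// (intD I1 I2) => /eqP.
by rewrite addrC addr_eq0 => /eqP.
Qed.

(** Two signs cancel: one from differentiating the reflected kernel y -> r (x - y), the other from
    the definition of the weak derivative. *)
Lemma mollify_partial j f g r : intg f -> rweak j f g -> rtest r ->
  partial j (convol f r) = convol g r.
Proof.
move=> If [_ _ H] tr; rewrite partial_conv//; apply/funext => x.
have [sr _] := tr.
rewrite /convol.
have := H _ (rtest_refl x tr); rewrite partial_refl// => Hx.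
have I1 := locint_mul_rtest (intg_locint If) (rtest_refl x (rtest_partial j tr)).
rewrite (@eq_int _ _ _ mu _ (fun y => - (f y * partial j r (x - y)))) in Hx; last first.
  by move=> y; rewrite mulrN.
by rewrite (intN I1) in Hx; exact: oppr_inj.
Qed.

End weak_derivatives.

(** * Radial cutoffs *)

Section radial_cutoffs.
Context {R : realType} {N : nat}.
Local Notation E := 'rV[R]_N.
Local Notation e_ j := (delta_mx ord0 j : E).
Implicit Types (f g h : E -> R) (x : E) (j : 'I_N).

Variables (K : R) (chi : R -> R) (a : E) (l : R).
Hypotheses (hchi : cutoff K chi) (l0 : 0 < l).

Lemma cutoff_smooth1 : smooth1 chi.
Proof. by have [H _ _ _ _] := hchi. Qed.

Lemma derive1n_near_cst (c : R) (U : set R) n : open U -> (forall t, U t -> chi t = c) ->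
  forall t, U t -> derive1n n.+1 chi t = 0.
Proof.
move=> oU Uc; have near0 (f : R -> R) (d : R) : (forall t, U t -> f t = d) ->
    forall t, U t -> f^`()%classic t = 0.
  move=> fd t Ut; rewrite derive1E -(@near_eq_derive R R R (fun=> d)) ?derive_cst//.
  by apply: filterS (open_nbhs_nbhs (conj oU Ut)) => s /fd.
elim: n => [|n IH] t Ut; first by rewrite derive1nS derive1n0; exact: (near0 _ c).
by rewrite derive1nS; exact: (near0 _ 0).
Qed.

Lemma cutoff_flat n (t : R) : `|t| < 1 \/ 2 < `|t| -> derive1n n.+1 chi t = 0.
Proof.
have [_ h1 h2 _ _] := hchi.
move=> [t1|t2].
  apply: (@derive1n_near_cst 1 [set s | `|s| < 1]) => // [|s /ltW /h1//].
  exact: (open_comp (fun s _ => @norm_continuous _ R s) (@open_lt R 1)).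
apply: (@derive1n_near_cst 0 [set s | 2 < `|s|]) => // [|s /ltW /h2//].
exact: (open_comp (fun s _ => @norm_continuous _ R s) (@open_gt R 2)).
Qed.

Let r x := enorm (x - a).
Let q x := dotv (x - a) (x - a).

Let r_ge0 x : 0 <= r x. Proof. exact: enorm_ge0. Qed.

Let shiftc i : smooth (fun x => x ord0 i - a ord0 i).
Proof. by apply: smoothB; [exact: smooth_coordE|exact: smooth_cst]. Qed.

Let d_shiftc j i x : is_derive x (e_ j) (fun x : E => x ord0 i - a ord0 i) (i == j)%:R.
Proof.
have := is_deriveB (is_derive_coord i x (e_ j)) (@is_derive_cst R E R (a ord0 i) x (e_ j)).
by rewrite subr0 ej_coord.
Qed.

Let qE : q = fun x => \sum_(i < N) (x ord0 i - a ord0 i) * (x ord0 i - a ord0 i).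
Proof. by apply/funext => x; apply: eq_bigr => i _; rewrite !mxE. Qed.

Let smooth_q : smooth q.
Proof. by rewrite qE; apply: smooth_sum => i; apply: smoothM; exact: shiftc. Qed.

Let d_q j x : is_derive x (e_ j) q (2 * (x ord0 j - a ord0 j)).
Proof.
have := smooth_is_derive x j smooth_q; congr is_derive.
rewrite qE partial_sum; last by move=> i; apply: smoothM; exact: shiftc.
rewrite (bigD1 j)//= big1 ?addr0.
  rewrite partialM; [|exact: shiftc..].
  rewrite (_ : partial j _ = fun=> 1); first by rewrite mul1r mulr1 mulr_natl.
  by apply: is_derive_partial => y; have := d_shiftc j j y; rewrite eqxx.
move=> i ij; rewrite partialM; [|exact: shiftc..].
rewrite (_ : partial j _ = fun=> 0); first by rewrite mul0r mulr0 addr0.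
by apply: is_derive_partial => y; have := d_shiftc j i y; rewrite (negbTE ij).
Qed.

Let d_r j x : 0 < r x -> is_derive x (e_ j) r ((x ord0 j - a ord0 j) / r x).
Proof.
move=> rx.
have q0 : 0 < q x by rewrite -sqrtr_gt0.
have := is_derive_comp1 (d_q j x) (is_derive1_sqrt q0).
move/is_derive_eq; apply; rewrite -/(enorm (x - a)) -/(r x) invfM.
by field; rewrite gt_eqF.
Qed.

Lemma continuous_enorm : continuous (fun x => enorm (x - a)).
Proof.
move=> x; have cq := smooth_continuous smooth_q.
have cs := @sqrt_continuous R.
exact: (@continuous_comp _ _ _ q (@Num.sqrt R) x (cq x) (cs (q x))).
Qed.

Let continuous_r : continuous r := @continuous_enorm.

Let coord_le_r x i : `|x ord0 i - a ord0 i| <= r x.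
Proof. by have := coord_le_enorm (x - a) i; rewrite !mxE. Qed.

Let rlE x : `|r x / l| = r x / l.
Proof. by rewrite ger0_norm// divr_ge0// ltW. Qed.

(** Finite sums of such terms are stable under differentiation and contain every derivative of the
    cutoff. The index n + 1 ensures at least one derivative of chi, so a term vanishes for r < l,
    and neither the kink of r at the centre nor the value of 1 / r there matters. *)
Let term (n m : nat) p x := derive1n n.+1 chi (r x / l) * ((r x)^-1 ^+ m * p x).

Let term_flat n m p x : r x < l \/ 2 * l < r x -> term n m p x = 0.
Proof.
move=> rl; rewrite /term cutoff_flat ?mul0r// rlE ltr_pdivrMr// ltr_pdivlMr// mul1r.
by case: rl; [left|right].
Qed.

Let r_near x (c : R) : r x < c -> nbhs x [set y | r y < c].
Proof.
move=> rc; have cn : r @ x --> r x := @continuous_r x.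
exact: cvgr_lt cn _ rc.
Qed.

(** The three summands come from differentiating the factor in chi, the power of 1 / r and p. For r
    < l everything is locally zero; otherwise r > 0 and the derivative of r is available. *)
Let d_term n m p j x : smooth p -> is_derive x (e_ j) (term n m p)
  (term n.+1 m.+1 (fun y => l^-1 * ((y ord0 j - a ord0 j) * p y)) x +
   (term n m.+2 (fun y => - m%:R * ((y ord0 j - a ord0 j) * p y)) x +
    term n m (partial j p) x)).
Proof.
move=> sp; have [rl|lr] := ltP (r x) l.
  rewrite !(term_flat _ _ _ (or_introl rl)) !addr0.
  apply: (@near_eq_is_derive R E R (fun=> 0) _ x _ 0 _ (@is_derive_cst R E R 0 x (e_ j))).
  by apply: filterS (r_near rl) => y yl; rewrite (term_flat _ _ _ (or_introl yl)).
have r0 : 0 < r x by exact: lt_le_trans lr.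
have D1 : is_derive x (e_ j) (fun y => r y / l) (l^-1 *: ((x ord0 j - a ord0 j) / r x)).
  rewrite (_ : (fun y => r y / l) = (fun y => l^-1 *: r y)).
    exact: (is_deriveZ l^-1 (d_r j r0)).
  by apply/funext => y; rewrite mulrC.
have D2 := is_derive_comp1 D1 (smooth1_is_derive n.+1 _ cutoff_smooth1).
have D3 : is_derive x (e_ j) (fun y => (r y)^-1 ^+ m)
   (- m%:R * ((x ord0 j - a ord0 j) * (r x)^-1 ^+ m.+2)).
  have DV : is_derive (r x) (1 : R) (fun t : R => t^-1) (- (r x) ^- 2 *: 1).
    by apply: is_deriveV; rewrite gt_eqF.
  have D0 := is_derive_comp1 (d_r j r0) DV.
  elim: m => [|m IH].
    have -> : (fun y => (r y)^-1 ^+ 0) = fun=> 1 by apply/funext => y; rewrite expr0.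
    by rewrite oppr0 mul0r; exact: (@is_derive_cst R E R 1 x (e_ j)).
  have -> : (fun y => (r y)^-1 ^+ m.+1) = fun y => (r y)^-1 * (r y)^-1 ^+ m.
    by apply/funext => y; rewrite exprS.
  have := is_deriveM D0 IH; move/is_derive_eq; apply.
  rewrite /GRing.scale/= !exprS -natr1; field.
  by rewrite gt_eqF.
have D4 : is_derive x (e_ j) (fun y => (r y)^-1 ^+ m * p y) _ :=
  is_deriveM D3 (smooth_is_derive x j sp).
have := is_deriveM D2 D4; move/is_derive_eq; apply.
have sE (u v : R) : u *: v = u * v by [].
rewrite /term !sE !exprS.
move: ((r x)^-1 ^+ m) (derive1n n.+1 chi (r x / l)) (derive1n n.+2 chi (r x / l)) => P X Y.
by field; rewrite !gt_eqF.
Qed.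

Let c_term n m p : smooth p -> continuous (term n m p).
Proof.
move=> sp x; have [rl|lr] := ltP (r x) l.
  rewrite /continuous_at (term_flat _ _ _ (or_introl rl)).
  apply: (@cvg_near_cst _ _ _ _ (nbhs (x : E))).
  apply: (@filterS _ (nbhs (x : E)) _ _ _ _ (r_near rl)) => y yl.
  by rewrite (term_flat _ _ _ (or_introl yl)).
have r0 : 0 < r x by exact: lt_le_trans lr.
have cV : continuous_at x (fun y => (r y)^-1 ^+ m).
  apply: (@continuous_comp _ _ _ (fun y => (r y)^-1) (fun t : R => t ^+ m)).
    by apply: (@cvgV R _ (nbhs x) _ r (r x)); [rewrite gt_eqF|exact: continuous_r].
  exact: exprn_continuous.
have cX : continuous_at x (fun y => derive1n n.+1 chi (r y / l)).
  apply: (@continuous_comp _ _ _ (fun y => r y / l) (derive1n n.+1 chi)).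
    exact: (@continuousM R _ r (fun=> l^-1) x (@continuous_r x) (@cst_continuous _ _ _ x)).
  by apply: differentiable_continuous; apply/derivable1_diffP; exact: cutoff_smooth1.
have cp : continuous_at x p := @smooth_continuous _ _ p sp x.
have cVp := @continuousM R _ (fun y => (r y)^-1 ^+ m) p x cV cp.
exact: (@continuousM R _ (fun y => derive1n n.+1 chi (r y / l))
  (fun y => (r y)^-1 ^+ m * p y) x cX cVp).
Qed.

Let sum_terms (s : seq (nat * nat * (E -> R))) x :=
  \sum_(p <- s) term p.1.1 p.1.2 p.2 x.

Let eta x := chi (r x / l).

Let d_eta j x : is_derive x (e_ j) eta (term 0 1 (fun y => l^-1 * (y ord0 j - a ord0 j)) x).
Proof.
have [rl|lr] := ltP (r x) l.
  rewrite !(term_flat _ _ _ (or_introl rl)).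
  apply: (@near_eq_is_derive R E R (fun=> 1) _ x _ 0 _ (@is_derive_cst R E R 1 x (e_ j))).
  apply: filterS (r_near rl) => y yl; have [_ h1 _ _ _] := hchi.
  by rewrite /eta h1// rlE ler_pdivrMr// mul1r ltW.
have r0 : 0 < r x by exact: lt_le_trans lr.
have D1 : is_derive x (e_ j) (fun y => r y / l) (l^-1 *: ((x ord0 j - a ord0 j) / r x)).
  rewrite (_ : (fun y => r y / l) = (fun y => l^-1 *: r y)).
    exact: (is_deriveZ l^-1 (d_r j r0)).
  by apply/funext => y; rewrite mulrC.
have := is_derive_comp1 D1 (smooth1_is_derive 0 _ cutoff_smooth1).
move/is_derive_eq; apply; rewrite /term /GRing.scale/= expr1; field.
by rewrite !gt_eqF.
Qed.

Let smooth_term n m p : smooth p -> smooth (term n m p).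
Proof.
move=> sp.
pose ok (s : seq (nat * nat * (E -> R))) := forall p, List.In p s -> smooth p.2.
apply: (@smooth_coind _ _ (fun h => exists s, ok s /\ h = sum_terms s)); last first.
  exists [:: (n, m, p)]; split; first by move=> t [<-|[]].
  by apply/funext => x; rewrite /sum_terms big_cons big_nil addr0.
move=> _ [s [oks ->]]; split.
  elim: s oks => [_|t s IH oks].
    rewrite (_ : sum_terms _ = fun=> 0); first exact: cst_continuous.
    by apply/funext => x; rewrite /sum_terms big_nil.
  rewrite (_ : sum_terms _ = fun x => term t.1.1 t.1.2 t.2 x + sum_terms s x); last first.
    by apply/funext => x; rewrite /sum_terms big_cons.
  apply: continuous_add; first exact: (@c_term t.1.1 t.1.2 t.2 (oks t (or_introl erefl))).
  exact: (IH (fun u us => oks u (or_intror us))).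
move=> j.
pose d (t : nat * nat * (E -> R)) :=
  [:: (t.1.1.+1, t.1.2.+1, fun y : E => l^-1 * ((y ord0 j - a ord0 j) * t.2 y));
      (t.1.1, t.1.2.+2, fun y : E => - t.1.2%:R * ((y ord0 j - a ord0 j) * t.2 y));
      (t.1.1, t.1.2, partial j t.2)].
have H x : is_derive x (e_ j) (sum_terms s) (sum_terms (flatten [seq d t | t <- s]) x).
  elim: s oks => [_|t s IH oks].
    rewrite (_ : sum_terms _ = fun=> 0).
      exact: (@is_derive_cst R E R 0 x (e_ j)).
    by apply/funext => y; rewrite /sum_terms big_nil.
  rewrite (_ : sum_terms _ = fun x => term t.1.1 t.1.2 t.2 x + sum_terms s x); last first.
    by apply/funext => y; rewrite /sum_terms big_cons.
  have := is_deriveD (d_term t.1.1 t.1.2 j x (oks t (or_introl erefl)))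
    (IH (fun u us => oks u (or_intror us))).
  by move/is_derive_eq; apply; rewrite /sum_terms /= !big_cons !addrA.
split; first by move=> x; have [] := H x.
exists (flatten [seq d t | t <- s]); split; last exact: is_derive_partial.
elim: s oks {H} => [_ ? []|t s IH oks u /=].
have st := oks t (or_introl erefl).
have sc := shiftc j.
move=> [<-|[<-|[<-|us]]] /=.
- exact: (smoothZ _ (smoothM sc st)).
- exact: (smoothZ _ (smoothM sc st)).
- exact: smooth_partial.
- exact: (IH (fun u us => oks u (or_intror us))).
Qed.

Let sp0 j : smooth (fun y : E => l^-1 * (y ord0 j - a ord0 j)).
Proof. exact: (smoothZ _ (shiftc j)). Qed.

Let partial_eta j : partial j eta = term 0 1 (fun y => l^-1 * (y ord0 j - a ord0 j)).
Proof. by apply: is_derive_partial => x; exact: d_eta. Qed.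

Lemma radial_cutoff_rtest : rtest (fun x => chi (enorm (x - a) / l)).
Proof.
split.
  (* [eta] carries chi itself and is not a [term], but its partial derivatives are, so one extra
     member of the class suffices. *)
  apply: (@smooth_coind _ _ (fun h => h = eta \/ smooth h)); last by left.
  move=> h [->|sh].
    split.
      move=> x; apply: (@continuous_comp _ _ _ (fun y => r y / l) chi).
        exact: (@continuousM R _ r (fun=> l^-1) x (@continuous_r x) (@cst_continuous _ _ _ x)).
      apply: differentiable_continuous; apply/derivable1_diffP.
      by have := @cutoff_smooth1 0%N (r x / l); rewrite derive1n0.
    move=> j; split; first by move=> x; have [] := d_eta j x.
    by right; rewrite partial_eta; exact: (smooth_term _ _ (sp0 j)).
  split; first exact: smooth_continuous.
  move=> j; split; first by move=> x; exact: smooth_derivable.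
  by right; exact: smooth_partial.
exists (2 * l + `|a|) => x i xi; have [_ _ h2 _ _] := hchi.
rewrite h2// rlE ler_pdivlMr//.
apply: le_trans (coord_le_r x i).
have := ler_normD (x ord0 i - a ord0 i) (a ord0 i); rewrite subrK => h.
have := coord_norm_le a i; have := lt_le_trans xi h => h3 h4.
by rewrite ltW// -(ltrD2r `|a|) (lt_le_trans h3)// lerD2l.
Qed.

Lemma radial_cutoff_flat j x : enorm (x - a) < l \/ 2 * l < enorm (x - a) ->
  partial j (fun y => chi (enorm (y - a) / l)) x = 0 /\
  partial j (partial j (fun y => chi (enorm (y - a) / l))) x = 0.
Proof.
move=> H; rewrite -/eta partial_eta; split; first exact: term_flat.
by have [_] := d_term 0 1 j x (sp0 j); rewrite !(term_flat _ _ _ H) !addr0.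
Qed.

Let K0 : 0 <= K.
Proof. by have [_ _ _ + _] := hchi => /(_ 0); apply: le_trans. Qed.

Lemma radial_cutoff_partial j x :
  `|partial j (fun y => chi (enorm (y - a) / l)) x| <= K / l.
Proof.
have [rl|lr] := ltP (r x) l.
  have [-> _] := radial_cutoff_flat j (or_introl rl).
  by rewrite normr0 divr_ge0// ltW.
have r0 : 0 < r x by exact: lt_le_trans lr.
have [_ _ _ h1 _] := hchi.
rewrite -/eta partial_eta /term expr1 normrM ler_pM//.
have z : `|x ord0 j - a ord0 j| / r x <= 1 by rewrite ler_pdivrMr// mul1r.
have l1 : 0 <= l^-1 by rewrite invr_ge0 ltW.
have r1 : 0 <= (r x)^-1 by rewrite invr_ge0 ltW.
rewrite !normrM (ger0_norm l1) (ger0_norm r1).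
rewrite (_ : _ * _ = `|x ord0 j - a ord0 j| / r x * l^-1); last by ring.
by rewrite -[leRHS]mul1r ler_wpM2r.
Qed.

(** The three contributions of size K / l^2 come from differentiating chi', 1 / r and the coordinate
    x_j - a_j. Where they are nonzero r >= l, so every 1 / r is at most 1 / l. *)
Lemma radial_cutoff_partial2 j x :
  `|partial j (partial j (fun y => chi (enorm (y - a) / l))) x| <= 3 * (K / l ^+ 2).
Proof.
have [rl|lr] := ltP (r x) l.
  have [_ ->] := radial_cutoff_flat j (or_introl rl).
  by rewrite normr0 mulr_ge0// divr_ge0// sqr_ge0.
have r0 : 0 < r x by exact: lt_le_trans lr.
have [_ _ _ h1 h2] := hchi.
have rl1 : (r x)^-1 <= l^-1 by rewrite lef_pV2.
have z : `|x ord0 j - a ord0 j| / r x <= 1 by rewrite ler_pdivrMr// mul1r.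
have z0 : 0 <= `|x ord0 j - a ord0 j| / r x by rewrite divr_ge0// ltW.
have l1 : 0 <= l^-1 by rewrite invr_ge0 ltW.
have r1 : 0 <= (r x)^-1 by rewrite invr_ge0 ltW.
rewrite -/eta partial_eta.
have [_] := d_term 0 1 j x (sp0 j); rewrite -/(partial j _ x) => ->.
have pl : partial j (fun y : E => l^-1 * (y ord0 j - a ord0 j)) = fun=> l^-1.
  rewrite partialZ; last exact: shiftc.
  apply/funext => y; have [_] := d_shiftc j j y.
  by rewrite /partial => ->; rewrite eqxx mulr1.
rewrite pl.
have -> : 3 * (K / l ^+ 2) = K / l ^+ 2 + (K / l ^+ 2 + K / l ^+ 2) by ring.
have ln : `|l^-1| = l^-1 by rewrite ger0_norm.
have rn : `|(r x)^-1| = (r x)^-1 by rewrite ger0_norm.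
(* w is a direction cosine, hence at most 1 in absolute value. *)
pose w := (x ord0 j - a ord0 j) / r x.
have w1 : `|w ^+ 2| <= 1.
  by rewrite normrX exprn_ile1// /w normrM rn.
have b1 : `|w ^+ 2 * (l^-1 * l^-1)| <= (l ^+ 2)^-1.
  rewrite normrM -[leRHS]mul1r ler_pM// ger0_norm ?mulr_ge0//.
  by rewrite expr2 invfM.
have b2 : `|w ^+ 2 * ((r x)^-1 * l^-1)| <= (l ^+ 2)^-1.
  rewrite normrM -[leRHS]mul1r ler_pM// ger0_norm ?mulr_ge0//.
  by rewrite expr2 invfM ler_wpM2r.
have b3 : `|(r x)^-1 * l^-1| <= (l ^+ 2)^-1.
  by rewrite ger0_norm ?mulr_ge0// expr2 invfM ler_wpM2r.
rewrite /term.
rewrite (_ : (r x)^-1 ^+ 2 * _ = w ^+ 2 * (l^-1 * l^-1)); last by rewrite /w; ring.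
rewrite (_ : (r x)^-1 ^+ 3 * _ = - (w ^+ 2 * ((r x)^-1 * l^-1))); last by rewrite /w; ring.
rewrite expr1.
rewrite (le_trans (ler_normD _ _))// lerD//; first by rewrite normrM ler_pM.
rewrite (le_trans (ler_normD _ _))// lerD//; first by rewrite normrM normrN ler_pM.
by rewrite normrM ler_pM.
Qed.

End radial_cutoffs.

(** * Time derivative of the localised mass *)

Section energy.
Context {R : realType} {N : nat}.
Local Notation E := 'rV[R]_N.
Local Notation mu := (leb N : {measure set E -> \bar R}).
Local Notation intg := (rintegrable mu).
Implicit Types (f h k eta psi : E -> R) (g : 'I_N -> E -> R) (x : E) (j : 'I_N) (c : R).

Definition L2loc f := meas f /\ locint (fun x => f x ^+ 2).
Definition L2 f := meas f /\ intg (fun x => f x ^+ 2).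

Lemma meas_sqr f : meas f -> meas (fun x => f x ^+ 2).
Proof. by move=> mf; under eq_fun do rewrite expr2; exact: measurable_funM. Qed.

Lemma L2_L2loc f : L2 f -> L2loc f.
Proof. by move=> [mf If]; split => //; exact: intg_locint. Qed.

Lemma bounded_L2loc f c : meas f -> bounded_by c f -> L2loc f.
Proof.
move=> mf fc; split => //; apply: (@bounded_locint _ _ (c ^+ 2)); first exact: meas_sqr.
move=> x; rewrite normrX; have := fc x; have := normr_ge0 (f x) => h1 h2.
by rewrite ler_pXn2r// nnegrE (le_trans h1).
Qed.

Lemma sqrD_le (a b : R) : (a + b) ^+ 2 <= 2 * (a ^+ 2 + b ^+ 2).
Proof. by have := sqr_ge0 (a - b); rewrite !expr2; lra. Qed.

Lemma intgM_L2 f h : L2 f -> L2 h -> intg (fun x => f x * h x).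
Proof.
move=> [mf If] [mh Ih].
apply: (@le_intg _ _ _ mu _ (fun x => 1 * f x ^+ 2 + 1^-1 * h x ^+ 2)).
- exact: measurable_funM.
- by move=> x; exact: young2.
- exact: intgD (intgZ _ If) (intgZ _ Ih).
Qed.

Lemma L2D f h : L2 f -> L2 h -> L2 (fun x => f x + h x).
Proof.
move=> [mf If] [mh Ih]; have mfh := measurable_funD mf mh; split => //.
apply: (@le_intg _ _ _ mu _ (fun x => 2 * (f x ^+ 2 + h x ^+ 2))).
- exact: meas_sqr.
- by move=> x; rewrite ger0_norm ?sqr_ge0// sqrD_le.
- exact: intgZ (intgD If Ih).
Qed.

Lemma L2Z (a : R) f : L2 f -> L2 (fun x => a * f x).
Proof.
move=> [mf If]; split; first exact: measurable_funM.
by under eq_fun do rewrite exprMn; exact: intgZ.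
Qed.

Lemma L2B f h : L2 f -> L2 h -> L2 (fun x => f x - h x).
Proof.
move=> Lf Lh; have := L2D Lf (L2Z (-1) Lh).
by congr L2; apply/funext => x; rewrite mulN1r.
Qed.

Lemma L2locD f h : L2loc f -> L2loc h -> L2loc (fun x => f x + h x).
Proof.
move=> [mf If] [mh Ih]; have mfh := measurable_funD mf mh; split => //.
split; first exact: meas_sqr.
move=> c; have [_ /(_ c) Ifh] := locintZ 2 (locintD If Ih).
apply: (le_intg _ _ Ifh).
  by apply: measurable_funM; [exact: meas_sqr|apply: measurable_indic; exact: measurable_cube].
move=> x; rewrite normrM ger0_norm ?sqr_ge0// indicE normr_nat.
by rewrite ler_wpM2r// sqrD_le.
Qed.

Lemma L2loc_locint f : L2loc f -> locint f.
Proof.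
move=> [mf [_ If]]; split => // c.
apply: (@le_intg _ _ _ mu _ (fun x => f x ^+ 2 * \1_(cube c) x + \1_(cube c) x)).
- by apply: measurable_funM => //; apply: measurable_indic; exact: measurable_cube.
- move=> x; rewrite normrM indicE normr_nat; case: (_ \in _).
    by rewrite !mulr1; exact: norm_le_sqrD1.
  by rewrite !mulr0 addr0.
- exact: intgD (If c) (@intg_indic_cube R N c).
Qed.

Lemma supp_mulr c f h : supp_in c h -> supp_in c (fun x => f x * h x).
Proof. by move=> sh x i xi; rewrite (sh x i xi) mulr0. Qed.

Lemma L2loc_mul c (M : R) f h : L2loc f -> meas h -> bounded_by M h -> supp_in c h ->
  L2 (fun x => f x * h x).
Proof.
move=> [mf If] mh hM sh; split; first exact: measurable_funM.
under eq_fun do rewrite exprMn.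
apply: (@locint_mul _ _ c (M ^+ 2)) => //.
- exact: meas_sqr.
- move=> x; rewrite normrX; have := hM x; have := normr_ge0 (h x) => h1 h2.
  by rewrite ler_pXn2r// nnegrE (le_trans h1).
- by move=> x i xi; rewrite (sh x i xi) expr0n.
Qed.

Lemma L2loc_mul_rtest f h : L2loc f -> rtest h -> L2 (fun x => f x * h x).
Proof.
move=> Lf th; have [M _ hM] := rtest_bounded th.
by have [sh [c sc]] := th; exact: L2loc_mul Lf (smooth_meas sh) hM sc.
Qed.

(* Squared H^1 norm of f, whose weak gradient is g. *)
Definition sqH1 f g := \int[mu]_x (f x ^+ 2) + \sum_(j < N) \int[mu]_x (g j x ^+ 2).

Lemma sqH1_ge0 f g : 0 <= sqH1 f g.
Proof.
apply: addr_ge0; first by apply: int_ge0 => x; exact: sqr_ge0.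
by apply: sumr_ge0 => j _; apply: int_ge0 => x; exact: sqr_ge0.
Qed.

Definition sqH1t psi := sqH1 psi (fun j => partial j psi).

(** The weak gradient is carried as explicit data. A common supporting cube makes functions and
    gradients integrable and their mollifications test functions. *)
Definition H1c c f g := [/\ L2 f, forall j, L2 (g j), supp_in c f,
  forall j, supp_in c (g j) & forall j, rweak j f (g j)].

Lemma L2_supp_intg c f : L2 f -> supp_in c f -> intg f.
Proof.
move=> Lf sf; have [_ I1] := L2loc_locint (L2_L2loc Lf).
have := I1 c; congr (rintegrable _ _); apply/funext => x; rewrite indicE.
have [_|xc] := boolP (x \in cube c); first by rewrite mulr1.
rewrite mulr0; apply/esym; apply: contrapT => fx; move/negP : xc; apply; rewrite inE => i.
by rewrite leNgt; apply/negP => /sf.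
Qed.

Lemma H1cD c f f' g g' : H1c c f g -> H1c c f' g' ->
  H1c c (fun x => f x + f' x) (fun j x => g j x + g' j x).
Proof.
move=> [Lf Lg sf sg w] [Lf' Lg' sf' sg' w']; split.
- exact: L2D.
- by move=> j; exact: L2D.
- by move=> x i xi; rewrite (sf x i xi) (sf' x i xi) addr0.
- by move=> j x i xi; rewrite (sg j x i xi) (sg' j x i xi) addr0.
- by move=> j; exact: rweakD.
Qed.

Lemma sqH1D_le f f' g g' : L2 f -> L2 f' -> (forall j, L2 (g j)) -> (forall j, L2 (g' j)) ->
  sqH1 (fun x => f x + f' x) (fun j x => g j x + g' j x) <= 2 * (sqH1 f g + sqH1 f' g').
Proof.
move=> Lf Lf' Lg Lg'.
have H h h' : L2 h -> L2 h' -> \int[mu]_x ((h x + h' x) ^+ 2) <=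
    2 * (\int[mu]_x (h x ^+ 2) + \int[mu]_x (h' x ^+ 2)).
  move=> Lh Lh'; have [_ I0] := L2D Lh Lh'.
  have [_ I1] := Lh; have [_ I2] := Lh'.
  rewrite -(intD I1 I2) -(intZ 2 (intgD I1 I2)).
  by apply: (le_int I0 (intgZ 2 (intgD I1 I2))) => x; exact: sqrD_le.
rewrite /sqH1 addrACA mulrDr lerD ?H//.
rewrite -big_split/= mulr_sumr; apply: ler_sum => j _; exact: H.
Qed.

Lemma H1c_mul c f g eta : L2loc f -> (forall j, L2loc (g j)) ->
  (forall j, rweak j f (g j)) -> rtest eta -> supp_in c eta ->
  H1c c (fun x => f x * eta x) (fun j x => g j x * eta x + f x * partial j eta x).
Proof.
move=> Lf Lg w te se; split.
- exact: L2loc_mul_rtest.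
- move=> j; apply: L2D; first exact: L2loc_mul_rtest.
  by apply: L2loc_mul_rtest => //; exact: rtest_partial.
- exact: supp_mulr.
- move=> j x i xi; rewrite (se x i xi) (partial_supp j se xi).
  by rewrite !mulr0 addr0.
- by move=> j; exact: rweakM.
Qed.

Lemma mul_bounded_L2_le (M : R) f h : L2 f -> meas h -> bounded_by M h ->
  L2 (fun x => f x * h x) /\
  \int[mu]_x ((f x * h x) ^+ 2) <= M ^+ 2 * \int[mu]_x (f x ^+ 2).
Proof.
move=> [mf If] mh hM.
have pt x : (f x * h x) ^+ 2 <= M ^+ 2 * f x ^+ 2.
  rewrite exprMn mulrC ler_wpM2r ?sqr_ge0// -real_normK ?num_real//.
  have := hM x; have := normr_ge0 (h x) => h1 h2.
  by rewrite ler_pXn2r// nnegrE (le_trans h1).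
have mfh : meas (fun x => f x * h x) by exact: measurable_funM.
have Ifh : intg (fun x => (f x * h x) ^+ 2).
  apply: (le_intg (meas_sqr mfh) _ (intgZ (M ^+ 2) If)) => x.
  by rewrite ger0_norm ?sqr_ge0.
split => //; rewrite -(intZ _ If); exact: le_int Ifh (intgZ _ If) pt.
Qed.

(** The constant involves only sup norms of eta and its partials, so one C serves all increments of
    the solution. *)
Lemma sqH1_mul_le eta : rtest eta -> exists2 C, 0 <= C & forall f g,
  L2 f -> (forall j, L2 (g j)) ->
  sqH1 (fun x => f x * eta x) (fun j x => g j x * eta x + f x * partial j eta x) <=
  C * sqH1 f g.
Proof.
move=> te; have [M0 M0p h0] := rtest_bounded te.
have bd j : exists C, bounded_by C (partial j eta).
  by have [C _ hC] := rtest_bounded (rtest_partial j te); exists C.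
have [M hM] := choice bd.
pose S := M0 ^+ 2 + \sum_(j < N) 2 * M j ^+ 2 + 2 * M0 ^+ 2.
have S1 : 0 <= \sum_(j < N) 2 * M j ^+ 2.
  by apply: sumr_ge0 => j _; rewrite mulr_ge0// sqr_ge0.
have S0 : 0 <= S by rewrite /S !addr_ge0// ?mulr_ge0// ?sqr_ge0.
exists S => // f g Lf Lg.
have me := smooth_meas (proj1 te).
have mp j := smooth_meas (smooth_partial j (proj1 te)).
have [_ H0] := mul_bounded_L2_le Lf me h0.
have Hj j : \int[mu]_x ((g j x * eta x + f x * partial j eta x) ^+ 2) <=
   2 * M0 ^+ 2 * \int[mu]_x (g j x ^+ 2) + 2 * M j ^+ 2 * \int[mu]_x (f x ^+ 2).
  have [L1 H1] := mul_bounded_L2_le (Lg j) me h0.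
  have [L2' H2] := mul_bounded_L2_le Lf (mp j) (hM j).
  have [_ I0] := L2D L1 L2'.
  have [_ I1] := L1; have [_ I2] := L2'.
  apply: (@le_trans _ _ (\int[mu]_x (2 * ((g j x * eta x) ^+ 2 + (f x * partial j eta x) ^+ 2)))).
    by apply: (le_int I0 (intgZ 2 (intgD I1 I2))) => x; exact: sqrD_le.
  rewrite (intZ 2 (intgD I1 I2)) (intD I1 I2) mulrDr.
  by apply: lerD; rewrite -[leRHS]mulrA; apply: ler_wpM2l.
rewrite /sqH1.
set If := \int[mu]_x (f x ^+ 2) in H0 Hj *.
have If0 : 0 <= If by apply: int_ge0 => x; exact: sqr_ge0.
set G := \sum_(j < N) \int[mu]_x (g j x ^+ 2).
have G0 : 0 <= G.
  by apply: sumr_ge0 => j _; apply: int_ge0 => x; exact: sqr_ge0.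
apply: (@le_trans _ _ (M0 ^+ 2 * If + (2 * M0 ^+ 2 * G + (\sum_(j < N) 2 * M j ^+ 2) * If))).
  rewrite lerD// mulr_sumr mulr_suml -big_split/=; apply: ler_sum => j _; exact: Hj.
rewrite /S; move: S1; move: (\sum_(j < N) 2 * M j ^+ 2) => S' S1.
rewrite -subr_ge0 (_ : _ - _ = (M0 ^+ 2 + S') * G + 2 * M0 ^+ 2 * If); last by ring.
by rewrite addr_ge0// ?mulr_ge0// ?addr_ge0// ?sqr_ge0.
Qed.

Lemma convolB f f' r (M : R) : intg f -> intg f' -> meas r -> bounded_by M r ->
  (fun x => convol f r x - convol f' r x) = convol (fun x => f x - f' x) r.
Proof.
move=> If If' mr rM; apply/funext => x.
rewrite /convol -intB; [|exact: intg_conv_kernel If mr rM|exact: intg_conv_kernel If' mr rM].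
by apply: eq_int => y; rewrite mulrBl.
Qed.

Section moll.
Variable rho : nat -> E -> R.
Hypothesis Hrho : mollifier rho.

(** Mollification commutes with weak derivatives and contracts L^2, so the H^1 norm does not grow:
    this makes the bounds on the test functions uniform in n. *)
Lemma H1c_mollify c f g n : H1c c f g -> let psi := convol f (rho n) in
  [/\ rtest psi, sqH1t psi <= sqH1 f g & forall j, partial j psi = convol (g j) (rho n)].
Proof.
move=> [Lf Lg sf sg w] psi.
have [tr r0 r1 rs] := Hrho n.
have If := L2_supp_intg Lf sf.
have Ig j := L2_supp_intg (Lg j) (sg j).
have pE j : partial j psi = convol (g j) (rho n) by exact: mollify_partial.
split => //; first exact: conv_rtest If sf tr.
rewrite /sqH1t /sqH1 lerD//; first exact: (mollify_sqr Hrho n If (proj2 Lf)).2.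
apply: ler_sum => j _; rewrite pE.
exact: (mollify_sqr Hrho n (Ig j) (proj2 (Lg j))).2.
Qed.

End moll.

End energy.

Lemma dist_four (R : realFieldType) (va vb va' vb' a b s t : R) :
  `|a - va'| <= s -> `|b - vb'| <= s -> `|va' - va| <= t -> `|vb' - vb| <= t ->
  `|va + vb - (a + b)| <= s + s + (t + t).
Proof.
rewrite !ler_norml => /andP[? ?] /andP[? ?] /andP[? ?] /andP[? ?].
by apply/andP; split; lra.
Qed.

(** This is the error bound of [mass_derivative], with u the squared H^1 norm of the increment and v
    the H^{-1} error of the difference quotient. *)
Lemma modulus_cvg0 (R : realType) (T : Type) (F : set_system T) {FF : Filter F}
    (S C D : R) (u v : T -> R) : u @ F --> 0 -> v @ F --> 0 ->
  (fun h => v h * Num.sqrt (S + 2 * (C * u h)) + v h * Num.sqrt (S + 2 * (C * u h)) +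
    (D * Num.sqrt (C * u h) + D * Num.sqrt (C * u h))) @ F --> 0.
Proof.
move=> u0 v0.
have cst (c : R) : (fun=> c) @ F --> c by exact: cvg_cst.
have M f g (a b : R) : f @ F --> a -> g @ F --> b -> (fun h => f h * g h) @ F --> a * b.
  by move=> fa gb; exact: (cvgM fa gb).
have P f g (a b : R) : f @ F --> a -> g @ F --> b -> (fun h => f h + g h) @ F --> a + b.
  by move=> fa gb; exact: (cvgD fa gb).
have sq w (l : R) : w @ F --> l -> (fun h => Num.sqrt (w h)) @ F --> Num.sqrt l.
  by move=> wl; exact: (cvg_comp _ _ wl (@sqrt_continuous R l)).
have cu := M _ _ _ _ (cst C) u0.
have c1 := M _ _ _ _ v0 (sq _ _ (P _ _ _ _ (cst S) (M _ _ _ _ (cst 2) cu))).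
have c2 := M _ _ _ _ (cst D) (sq _ _ cu).
have := P _ _ _ _ (P _ _ _ _ c1 c1) (P _ _ _ _ c2 c2).
by rewrite !(mulr0, mul0r, sqrtr0, addr0).
Qed.

Section mass_derivative.
Context {R : realType} {N : nat}.
Local Notation E := 'rV[R]_N.
Local Notation mu := (leb N : {measure set E -> \bar R}).
Local Notation intg := (rintegrable mu).
Implicit Types (f k psi : E -> R) (g : 'I_N -> E -> R) (x : E) (j : 'I_N) (c : R).

Lemma cvg_sumR (I : Type) (s : seq I) (T : Type) (F : set_system T) {FF : Filter F}
    (u : I -> T -> R) (l : I -> R) :
  (forall i, u i @ F --> l i) ->
  (fun n => \sum_(i <- s) u i n) @ F --> \sum_(i <- s) l i.
Proof.
move=> H; elim: s => [|i s IH].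
  by rewrite big_nil; under eq_fun do rewrite big_nil; exact: cvg_cst.
rewrite big_cons; under eq_fun do rewrite big_cons.
by apply: cvgD; [exact: H|exact: IH].
Qed.

Definition lap psi x := \sum_(j < N) partial j (partial j psi) x.

Section limits.
Variable rho : nat -> E -> R.
Hypothesis Hrho : mollifier rho.

Let supp5 n : supp_in 5 (rho n).
Proof.
have [_ _ _ rs] := Hrho n => x i xi; apply: contrapT => /eqP rx.
have /andP[h1 h2] := rs _ rx i.
have n5 : - 5 <= - 5 / n.+1%:R :> R.
  rewrite -[leLHS]mulr1; apply: ler_wnM2l; first by rewrite oppr_le0.
  by rewrite invf_le1 ?ler1n.
have := le_lt_trans n5 h1; move: xi; rewrite (ltr0_norm h2) => xi h3.
by have := lt_trans h3 (_ : x ord0 i < - 5); rewrite ltxx ltrNr => /(_ xi).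
Qed.

(** One integration by parts against the smooth mollification moves a derivative to k; the remaining
    pairings of gradients in L^2 pass to the weak limit. *)
Lemma int_lap_cvg c f g k (kg : 'I_N -> E -> R) : H1c c f g ->
  (forall j, rweak j k (kg j)) -> (forall j, L2 (kg j)) ->
  (fun n => \int[mu]_x (k x * lap (convol f (rho n)) x)) @ \oo -->
  - \sum_(j < N) \int[mu]_x (g j x * kg j x).
Proof.
move=> Hf wk Lk; have [Lf Lg sf sg w] := Hf.
have Ig j := L2_supp_intg (Lg j) (sg j).
rewrite (_ : (fun n => _) =
  fun n => - \sum_(j < N) \int[mu]_x (convol (g j) (rho n) x * kg j x)); last first.
  apply/funext => n; have [tp _ pE] := H1c_mollify Hrho n Hf.
  have tpj j := rtest_partial j tp.
  rewrite (@eq_int _ _ _ mu _ (fun x => \sum_(j < N)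
    k x * partial j (partial j (convol f (rho n))) x)); last first.
    by move=> x; rewrite /lap mulr_sumr.
  rewrite int_sum; last first.
    move=> j; have [lk _ _] := wk j.
    exact: locint_mul_rtest lk (rtest_partial j (tpj j)).
  rewrite -sumrN; apply: eq_bigr => j _.
  have [_ _ ->//] := wk j; congr (- _); apply: eq_int => x.
  by rewrite pE mulrC.
apply: cvgN; apply: cvg_sumR => j.
exact: (mollify_weak_cvg_sqr Hrho (Ig j) (proj1 (Lk j)) (proj2 (Lg j)) (proj2 (Lk j))).
Qed.

(* u is only known to be in L^4_loc and the potential in L^2, so the product
   of u, the mollified u and the potential is dominated with exponents 4, 4, 2. *)
Lemma quartic_young (s b v e : R) : 0 < e ->
  `|s * (b * v)| <= e * s ^+ 4 + (e * b ^+ 4 + e^-1 * v ^+ 2).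
Proof.
move=> e0; rewrite mulrA (le_trans (young2 _ _ e0))// addrA lerD2r -mulrDr ler_wpM2l ?(ltW e0)//.
rewrite exprMn -subr_ge0 (_ : _ - _ = (s ^+ 2 - b ^+ 2) ^+ 2 / 2 + (s ^+ 4 + b ^+ 4) / 2); last by field.
by rewrite addr_ge0// divr_ge0// ?sqr_ge0// addr_ge0// exprn_even_ge0.
Qed.

Lemma int_potential_cvg c f b v : intg f -> supp_in c f -> intg (fun x => f x ^+ 4) ->
  meas b -> locint (fun x => b x ^+ 4) -> L2 v ->
  (fun n => \int[mu]_x ((b x * v x) * convol f (rho n) x)) @ \oo -->
  \int[mu]_x ((b x * v x) * f x).
Proof.
move=> If sf If4 mb [_ lb] [mv Iv].
pose Q := cube (c + 5) : set E.
have mQ : measurable Q by exact: measurable_cube.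
(* Restricting b to Q is invisible, as f and its mollifications vanish outside Q, and it makes b^4
   integrable. *)
pose k x := (b x * \1_Q x) * v x.
have mk : meas k.
  by apply: measurable_funM => //; apply: measurable_funM => //; exact: measurable_indic.
have kb x h : supp_in (c + 5) h -> (b x * v x) * h x = h x * k x.
  move=> sh; rewrite /k indicE; have [xc|xc] := boolP (x \in Q); first by rewrite mulr1; ring.
  rewrite (_ : h x = 0) ?mulr0 ?mul0r//.
  apply: contrapT => hx; move/negP : xc; apply; rewrite inE => i.
  by rewrite leNgt; apply/negP => /sh.
rewrite (_ : (fun n => _) = fun n => \int[mu]_x (convol f (rho n) x * k x)); last first.
  by apply/funext => n; apply: eq_int => x; apply: kb; exact: conv_supp.
rewrite (_ : \int[mu]_x _ = \int[mu]_x (f x * k x)); last first.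
  by apply: eq_int => x; apply: kb; apply: supp_in_le sf; rewrite lerDl.
apply: (mollify_weak_cvg Hrho If mk If4) => [x|e e0]; first by rewrite exprn_even_ge0.
exists (fun x => e * (b x ^+ 4 * \1_Q x) + e^-1 * v x ^+ 2).
  exact: intgD (intgZ _ (lb _)) (intgZ _ Iv).
move=> x y; rewrite (le_trans (quartic_young _ _ _ e0))// !lerD2l lerD2r ler_wpM2l ?(ltW e0)//.
by rewrite exprMn indicE; case: (_ \in _); rewrite ?expr1n// expr0n.
Qed.

Variables (eta al be V : E -> R) (Al Be : 'I_N -> E -> R) (c : R).
Hypotheses (te : rtest eta) (se : supp_in c eta).
Hypotheses (Lal : L2loc al) (Lbe : L2loc be).
Hypotheses (al4 : locint (fun x => al x ^+ 4)) (be4 : locint (fun x => be x ^+ 4)).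
Hypotheses (LAl : forall j, L2 (Al j)) (LBe : forall j, L2 (Be j)).
Hypotheses (wal : forall j, rweak j al (Al j)) (wbe : forall j, rweak j be (Be j)).
Hypothesis (LV : L2 V).
Variables (vR vI : (E -> R) -> R).
Hypothesis (vRE : forall psi, rtest psi -> vR psi =
  - (\int[mu]_x (be x * lap psi x)) - \int[mu]_x ((be x * V x) * psi x)).
Hypothesis (vIE : forall psi, rtest psi -> vI psi =
  \int[mu]_x (al x * lap psi x) + \int[mu]_x ((al x * V x) * psi x)).

(** Formally the mass has derivative vR(2 al eta) + vI(2 be eta), where vR and vI are the real and
    imaginary parts of the velocity; [A] and [B] are these two arguments, [gA] and [gB] their weak
    gradients. *)
Let A x := (2 * al x) * eta x.
Let B x := (2 * be x) * eta x.
Let gA j x := (2 * Al j x) * eta x + (2 * al x) * partial j eta x.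
Let gB j x := (2 * Be j x) * eta x + (2 * be x) * partial j eta x.

(** The vector paired with the gradient of eta is twice the imaginary part of conj(u) grad u, the
    momentum density of the Schrodinger flow. *)
Definition flux := \int[mu]_x (\sum_(j < N) 2 * (al x * Be j x - be x * Al j x) * partial j eta x).

Let L2locZ (a : R) f : L2loc f -> L2loc (fun x => a * f x).
Proof.
move=> [mf If]; split; first exact: measurable_funM.
by under eq_fun do rewrite exprMn; exact: locintZ.
Qed.

Let HA : H1c c A gA.
Proof.
apply: (@H1c_mul _ _ c (fun x => 2 * al x) (fun j x => 2 * Al j x)) => //.
- exact: L2locZ.
- by move=> j; apply/L2locZ/L2_L2loc.
- by move=> j; exact: rweakZ.
Qed.

Let HB : H1c c B gB.
Proof.
apply: (@H1c_mul _ _ c (fun x => 2 * be x) (fun j x => 2 * Be j x)) => //.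
- exact: L2locZ.
- by move=> j; apply/L2locZ/L2_L2loc.
- by move=> j; exact: rweakZ.
Qed.

Let int4 f : locint (fun x => f x ^+ 4) -> intg (fun x => ((2 * f x) * eta x) ^+ 4).
Proof.
move=> lf; have [sE _] := te.
have t4 : rtest (fun x => 2 ^+ 4 * (eta x * (eta x * (eta x * eta x)))).
  exact: (rtestZ _ (rtestM_smooth sE (rtestM_smooth sE (rtestM_smooth sE te)))).
have := locint_mul_rtest lf t4; congr (rintegrable _ _); apply/funext => x; ring.
Qed.

(** In the limit the potential terms 2 al be V eta cancel, and so do the products of the two
    gradients weighted by eta; what remains carries a derivative of eta and is the flux. *)
Lemma velocity_cvg : (fun n => vR (convol A (rho n)) + vI (convol B (rho n))) @ \oo --> flux.
Proof.
have [LA LgA sA sgA wA] := HA; have [LB LgB sB sgB wB] := HB.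
have IA := L2_supp_intg LA sA; have IB := L2_supp_intg LB sB.
rewrite (_ : (fun n => _) = fun n =>
  - (\int[mu]_x (be x * lap (convol A (rho n)) x))
  - \int[mu]_x ((be x * V x) * convol A (rho n) x)
  + (\int[mu]_x (al x * lap (convol B (rho n)) x)
     + \int[mu]_x ((al x * V x) * convol B (rho n) x))); last first.
  apply/funext => n; have [tA _ _] := H1c_mollify Hrho n HA.
  by have [tB _ _] := H1c_mollify Hrho n HB; rewrite (vRE tA) (vIE tB).
have c1 := int_lap_cvg HA wbe LBe.
have c2 := int_lap_cvg HB wal LAl.
have c3 := int_potential_cvg IA sA (int4 al4) (proj1 Lbe) be4 LV.
have c4 := int_potential_cvg IB sB (int4 be4) (proj1 Lal) al4 LV.
have fluxE : flux = - - (\sum_(j < N) \int[mu]_x (gA j x * Be j x)) - \int[mu]_x ((be x * V x) * A x) +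
  (- (\sum_(j < N) \int[mu]_x (gB j x * Al j x)) + \int[mu]_x ((al x * V x) * B x)).
  rewrite opprK (_ : \int[mu]_x ((al x * V x) * B x) = \int[mu]_x ((be x * V x) * A x)); last first.
    by apply: eq_int => x; rewrite /A /B; ring.
  rewrite addrA addrAC subrK -sumrB /flux int_sum; last first.
    move=> j; have tj := rtest_partial j te.
    have h1 := intgM_L2 (L2loc_mul_rtest Lal tj) (LBe j).
    have h2 := intgM_L2 (L2loc_mul_rtest Lbe tj) (LAl j).
    have := intgZ 2 (intgB h1 h2); congr (rintegrable _ _); apply/funext => x; ring.
  apply: eq_bigr => j _.
  rewrite -(intB (intgM_L2 (LgA j) (LBe j)) (intgM_L2 (LgB j) (LAl j))).
  by apply: eq_int => x; rewrite /gA /gB; ring.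
rewrite fluxE; exact: (cvgD (cvgD (cvgN c1) (cvgN c3)) (cvgD c2 c4)).
Qed.

Variables (da db : R -> E -> R) (dA dB : R -> 'I_N -> E -> R).
Hypotheses (Lda : forall h, L2 (da h)) (Ldb : forall h, L2 (db h)).
Hypotheses (LdA : forall h j, L2 (dA h j)) (LdB : forall h j, L2 (dB h j)).
Hypotheses (wda : forall h j, rweak j (da h) (dA h j)).
Hypotheses (wdb : forall h j, rweak j (db h) (dB h j)).
Let en h := sqH1 (da h) (dA h) + sqH1 (db h) (dB h).
Hypothesis en0 : en h @[h --> 0^'] --> 0.
Variable (Cv : R) (eps : R -> R).
Hypotheses (eps0 : eps h @[h --> 0^'] --> 0).
Hypotheses (vRb : forall psi (d : R), rtest psi -> 0 <= d -> sqH1t psi <= d ^+ 2 -> `|vR psi| <= Cv * d).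
Hypotheses (vIb : forall psi (d : R), rtest psi -> 0 <= d -> sqH1t psi <= d ^+ 2 -> `|vI psi| <= Cv * d).
Hypotheses (vRB : forall psi psi', rtest psi -> rtest psi' ->
  vR (fun x => psi x - psi' x) = vR psi - vR psi').
Hypotheses (vIB : forall psi psi', rtest psi -> rtest psi' ->
  vI (fun x => psi x - psi' x) = vI psi - vI psi').
Hypothesis vRe : \forall h \near 0^', forall psi (d : R), rtest psi -> 0 <= d ->
  sqH1t psi <= d ^+ 2 -> `|h^-1 * \int[mu]_x (da h x * psi x) - vR psi| <= eps h * d.
Hypothesis vIe : \forall h \near 0^', forall psi (d : R), rtest psi -> 0 <= d ->
  sqH1t psi <= d ^+ 2 -> `|h^-1 * \int[mu]_x (db h x * psi x) - vI psi| <= eps h * d.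

Let mass h := \int[mu]_x (((al x + da h x) ^+ 2 + (be x + db h x) ^+ 2) * eta x).
Let mass0 := \int[mu]_x ((al x ^+ 2 + be x ^+ 2) * eta x).

Let Ah h x := A x + da h x * eta x.
Let Bh h x := B x + db h x * eta x.
Let gDA h j x := dA h j x * eta x + da h x * partial j eta x.
Let gDB h j x := dB h j x * eta x + db h x * partial j eta x.

Let HDA h : H1c c (fun x => da h x * eta x) (gDA h).
Proof.
by apply: H1c_mul => //; [exact: L2_L2loc|move=> j; exact: L2_L2loc].
Qed.

Let HDB h : H1c c (fun x => db h x * eta x) (gDB h).
Proof.
by apply: H1c_mul => //; [exact: L2_L2loc|move=> j; exact: L2_L2loc].
Qed.

(** By (s + d)^2 - s^2 = d (2 s + d) the quotient is an exact pairing of the increments with [Ah]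
    and [Bh], which differ from [A] and [B] by something small in H^1. *)
Let quotE h : h^-1 * (mass h - mass0) =
  h^-1 * \int[mu]_x (da h x * Ah h x) + h^-1 * \int[mu]_x (db h x * Bh h x).
Proof.
have [LA _ _ _ _] := HA; have [LB _ _ _ _] := HB.
have [LDA _ _ _ _] := HDA h; have [LDB _ _ _ _] := HDB h.
rewrite -mulrDr -(intD (intgM_L2 (Lda h) (L2D LA LDA)) (intgM_L2 (Ldb h) (L2D LB LDB))).
have IM f f' : L2loc f -> L2loc f' -> intg (fun x => (f x ^+ 2 + f' x ^+ 2) * eta x).
  by move=> [_ lf] [_ lf']; exact: locint_mul_rtest (locintD lf lf') te.
rewrite /mass /mass0.
rewrite -(intB (IM _ _ (L2locD Lal (L2_L2loc (Lda h))) (L2locD Lbe (L2_L2loc (Ldb h)))) (IM _ _ Lal Lbe)).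
congr (_ * _); apply: eq_int => x; rewrite /Ah /Bh /A /B; ring.
Qed.

(** Two errors are estimated on mollified functions: the difference between quotient and velocity,
    tested on functions of H^1 norm at most [d1 h], and the velocity tested on the increment times
    eta, of norm at most [d2 h]. Both bounds are independent of n. *)
Theorem mass_derivative : h^-1 * (mass h - mass0) @[h --> 0^'] --> flux.
Proof.
have [LA LgA sA sgA wA] := HA; have [LB LgB sB sgB wB] := HB.
have IA := L2_supp_intg LA sA; have IB := L2_supp_intg LB sB.
have [C C0 HC] := sqH1_mul_le te.
pose S := 2 * (sqH1 A gA + sqH1 B gB).
have S0 : 0 <= S by rewrite mulr_ge0// addr_ge0// sqH1_ge0.
pose d1 h := Num.sqrt (S + 2 * (C * en h)).
pose d2 h := Num.sqrt (C * en h).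
have en_ge0 h : 0 <= en h by rewrite addr_ge0// sqH1_ge0.
have Cen h : 0 <= C * en h by rewrite mulr_ge0.
have eDA h : sqH1 (fun x => da h x * eta x) (gDA h) <= C * en h.
  rewrite (le_trans (HC _ _ (Lda h) (LdA h)))// ler_wpM2l// /en lerDl; exact: sqH1_ge0.
have eDB h : sqH1 (fun x => db h x * eta x) (gDB h) <= C * en h.
  rewrite (le_trans (HC _ _ (Ldb h) (LdB h)))// ler_wpM2l// /en lerDr; exact: sqH1_ge0.
have HAh h : H1c c (Ah h) (fun j x => gA j x + gDA h j x) by exact: H1cD.
have HBh h : H1c c (Bh h) (fun j x => gB j x + gDB h j x) by exact: H1cD.
have eAh h : sqH1 (Ah h) (fun j x => gA j x + gDA h j x) <= d1 h ^+ 2.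
  have [LDA LgDA _ _ _] := HDA h.
  rewrite sqr_sqrtr; last by rewrite addr_ge0// mulr_ge0.
  rewrite (le_trans (sqH1D_le LA LDA LgA LgDA))// mulrDr lerD// ler_wpM2l//.
  by rewrite lerDl sqH1_ge0.
have eBh h : sqH1 (Bh h) (fun j x => gB j x + gDB h j x) <= d1 h ^+ 2.
  have [LDB LgDB _ _ _] := HDB h.
  rewrite sqr_sqrtr; last by rewrite addr_ge0// mulr_ge0.
  rewrite (le_trans (sqH1D_le LB LDB LgB LgDB))// mulrDr lerD// ler_wpM2l//.
  by rewrite lerDr sqH1_ge0.
pose bd h := eps h * d1 h + eps h * d1 h + (Cv * d2 h + Cv * d2 h).
have bd0 : bd h @[h --> 0^'] --> 0.
  have H := @modulus_cvg0 R _ _ _ S C Cv _ _ en0 eps0. exact: H.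
have key : \forall h \near 0^', `|flux - h^-1 * (mass h - mass0)| <= bd h.
  apply: filterS2 vRe vIe => h kR kI.
  have XE : (fun n => h^-1 * \int[mu]_x (da h x * convol (Ah h) (rho n) x) +
      h^-1 * \int[mu]_x (db h x * convol (Bh h) (rho n) x)) @ \oo -->
      h^-1 * (mass h - mass0).
    rewrite quotE.
    have [L1 _ s1 _ _] := HAh h; have [L2' _ s2 _ _] := HBh h.
    have w1 := mollify_weak_cvg_sqr Hrho (L2_supp_intg L1 s1) (proj1 (Lda h)) (proj2 L1) (proj2 (Lda h)).
    have w2 := mollify_weak_cvg_sqr Hrho (L2_supp_intg L2' s2) (proj1 (Ldb h)) (proj2 L2') (proj2 (Ldb h)).
    apply: cvgD; apply: cvgM; try exact: cvg_cst.
      rewrite (_ : \int[mu]_x _ = \int[mu]_x (Ah h x * da h x)); last first.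
        by apply: eq_int => x; rewrite mulrC.
      by under eq_fun do under eq_int do rewrite mulrC.
    rewrite (_ : \int[mu]_x _ = \int[mu]_x (Bh h x * db h x)); last first.
      by apply: eq_int => x; rewrite mulrC.
    by under eq_fun do under eq_int do rewrite mulrC.
  (* Here h is fixed and n tends to infinity: a bound valid for every n passes to the limit. *)
  apply: (cvgr_to_le (cvg_norm (cvgB velocity_cvg XE))); apply: nearW => n /=.
  have [tA eA _] := H1c_mollify Hrho n HA; have [tB eB _] := H1c_mollify Hrho n HB.
  have [tAh eAhn _] := H1c_mollify Hrho n (HAh h).
  have [tBh eBhn _] := H1c_mollify Hrho n (HBh h).
  have [tDA eDAn _] := H1c_mollify Hrho n (HDA h).
  have [tDB eDBn _] := H1c_mollify Hrho n (HDB h).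
  have d1p : 0 <= d1 h by exact: sqrtr_ge0.
  have d2p : 0 <= d2 h by exact: sqrtr_ge0.
  have b1 := kR _ _ tAh d1p (le_trans eAhn (eAh h)).
  have b2 := kI _ _ tBh d1p (le_trans eBhn (eBh h)).
  have d2E : d2 h ^+ 2 = C * en h by rewrite sqr_sqrtr.
  have [tr _ _ _] := Hrho n.
  have [M _ rM] := rtest_bounded tr; have mr := intg_meas (rtest_intg tr).
  have [L1 _ s1 _ _] := HAh h; have [L2' _ s2 _ _] := HBh h.
  have dAE : (fun x => convol (Ah h) (rho n) x - convol A (rho n) x) =
     convol (fun x => da h x * eta x) (rho n).
    rewrite (convolB (L2_supp_intg L1 s1) IA mr rM); congr convol.
    by apply/funext => x; rewrite /Ah addrAC subrr add0r.
  have dBE : (fun x => convol (Bh h) (rho n) x - convol B (rho n) x) =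
     convol (fun x => db h x * eta x) (rho n).
    rewrite (convolB (L2_supp_intg L2' s2) IB mr rM); congr convol.
    by apply/funext => x; rewrite /Bh addrAC subrr add0r.
  have b3 : `|vR (convol (Ah h) (rho n)) - vR (convol A (rho n))| <= Cv * d2 h.
    by rewrite -vRB// dAE; apply: vRb => //; rewrite d2E (le_trans eDAn).
  have b4 : `|vI (convol (Bh h) (rho n)) - vI (convol B (rho n))| <= Cv * d2 h.
    by rewrite -vIB// dBE; apply: vIb => //; rewrite d2E (le_trans eDBn).
  exact: dist_four b1 b2 b3 b4.
apply/cvgrPdist_le => e e0.
apply: filterS2 key ((cvgrPdist_le _ _).1 bd0 _ e0) => h k1.
rewrite sub0r normrN => k2.
exact: le_trans k1 (le_trans (ler_norm _) k2).
Qed.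

End limits.

End mass_derivative.

(** * Smallness of the flux *)

(** The letters stand for phi = a + i b, w = p + i q, their gradients A + i B and P + i Q, and two
    derivatives D, D' of the cutoff; the terms phi Dw are already integrated by parts. This doubles
    p B D and q A D, so p^2 and q^2 receive 2 from them and 1 from p Q D and q P D. Terms with the
    merely bounded factor phi must keep [chi], which stands for the indicator of the annulus. *)
Lemma flux_density_le (R : realFieldType) (a b A B p q P Q D D' M k k' chi : R) :
  `|a| <= M -> `|b| <= M -> `|D| <= k * chi -> `|D'| <= k' * chi -> 0 <= k -> 0 <= chi <= 1 ->
  `|2 * (a * B - b * A) * D + 2 * (p * B - q * A) * D + 2 * (p * Q - q * P) * D
    - 2 * (q * (A * D + a * D')) + 2 * (p * (B * D + b * D'))| <=
  k * (3 * (p ^+ 2 + q ^+ 2) + 2 * (A ^+ 2 + B ^+ 2) + (P ^+ 2 + Q ^+ 2))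
  + 2 * M * ((`|A| + `|B|) * k) * chi + 2 * M * ((`|p| + `|q|) * k') * chi.
Proof.
move=> aM bM Dk Dk' k0 /andP[c0 c1].
have M0 : 0 <= M by exact: le_trans aM.
have Dk1 : `|D| <= k by rewrite (le_trans Dk)// ler_piMr.
have sq2 (x y c : R) : 0 < c -> `|c * (x * y) * D| <= k * (c / 2 * (x ^+ 2 + y ^+ 2)).
  move=> cp; rewrite !normrM (gtr0_norm cp) [leRHS]mulrC ler_pM// ?mulr_ge0// ?(ltW cp)//.
  rewrite -(real_normK (num_real x)) -(real_normK (num_real y)) -subr_ge0.
  rewrite (_ : _ - _ = c / 2 * (`|x| - `|y|) ^+ 2); last by field.
  by rewrite mulr_ge0 ?sqr_ge0// divr_ge0// ltW.
have lin (z d x y : R) : `|z| <= d * chi -> `|x| <= M ->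
    `|2 * (x * y) * z| <= 2 * M * (`|y| * d) * chi.
  move=> zd xM; rewrite !normrM (ger0_norm (ler0n _ 2)).
  rewrite [leRHS](_ : _ = 2 * (M * `|y|) * (d * chi)); last by ring.
  by rewrite ler_pM// ?mulr_ge0// ler_wpM2l// ler_wpM2r.
have h1 := lin _ _ a B Dk aM; have h2 := lin _ _ b A Dk bM.
have h3 := lin _ _ a q Dk' aM; have h4 := lin _ _ b p Dk' bM.
have h5 := sq2 p B 4 (ltr0n _ 4); have h6 := sq2 q A 4 (ltr0n _ 4).
have h7 := sq2 p Q 2 (ltr0n _ 2); have h8 := sq2 q P 2 (ltr0n _ 2).
rewrite (_ : _ + 2 * (p * (B * D + b * D')) =
  2 * (a * B) * D - 2 * (b * A) * D - 2 * (a * q) * D' + 2 * (b * p) * D'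
  + 4 * (p * B) * D - 4 * (q * A) * D + 2 * (p * Q) * D - 2 * (q * P) * D); last by ring.
have tri (x y c d : R) : `|x| <= c -> `|y| <= d -> `|x + y| <= c + d.
  by move=> xc yd; rewrite (le_trans (ler_normD _ _))// lerD.
have trj (x y c d : R) : `|x| <= c -> `|y| <= d -> `|x - y| <= c + d.
  by move=> xc yd; rewrite (le_trans (ler_normB _ _))// lerD.
apply: (le_trans (trj _ _ _ _ (tri _ _ _ _ (trj _ _ _ _ (tri _ _ _ _ (tri _ _ _ _
  (trj _ _ _ _ (trj _ _ _ _ h1 h2) h3) h4) h5) h6) h7) h8)).
by rewrite le_eqVlt; apply/orP; left; apply/eqP; field.
Qed.

(* On an annulus of radius l the first term integrates to at most a constant
   multiple of e, and the second to a tail of G. *)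
Definition tame {R : realType} {N : nat} (g : 'rV[R]_N -> R) := forall e : R, 0 < e ->
  exists G : 'rV[R]_N -> R, [/\ rintegrable (leb N : {measure set _ -> \bar R}) G, forall x, 0 <= G x &
    forall l x, 1 <= l -> `|g x| / l <= e * l ^- N + G x].

Section flux_decay.
Context {R : realType} {N : nat}.
Local Notation E := 'rV[R]_N.
Local Notation mu := (leb N : {measure set E -> \bar R}).
Local Notation intg := (rintegrable mu).
Implicit Types (f g h k eta : E -> R) (x a : E) (j : 'I_N) (c l : R).

Section by_parts.
Variable rho : nat -> E -> R.
Hypothesis Hrho : mollifier rho.

(** f is only in H^1, so its mollification is inserted in the definition of the weak derivative of
    k, and both sides pass to the limit. *)
Lemma int_by_parts c f (df : 'I_N -> E -> R) j k dk : H1c c f df -> rweak j k dk ->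
  L2 k -> L2 dk -> \int[mu]_x (dk x * f x) = - \int[mu]_x (k x * df j x).
Proof.
move=> Hf wk Lk Ldk; have [Lf Lg sf sg _] := Hf; have [_ _ wkE] := wk.
have c1 := mollify_weak_cvg_sqr Hrho (L2_supp_intg Lf sf) (proj1 Ldk) (proj2 Lf) (proj2 Ldk).
have c2 := mollify_weak_cvg_sqr Hrho (L2_supp_intg (Lg j) (sg j)) (proj1 Lk)
  (proj2 (Lg j)) (proj2 Lk).
rewrite -[LHS]opprK; congr (- _).
apply: (@cvg_unique _ (@Rhausdorff R) ((fun n => \int[mu]_x (convol (df j) (rho n) x * k x)) @ \oo)).
- rewrite (_ : (fun n => _) = fun n => - \int[mu]_x (convol f (rho n) x * dk x)); last first.
    apply/funext => n; have [tp _ pE] := H1c_mollify Hrho n Hf.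
    have := wkE _ tp; rewrite pE => H.
    rewrite (@eq_int _ _ _ mu _ (fun x => k x * convol (df j) (rho n) x)); last first.
      by move=> x; rewrite mulrC.
    by rewrite H; congr (- _); apply: eq_int => x; rewrite mulrC.
  rewrite (@eq_int _ _ _ mu (fun x => dk x * f x) (fun x => f x * dk x)).
    exact: (cvgN c1).
  by move=> x; rewrite mulrC.
- by rewrite (@eq_int _ _ _ mu (fun x => k x * df j x) (fun x => df j x * k x)) // => x; rewrite mulrC.
Qed.

End by_parts.

Definition outside a l : set E := [set x | l <= enorm (x - a)].

Lemma measurable_outside a l : measurable (outside a l).
Proof.
have : measurable (~` [set x : E | enorm (x - a) < l]).
  apply: measurableC; apply: open_measurable_rV.
  have -> : [set x : E | enorm (x - a) < l] = (fun x => enorm (x - a)) @^-1` [set t | t < l] by [].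
  by apply: open_comp (@open_lt R l) => x _; exact: continuous_enorm.
by congr measurable; apply/seteqP; split => x /=; rewrite /outside/= leNgt => /negP.
Qed.

Definition cube_at a c : set E := [set x | forall i, `|a ord0 i - x ord0 i| <= c].

Lemma intg_indic_cube_at a c : intg (\1_(cube_at a c)) .
Proof.
have := intg_refl a (@intg_indic_cube R N c); congr (rintegrable _ _); apply/funext => x.
rewrite !indicE; congr (nat_of_bool _)%:R; apply/idP/idP; rewrite !inE => H i; have := H i.
  by rewrite !mxE.
by rewrite !mxE.
Qed.

Lemma int_indic_cube_at a c : 0 <= c -> \int[mu]_x \1_(cube_at a c) x = (2 * c) ^+ N.
Proof.
move=> c0; have := int_refl a (@intg_indic_cube R N c).
rewrite (_ : \int[mu]_x \1_(cube c) x = (2 * c) ^+ N); last first.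
  have mc : measurable (cube c : set E) by exact: measurable_cube.
  rewrite /Rintegral integral_indic// setIT -[LHS]/(fine (leb N (cube c))).
  by rewrite leb_cube.
move=> <-; apply: eq_int => x; rewrite !indicE; congr (nat_of_bool _)%:R.
by apply/idP/idP; rewrite !inE => H i; have := H i; rewrite !mxE.
Qed.

Lemma tail_small a f (e : R) : intg f -> 0 < e ->
  exists2 L : R, 0 <= L & forall l, L <= l -> \int[mu]_x (`|f x| * \1_(outside a l) x) <= e.
Proof.
move=> If e0; have mf := intg_meas If.
have mI l : meas (fun x => `|f x| * \1_(outside a l) x).
  apply: measurable_funM; first exact: measurableT_comp.
  by apply: measurable_indic; exact: measurable_outside.
have bI l x : `| `|f x| * \1_(outside a l) x| <= `|f x|.
  by rewrite normrM normr_id indicE normr_nat ler_piMr// lern1 leq_b1.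
have pt x : (fun n => `|f x| * \1_(outside a n%:R) x) @ \oo --> (0 : R).
  apply: cvg_near_cst; near=> n; rewrite indicE memNset ?mulr0//=.
  apply/negP; rewrite -ltNge; near: n; exact: nbhs_infty_gtr.
have [_] := @dominated_int _ _ _ mu (fun n x => `|f x| * \1_(outside a n%:R) x) (fun=> 0)
  (fun x => `|f x|) (fun n => mI n%:R) (@measurable_cst _ _ _ _ _ _) (intg_norm If)
  (fun n => bI n%:R) pt.
rewrite int0 => /cvgrPdist_le/(_ _ e0)[n _ /(_ _ (leqnn n))].
rewrite sub0r normrN => H; exists n%:R => // l nl.
apply: le_trans (le_trans (ler_norm _) H).
apply: le_int.
- exact: le_intg (mI l) (bI l) (intg_norm If).
- exact: le_intg (mI n%:R) (bI n%:R) (intg_norm If).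
- move=> x; rewrite ler_wpM2l// !indicE ler_nat; case: (boolP (x \in outside a l)) => //.
  rewrite inE => lx; rewrite mem_set//; exact: le_trans nl lx.
Unshelve. all: by end_near. Qed.

(** * Flux through a single annulus *)

Section flux_estimate.
Variables (K : R) (chi : R -> R) (a : E) (l : R).
Hypotheses (hchi : cutoff K chi) (l1 : 1 <= l) (N4 : (N <= 4)%N).
Variable rho : nat -> E -> R.
Hypothesis Hrho : mollifier rho.
Variables (M : R) (a0 b0 : E -> R) (A B : 'I_N -> E -> R).
Hypotheses (Ma : bounded_by M a0) (Mb : bounded_by M b0) (ma : meas a0) (mb : meas b0).
Hypotheses (LA : forall j, L2 (A j)) (LB : forall j, L2 (B j)).
Hypotheses (wA : forall j, rweak j a0 (A j)) (wB : forall j, rweak j b0 (B j)).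
Variables (p q : E -> R) (P Q : 'I_N -> E -> R).
Hypotheses (Lp : L2 p) (Lq : L2 q) (LP : forall j, L2 (P j)) (LQ : forall j, L2 (Q j)).
Hypotheses (wP : forall j, rweak j p (P j)) (wQ : forall j, rweak j q (Q j)).
Variables (e : R) (G : 'I_N -> E -> R).
Hypotheses (e0 : 0 < e) (IG : forall j, intg (G j)) (G0 : forall j x, 0 <= G j x).
Hypothesis AG : forall j x, (`|A j x| + `|B j x|) / l <= e * l ^- N + G j x.

Let eta x := chi (enorm (x - a) / l).

Let l0 : 0 < l. Proof. exact: lt_le_trans l1. Qed.

Let te : rtest eta. Proof. exact: radial_cutoff_rtest hchi l0. Qed.

Let X j x := 2 * (a0 x * B j x - b0 x * A j x) * partial j eta x
  + 2 * (p x * B j x - q x * A j x) * partial j eta x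
  + 2 * (p x * Q j x - q x * P j x) * partial j eta x.

(** The flux density once the products of phi with Dw have been integrated by parts: Dw remains only
    in the quadratic terms of [X]. *)
Let Y j x := X j x
  - 2 * (q x * (A j x * partial j eta x + a0 x * partial j (partial j eta) x))
  + 2 * (p x * (B j x * partial j eta x + b0 x * partial j (partial j eta) x)).

Let La : L2loc a0 := bounded_L2loc ma Ma.
Let Lb : L2loc b0 := bounded_L2loc mb Mb.

Let Lmul f j : L2loc f -> L2 (fun x => f x * partial j eta x).
Proof. by move=> Lf; apply: L2loc_mul_rtest Lf _; exact: rtest_partial. Qed.

Let Imul f h j : L2loc f -> L2 h -> intg (fun x => f x * h x * partial j eta x).
Proof.
move=> Lf Lh; have := intgM_L2 (Lmul j Lf) Lh.
by congr (rintegrable _ _); apply/funext => x; ring.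
Qed.

Let IX j : intg (X j).
Proof.
have H f g h k : L2loc f -> L2loc g -> L2 h -> L2 k ->
    intg (fun x => 2 * (f x * h x - g x * k x) * partial j eta x).
  move=> Lf Lg Lh Lk; have := intgZ 2 (intgB (Imul j Lf Lh) (Imul j Lg Lk)).
  by congr (rintegrable _ _); apply/funext => x; ring.
have Lp' := L2_L2loc Lp; have Lq' := L2_L2loc Lq.
exact: intgD (intgD (H _ _ _ _ La Lb (LB j) (LA j)) (H _ _ _ _ Lp' Lq' (LB j) (LA j)))
  (H _ _ _ _ Lp' Lq' (LQ j) (LP j)).
Qed.

Let Lgrad f f' j : L2loc f -> L2 f' ->
  L2 (fun x => f' x * partial j eta x + f x * partial j (partial j eta) x).
Proof.
move=> Lf Lf'; apply: (L2D (Lmul j (L2_L2loc Lf'))).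
by apply: L2loc_mul_rtest Lf _; do 2 apply: rtest_partial.
Qed.

Let IY j : intg (Y j).
Proof.
exact: intgD (intgB (IX j) (intgZ 2 (intgM_L2 Lq (Lgrad j La (LA j)))))
  (intgZ 2 (intgM_L2 Lp (Lgrad j Lb (LB j)))).
Qed.

Let fluxE : flux eta (fun x => a0 x + p x) (fun x => b0 x + q x)
    (fun j x => A j x + P j x) (fun j x => B j x + Q j x) = \sum_(j < N) \int[mu]_x Y j x.
Proof.
have [se [c sc]] := te.
have parts f (df : 'I_N -> E -> R) k k' j : L2loc f -> (forall i, L2 (df i)) -> (forall i, rweak i f (df i)) ->
    L2 k -> L2 k' -> rweak j k k' ->
    \int[mu]_x (k' x * (f x * partial j eta x)) =
    - \int[mu]_x (k x * (df j x * partial j eta x + f x * partial j (partial j eta) x)).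
  move=> Lf Lf' wf Lk Lk' wk.
  have H := H1c_mul Lf (fun i => L2_L2loc (Lf' i)) wf (rtest_partial j te) (partial_supp j sc).
  exact: (int_by_parts Hrho H wk Lk Lk').
rewrite /flux; transitivity (\sum_(j < N) \int[mu]_x (X j x +
    (2 * (Q j x * (a0 x * partial j eta x)) - 2 * (P j x * (b0 x * partial j eta x))))).
  rewrite -int_sum; last first.
    move=> j; exact: intgD (IX j) (intgB (intgZ 2 (intgM_L2 (LQ j) (Lmul j La)))
      (intgZ 2 (intgM_L2 (LP j) (Lmul j Lb)))).
  by apply: eq_int => x; apply: eq_bigr => j _; rewrite /X; ring.
apply: eq_bigr => j _.
have I1 := intgZ 2 (intgM_L2 (LQ j) (Lmul j La)).
have I2 := intgZ 2 (intgM_L2 (LP j) (Lmul j Lb)).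
have J1 := intgM_L2 Lq (Lgrad j La (LA j)); have J2 := intgM_L2 Lp (Lgrad j Lb (LB j)).
rewrite (intD (IX j) (intgB I1 I2)) (intB I1 I2).
rewrite (intZ 2 (intgM_L2 (LQ j) (Lmul j La))) (intZ 2 (intgM_L2 (LP j) (Lmul j Lb))).
rewrite (parts _ _ _ _ _ La LA wA Lq (LQ j) (wQ j)) (parts _ _ _ _ _ Lb LB wB Lp (LP j) (wP j)).
rewrite /Y (intD (intgB (IX j) (intgZ 2 J1)) (intgZ 2 J2)) (intB (IX j) (intgZ 2 J1)).
by rewrite (intZ 2 J1) (intZ 2 J2); ring.
Qed.

(** This equals 1 on the annulus carrying the derivatives of eta; the outer ball is enlarged to a
    cube, whose volume is explicit. *)
Let ch x := \1_(outside a l) x * \1_(cube_at a (2 * l)) x : R.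

Let K0 : 0 <= K.
Proof. by have [_ _ _ /(_ 0) H _] := hchi; exact: le_trans H. Qed.

Let ch01 x : 0 <= ch x <= 1.
Proof. by rewrite /ch !indicE; do 2 case: (_ \in _); rewrite ?mulr1 ?mulr0 ?ler01 ?lexx. Qed.

Let ch1 x : ~ (enorm (x - a) < l \/ 2 * l < enorm (x - a)) -> ch x = 1.
Proof.
move=> /not_orP[/negP h1 /negP h2]; rewrite -leNgt in h1; rewrite -leNgt in h2.
rewrite /ch !indicE !mem_set ?mulr1//.
by move=> i; rewrite distrC (le_trans _ h2)//; have := coord_le_enorm (x - a) i; rewrite !mxE.
Qed.

Let D1 j x : `|partial j eta x| <= (K / l) * ch x.
Proof.
have [H|H] := pselect (enorm (x - a) < l \/ 2 * l < enorm (x - a)).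
  have [-> _] := radial_cutoff_flat hchi l0 j H.
  have /andP[c0 _] := ch01 x; by rewrite normr0 mulr_ge0// divr_ge0// ltW.
by rewrite (ch1 H) mulr1; exact: radial_cutoff_partial.
Qed.

Let D2 j x : `|partial j (partial j eta) x| <= 3 * (K / l ^+ 2) * ch x.
Proof.
have [H|H] := pselect (enorm (x - a) < l \/ 2 * l < enorm (x - a)).
  have [_ ->] := radial_cutoff_flat hchi l0 j H.
  have /andP[c0 _] := ch01 x; by rewrite normr0 !mulr_ge0// invr_ge0 exprn_ge0// ltW.
by rewrite (ch1 H) mulr1; exact: radial_cutoff_partial2.
Qed.

Let s j x := 3 * (p x ^+ 2 + q x ^+ 2) + 2 * (A j x ^+ 2 + B j x ^+ 2) + (P j x ^+ 2 + Q j x ^+ 2).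

(** Young's inequality produces (l^-2)^2 = l^-4, and l^-4 <= l^-N because N <= 4 and l >= 1. *)
Let small_sqr y : `|y| / l ^+ 2 <= e * l ^- N + e^-1 * y ^+ 2.
Proof.
have := young2 (l ^- 2) `|y| e0.
have -> : `|l ^- 2 * `|y| | = `|y| / l ^+ 2.
  by rewrite normrM normr_id ger0_norm ?(mulrC (l ^- 2))// invr_ge0 exprn_ge0// ltW.
rewrite real_normK ?num_real// => H; apply: (le_trans H).
rewrite lerD2r ler_wpM2l ?(ltW e0)//.
rewrite exprVn -exprM/= lef_pV2 ?posrE ?exprn_gt0//.
exact: ler_weXn2l.
Qed.

(** The factor 2 goes with D phi and 6 = 2 times 3 with w, the 3 being that of the second derivative
    of the cutoff. As w has two components, e l^-N appears 2 + 6 + 6 = 14 times. *)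
Let Ybound j x := K / l * s j x + (M * K) * ((14 * e * l ^- N) * \1_(cube_at a (2 * l)) x +
  (2 * (`|G j x| * \1_(outside a l) x) + 6 * e^-1 * (`|p x ^+ 2 + q x ^+ 2| * \1_(outside a l) x))).

Let Y_le j x : `|Y j x| <= Ybound j x.
Proof.
have M0 : 0 <= M by exact: le_trans (Ma x).
have k0 : 0 <= K / l by rewrite divr_ge0// ltW.
apply: (le_trans (flux_density_le (A j x) (B j x) (p x) (q x) (P j x) (Q j x)
  (Ma x) (Mb x) (D1 j x) (D2 j x) k0 (ch01 x))).
rewrite /Ybound /s -addrA lerD2l.
have h1 := AG j x.
have h2 := lerD (small_sqr (p x)) (small_sqr (q x)).
set t := `|p x ^+ 2 + q x ^+ 2|.
have tE : t = p x ^+ 2 + q x ^+ 2 by rewrite /t ger0_norm// addr_ge0 ?sqr_ge0.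
have t0 : 0 <= t by exact: normr_ge0.
have MK0 : 0 <= M * K by rewrite mulr_ge0.
have G1 : `|G j x| = G j x by rewrite ger0_norm.
have /andP[c0 c1] := ch01 x.
apply: (@le_trans _ _ ((M * K) * ((14 * e * l ^- N + (2 * `|G j x| + 6 * e^-1 * t)) * ch x))).
  rewrite [leLHS](_ : _ = (2 * (M * K) * ((`|A j x| + `|B j x|) / l) +
     6 * (M * K) * (`|p x| / l ^+ 2 + `|q x| / l ^+ 2)) * ch x).
    2: by rewrite -[K / l ^+ 2]/(K * l ^- 2); ring.
  rewrite [leRHS]mulrA ler_wpM2r//.
  apply: (le_trans (lerD (ler_wpM2l _ h1) (ler_wpM2l _ h2))); try by rewrite mulr_ge0.
  rewrite G1 tE le_eqVlt; apply/orP; left; apply/eqP.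
  by field; rewrite !gt_eqF// exprn_gt0.
rewrite ler_wpM2l// /ch !indicE.
have X0 : 0 <= 14 * e * l ^- N by rewrite !mulr_ge0 ?(ltW e0)// invr_ge0 exprn_ge0// ltW.
have X1 : 0 <= 2 * `|G j x| by rewrite mulr_ge0.
have X2 : 0 <= 6 * e^-1 * t by rewrite !mulr_ge0// invr_ge0 ltW.
do 2 case: (_ \in _); rewrite ?mulr1 ?mulr0 ?mul0r ?mulr1 ?addr0 ?add0r// ?mulrA.
exact: addr_ge0.
Qed.

(** The cube has volume (4 l)^N, so the weight l^-N leaves 14 e 4^N; the quadratic terms keep their
    factor 1 / l, and everything else is a tail. *)
Lemma flux_le : `|flux eta (fun x => a0 x + p x) (fun x => b0 x + q x)
    (fun j x => A j x + P j x) (fun j x => B j x + Q j x)| <=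
  \sum_(j < N) (K / l * \int[mu]_x s j x + (M * K) * (14 * e * 4 ^+ N +
    (2 * \int[mu]_x (`|G j x| * \1_(outside a l) x) +
     6 * e^-1 * \int[mu]_x (`|p x ^+ 2 + q x ^+ 2| * \1_(outside a l) x)))).
Proof.
rewrite fluxE (le_trans (ler_norm_sum _ _ _))//; apply: ler_sum => j _.
have It f : intg f -> intg (fun x => `|f x| * \1_(outside a l) x).
  move=> If; apply: (@le_intg _ _ _ mu _ (fun x => `|f x|)).
  - apply: measurable_funM; first exact: measurableT_comp (intg_meas If).
    by apply: measurable_indic; exact: measurable_outside.
  - by move=> x; rewrite normrM normr_id indicE normr_nat ler_piMr// lern1 leq_b1.
  - exact: intg_norm.
have [_ Ip] := Lp; have [_ Iq] := Lq; have [_ IA] := LA j; have [_ IB] := LB j.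
have [_ IP] := LP j; have [_ IQ] := LQ j.
have Ipq := intgD Ip Iq.
have Is : intg (s j).
  exact: intgD (intgD (intgZ 3 Ipq) (intgZ 2 (intgD IA IB))) (intgD IP IQ).
have I1 := intgZ (14 * e * l ^- N) (@intg_indic_cube_at a (2 * l)).
have I2 := intgZ 2 (It _ (IG j)); have I3 := intgZ (6 * e^-1) (It _ Ipq).
have I4 := intgZ (M * K) (intgD I1 (intgD I2 I3)).
apply: (le_trans (norm_int_le (IY j) (intgD (intgZ (K / l) Is) I4) (Y_le j))).
rewrite (intD (intgZ (K / l) Is) I4) (intZ _ Is) (intZ _ (intgD I1 (intgD I2 I3))).
rewrite (intD I1 (intgD I2 I3)) (intD I2 I3) (intZ _ (@intg_indic_cube_at a (2 * l))).
rewrite (intZ _ (It _ (IG j))) (intZ _ (It _ Ipq)) int_indic_cube_at ?mulr_ge0 ?(ltW l0)//.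
rewrite (_ : 14 * e * l ^- N * (2 * (2 * l)) ^+ N = 14 * e * 4 ^+ N)//.
rewrite mulrA -natrM exprMn; field.
by rewrite gt_eqF ?exprn_gt0.
Qed.

End flux_estimate.

Lemma small_factor (C e : R) : 0 <= C -> 0 < e -> exists2 d, 0 < d & C * d <= e.
Proof.
move=> C0 e0; have C1 : 0 < C + 1 by rewrite ltr_wpDl.
exists (e / (C + 1)); first exact: divr_gt0.
by rewrite mulrA ler_pdivrMr// mulrC ler_wpM2l ?(ltW e0)// lerDl.
Qed.

Lemma sqr_shift_le (y z : R) : y ^+ 2 <= 2 * z ^+ 2 + 2 * (y - z) ^+ 2.
Proof. by have := sqrD_le z (y - z); rewrite addrC subrK mulrDr. Qed.

Lemma L2_shift_le f h : L2 f -> L2 h ->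
  \int[mu]_x (f x ^+ 2) <= 2 * \int[mu]_x (h x ^+ 2) + 2 * \int[mu]_x ((f x - h x) ^+ 2).
Proof.
move=> Lf Lh; have [_ I1] := L2B Lf Lh; have [_ I2] := Lh; have [_ I3] := Lf.
rewrite -(intZ 2 I1) -(intZ 2 I2) -(intD (intgZ 2 I2) (intgZ 2 I1)).
apply: (le_int I3 (intgD (intgZ 2 I2) (intgZ 2 I1))) => x; exact: sqr_shift_le.
Qed.

Lemma sqH1_ge_fun f (g : 'I_N -> E -> R) : \int[mu]_x (f x ^+ 2) <= sqH1 f g.
Proof.
by rewrite /sqH1 lerDl; apply: sumr_ge0 => j _; apply: int_ge0 => x; exact: sqr_ge0.
Qed.

Lemma sqH1_ge_grad f (g : 'I_N -> E -> R) j : \int[mu]_x (g j x ^+ 2) <= sqH1 f g.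
Proof.
rewrite /sqH1 (bigD1 j)//= addrCA lerDl addr_ge0//.
  by apply: int_ge0 => x; exact: sqr_ge0.
by apply: sumr_ge0 => i _; apply: int_ge0 => x; exact: sqr_ge0.
Qed.

Lemma intg_outside a l f : intg f -> intg (fun x => `|f x| * \1_(outside a l) x).
Proof.
move=> If; apply: (@le_intg _ _ _ mu _ (fun x => `|f x|)).
- apply: measurable_funM; first exact: measurableT_comp (intg_meas If).
  by apply: measurable_indic; exact: measurable_outside.
- by move=> x; rewrite normrM normr_id indicE normr_nat ler_piMr// lern1 leq_b1.
- exact: intg_norm.
Qed.

Lemma sum_const_const (c t : R) (g : 'I_N -> R) :
  \sum_(j < N) (c + (g j + t)) = N%:R * c + (\sum_(j < N) g j + N%:R * t).
Proof. by rewrite !big_split/= !sumr_const card_ord !mulr_natl. Qed.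

Section flux_uniform.
Variables (K : R) (chi : R -> R) (a : E).
Hypotheses (hchi : cutoff K chi) (N4 : (N <= 4)%N).
Variable rho : nat -> E -> R.
Hypothesis Hrho : mollifier rho.
Variables (M : R) (a0 b0 : E -> R) (A B : 'I_N -> E -> R).
Hypotheses (Ma : bounded_by M a0) (Mb : bounded_by M b0) (ma : meas a0) (mb : meas b0).
Hypotheses (LA : forall j, L2 (A j)) (LB : forall j, L2 (B j)).
Hypotheses (wA : forall j, rweak j a0 (A j)) (wB : forall j, rweak j b0 (B j)).
Hypotheses (tA : forall j, tame (A j)) (tB : forall j, tame (B j)).
Variables (p q : E -> R) (P Q : 'I_N -> E -> R).
Hypotheses (Lp : L2 p) (Lq : L2 q) (LP : forall j, L2 (P j)) (LQ : forall j, L2 (Q j)).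

(** Passing from (p, q) to a nearby (p', q') at most doubles the tail of the squares and adds a
    multiple of the H^1 distance, so constants chosen for (p, q) serve a whole H^1 ball. Four
    contributions get e0 / 4 each: the volume term, the tails, the distance and the 1 / l term. *)
Lemma flux_uniform (e0 : R) : 0 < e0 -> exists d L : R, [/\ 0 < d, 1 <= L &
  forall l, L <= l -> forall (p' q' : E -> R) (P' Q' : 'I_N -> E -> R),
  L2 p' -> L2 q' -> (forall j, L2 (P' j)) -> (forall j, L2 (Q' j)) ->
  (forall j, rweak j p' (P' j)) -> (forall j, rweak j q' (Q' j)) ->
  sqH1 (fun x => p' x - p x) (fun j x => P' j x - P j x) <= d ->
  sqH1 (fun x => q' x - q x) (fun j x => Q' j x - Q j x) <= d ->
  `|flux (fun x => chi (enorm (x - a) / l)) (fun x => a0 x + p' x) (fun x => b0 x + q' x)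
     (fun j x => A j x + P' j x) (fun j x => B j x + Q' j x)| <= e0].
Proof.
move=> e0p.
have K0 : 0 <= K by have [_ _ _ /(_ 0) H _] := hchi; exact: le_trans H.
have M0 : 0 <= M by exact: le_trans (Ma 0).
have C0 : 0 <= M * K by rewrite mulr_ge0.
have e4 : 0 < e0 / 4 by rewrite divr_gt0.
(* e comes first: the functions G supplied by tameness depend on it. *)
have [e ep He] : exists2 e, 0 < e & (M * K * (N%:R * 14 * 4 ^+ N)) * e <= e0 / 4.
  by apply: small_factor => //; rewrite !mulr_ge0.
have e2p : 0 < e / 2 by rewrite divr_gt0.
have [GA HA] := choice (fun j => tA j e2p); have [GB HB] := choice (fun j => tB j e2p).
pose G j x := GA j x + GB j x.
have IG j : intg (G j) by have [h _ _] := HA j; have [h' _ _] := HB j; exact: intgD.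
have G0 j x : 0 <= G j x.
  by have [_ h _] := HA j; have [_ h' _] := HB j; exact: addr_ge0.
have AG l (l1 : 1 <= l) j x : (`|A j x| + `|B j x|) / l <= e * l ^- N + G j x.
  have [_ _ h] := HA j; have [_ _ h'] := HB j.
  have := lerD (h _ x l1) (h' _ x l1); rewrite -mulrDl => H; apply: (le_trans H).
  by rewrite addrACA -mulrDl -splitr.
have [dd ddp Hdd] : exists2 d, 0 < d & (M * K * (6 * e^-1 * 4 * N%:R)) * d <= e0 / 4.
  by apply: small_factor => //; rewrite !mulr_ge0// invr_ge0 ltW.
have [ep' ep'p Hep'] : exists2 d, 0 < d & (M * K) * d <= e0 / 4 by exact: small_factor.
have [_ Ip] := Lp; have [_ Iq] := Lq; have Ipq := intgD Ip Iq.
(* All tails are gathered into one integrable function, so that a single radius controls them. *)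
pose F x := \sum_(j < N) 2 * G j x + (6 * e^-1 * 2 * N%:R) * (p x ^+ 2 + q x ^+ 2).
have IF : intg F.
  by apply: intgD (intgZ _ Ipq); apply: intg_sum => j; exact: intgZ.
have [L1 L10 HL1] := tail_small a IF ep'p.
pose S := \sum_(j < N) (3 * (2 * sqH1 p P + 2 + (2 * sqH1 q Q + 2)) +
  2 * (\int[mu]_x (A j x ^+ 2) + \int[mu]_x (B j x ^+ 2)) +
  (2 * sqH1 p P + 2 + (2 * sqH1 q Q + 2))).
have KS : 0 <= K * `|S| by rewrite mulr_ge0.
have [dl dl0 Hdl] := small_factor KS e4.
(* Distance at most 1 bounds the norms of (p', q') in terms of those of (p, q), as recorded in
   [S]. *)
exists (Num.min dd 1), (Num.max 1 (Num.max L1 dl^-1)); split.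
- by rewrite lt_min ddp ltr01.
- by rewrite le_max lexx.
move=> l; rewrite !ge_max => /and3P[l1 lL1 lL2] p' q' P' Q' Lp' Lq' LP' LQ' wP wQ.
rewrite !le_min => /andP[pd pd1] /andP[qd qd1].
have l0 : 0 < l by exact: lt_le_trans l1.
apply: (le_trans (flux_le a hchi l1 N4 Hrho Ma Mb ma mb LA LB wA wB Lp' Lq' LP' LQ' wP wQ
  ep IG G0 (AG l l1))).
have [_ Ip'] := Lp'; have [_ Iq'] := Lq'; have Ipq' := intgD Ip' Iq'.
have nrm f f' (d' d : R) (g g' : 'I_N -> E -> R) : L2 f -> L2 f' -> \int[mu]_x (f x ^+ 2) <= d' ->
    \int[mu]_x ((f' x - f x) ^+ 2) <= d -> d <= 1 -> \int[mu]_x (f' x ^+ 2) <= 2 * d' + 2.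
  move=> Lf Lf' fd ffd d1; apply: (le_trans (L2_shift_le Lf' Lf)).
  by rewrite lerD ?ler_wpM2l// -[leRHS]mulr1 ler_wpM2l// (le_trans ffd).
have s_le j : \int[mu]_x (3 * (p' x ^+ 2 + q' x ^+ 2) + 2 * (A j x ^+ 2 + B j x ^+ 2) +
    (P' j x ^+ 2 + Q' j x ^+ 2)) <=
  3 * (2 * sqH1 p P + 2 + (2 * sqH1 q Q + 2)) +
  2 * (\int[mu]_x (A j x ^+ 2) + \int[mu]_x (B j x ^+ 2)) +
  (2 * sqH1 p P + 2 + (2 * sqH1 q Q + 2)).
  have [_ IA] := LA j; have [_ IB] := LB j; have [_ IP] := LP' j; have [_ IQ] := LQ' j.
  rewrite (intD (intgD (intgZ 3 Ipq') (intgZ 2 (intgD IA IB))) (intgD IP IQ)).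
  rewrite (intD (intgZ 3 Ipq') (intgZ 2 (intgD IA IB))) (intZ 3 Ipq') (intZ 2 (intgD IA IB)).
  rewrite (intD Ip' Iq') (intD IA IB) (intD IP IQ) lerD//.
    rewrite lerD2r ler_wpM2l// lerD//.
      exact: (nrm p p' _ _ P P Lp Lp' (sqH1_ge_fun p P) (sqH1_ge_fun _ _) pd1).
    exact: (nrm q q' _ _ Q Q Lq Lq' (sqH1_ge_fun q Q) (sqH1_ge_fun _ _) qd1).
  rewrite lerD//.
    exact: (nrm _ _ _ _ P P (LP j) (LP' j) (sqH1_ge_grad p P j) (sqH1_ge_grad _ _ j) pd1).
  exact: (nrm _ _ _ _ Q Q (LQ j) (LQ' j) (sqH1_ge_grad q Q j) (sqH1_ge_grad _ _ j) qd1).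
rewrite big_split/= -mulr_sumr -mulr_sumr.
pose I1 := \int[mu]_x (`|p x ^+ 2 + q x ^+ 2| * \1_(outside a l) x).
have IO1 := intg_outside a l Ipq.
have tpq : \int[mu]_x (`|p' x ^+ 2 + q' x ^+ 2| * \1_(outside a l) x) <= 2 * I1 + 4 * dd.
  have [_ J1] := L2B Lp' Lp; have [_ J2] := L2B Lq' Lq; have J := intgZ 2 (intgD J1 J2).
  apply: (@le_trans _ _ (2 * I1 + \int[mu]_x (2 * ((p' x - p x) ^+ 2 + (q' x - q x) ^+ 2)))).
    rewrite -(intZ 2 IO1) -(intD (intgZ 2 IO1) J).
    apply: (le_int (intg_outside a l Ipq') (intgD (intgZ 2 IO1) J)) => x.
    rewrite !ger0_norm ?addr_ge0 ?sqr_ge0// indicE; case: (_ \in _); rewrite ?mulr1 ?mulr0.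
      by rewrite !mulrDr addrACA lerD// sqr_shift_le.
    by rewrite add0r mulr_ge0// addr_ge0 ?sqr_ge0.
  rewrite lerD2l (intZ 2 (intgD J1 J2)) (intD J1 J2).
  have := lerD (le_trans (sqH1_ge_fun (fun x => p' x - p x) _) pd)
               (le_trans (sqH1_ge_fun (fun x => q' x - q x) _) qd).
  by move=> H; rewrite (_ : 4 * dd = 2 * (dd + dd)) ?ler_wpM2l//; ring.
have tF : \sum_(j < N) 2 * \int[mu]_x (`|G j x| * \1_(outside a l) x) +
    (6 * e^-1 * 2 * N%:R) * I1 = \int[mu]_x (`|F x| * \1_(outside a l) x).
  rewrite -(intZ _ IO1).
  under eq_bigr do rewrite -(intZ 2 (intg_outside a l (IG _))).
  rewrite -int_sum => [|j]; last exact: intgZ (intg_outside a l (IG j)).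
  rewrite -intD; [|by apply: intg_sum => j; exact: intgZ (intg_outside a l (IG j))|exact: intgZ IO1].
  apply: eq_int => x; have pq0 : 0 <= p x ^+ 2 + q x ^+ 2 by rewrite addr_ge0 ?sqr_ge0.
  have F0 : 0 <= F x.
    rewrite addr_ge0//; first by apply: sumr_ge0 => j _; rewrite mulr_ge0.
    by rewrite !mulr_ge0 ?invr_ge0 ?(ltW ep).
  rewrite (ger0_norm F0) (ger0_norm pq0) /F [RHS]mulrDl mulr_suml mulrA; congr (_ + _).
  by apply: eq_bigr => j _; rewrite ger0_norm// mulrA.
have b1 : K / l * \sum_(j < N) \int[mu]_x (3 * (p' x ^+ 2 + q' x ^+ 2) +
    2 * (A j x ^+ 2 + B j x ^+ 2) + (P' j x ^+ 2 + Q' j x ^+ 2)) <= e0 / 4.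
  apply: (@le_trans _ _ (K / l * `|S|)).
    rewrite ler_wpM2l ?divr_ge0// ?(ltW l0)//; apply: le_trans (ler_norm S).
    by apply: ler_sum => j _; exact: s_le.
  rewrite mulrAC (le_trans _ Hdl)// ler_wpM2l// -[dl]invrK lef_pV2 ?posrE ?invr_gt0//.
rewrite (_ : e0 = e0 / 4 + (e0 / 4 + (e0 / 4 + e0 / 4))); last by field.
apply: lerD b1 _.
have b2 : M * K * (N%:R * (14 * e * 4 ^+ N)) <= e0 / 4.
  by apply: le_trans He; rewrite le_eqVlt; apply/orP; left; apply/eqP; ring.
have b3 : M * K * (\sum_(j < N) 2 * \int[mu]_x (`|G j x| * \1_(outside a l) x) +
    (6 * e^-1 * 2 * N%:R) * I1) <= e0 / 4.
  by apply: le_trans Hep'; rewrite tF ler_wpM2l// HL1.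
rewrite sum_const_const mulrDr [in X in _ + X]mulrDr.
apply: (lerD b2); apply: le_trans (lerD b3 Hdd).
rewrite [in leRHS]mulrDr -[leRHS]addrA lerD2l -[X in _ <= _ + X]mulrA -mulrDr ler_wpM2l//.
apply: (@le_trans _ _ (N%:R * (6 * e^-1 * (2 * I1 + 4 * dd)))).
  by rewrite ler_wpM2l// ler_wpM2l// mulr_ge0// invr_ge0 ltW.
by rewrite le_eqVlt; apply/orP; left; apply/eqP; ring.
Qed.

End flux_uniform.


End flux_decay.

(** * The potential is real *)

Section scaling.
Context {R : realType} {N : nat}.
Local Notation E := 'rV[R]_N.
Local Notation e_ j := (delta_mx ord0 j : E).
Implicit Types (f g h : E -> R) (j : 'I_N) (x : E).
Local Opaque smooth.

Lemma is_derive_scale (c : R) f x (v : E) (d : R) : is_derive (c *: x) v f d ->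
  is_derive x v (fun y => f (c *: y)) (c * d).
Proof.
move=> df; have sx : x = 0 *: v + x by rewrite scale0r add0r.
rewrite sx; apply/is_derive_slice.
have {}df : is_derive (c * 0) (1 : R) (fun t : R => f (t *: v + c *: x)) d.
  by apply/is_derive_slice; rewrite mulr0 scale0r add0r.
rewrite (_ : (fun t : R => _) = (fun t : R => f (t *: v + c *: x)) \o (fun t => c * t)).
  have dc : is_derive (0 : R) (1 : R) (fun t : R => c * t) c.
    have := is_deriveZ c (@is_derive_id R R^o (0 : R) (1 : R)).
    by move/is_derive_eq; apply; rewrite /GRing.scale/= mulr1.
  have := is_derive1_comp df dc.
  by move/is_derive_eq; apply; rewrite mulrC.
by apply/funext => t /=; rewrite scalerDr scalerA.
Qed.

Lemma continuous_scale (c : R) : continuous (fun x : E => c *: x).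
Proof. exact: scaler_continuous. Qed.

Lemma partial_scale j f (c : R) : smooth f ->
  partial j (fun x => f (c *: x)) = fun x => c * partial j f (c *: x).
Proof.
move=> sf; apply: is_derive_partial => x.
exact: (is_derive_scale (smooth_is_derive (c *: x) j sf)).
Qed.

Lemma smooth_scale f (c : R) : smooth f -> smooth (fun x => f (c *: x)).
Proof.
move=> sf.
apply: (@smooth_coind _ _ (fun h => exists f, smooth f /\ h = fun x => f (c *: x)));
  last by exists f.
move=> _ [{}f [{}sf ->]]; split.
  move=> x; apply: (@continuous_comp _ _ _ (fun y : E => c *: y) f).
    exact: continuous_scale.
  exact: (smooth_continuous sf).
move=> j; split.
  by move=> x; have [] := is_derive_scale (smooth_is_derive (c *: x) j sf).
exists (fun x => c * partial j f x); split; last exact: partial_scale.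
exact/smoothZ/smooth_partial.
Qed.

Lemma partials_scale (js : seq 'I_N) f (c : R) : smooth f ->
  partials js (fun x => f (c *: x)) = fun x => c ^+ size js * partials js f (c *: x).
Proof.
move=> sf; elim: js => [|j js IH]; first by apply/funext => x; rewrite mul1r.
have sp := smooth_partials js sf.
rewrite /= IH partialZ; last exact: smooth_scale.
by rewrite partial_scale//; apply/funext => x; rewrite exprSr mulrA.
Qed.

Lemma partialsD (js : seq 'I_N) f g : smooth f -> smooth g ->
  partials js (fun x => f x + g x) = fun x => partials js f x + partials js g x.
Proof.
move=> sf sg; elim: js => [//|j js IH] /=.
by rewrite IH (partialD j (smooth_partials js sf) (smooth_partials js sg)).
Qed.

Lemma partialsZ (js : seq 'I_N) f (c : R) : smooth f ->
  partials js (fun x => c * f x) = fun x => c * partials js f x.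
Proof.
move=> sf; elim: js => [//|j js IH] /=.
by rewrite IH (partialZ j c (smooth_partials js sf)).
Qed.

Lemma partials_zero (js : seq 'I_N) f (U : set E) : open U -> (forall x, U x -> f x = 0) ->
  forall x, U x -> partials js f x = 0.
Proof.
move=> oU f0; elim: js => [//|j js IH] x Ux /=.
have H : is_derive x (e_ j) (partials js f) 0.
  apply: (@near_eq_is_derive R E R (fun=> 0) _ x _ 0 _ (@is_derive_cst R E R 0 x (e_ j))).
  by apply: filterS (open_nbhs_nbhs (conj oU Ux)) => y Uy; rewrite (IH _ Uy).
by have [_] := H.
Qed.

(** Peeling off the innermost derivative, the product rule gives two products with one derivative
    fewer, whence a factor 2 per order. All bounds are taken at one point, so that weights depending
    on x can be carried through. *)
Lemma leibniz_le n g h x (A B : R) : smooth g -> smooth h ->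
  (forall js : seq 'I_N, (size js <= n)%N -> `|partials js g x| <= A) ->
  (forall js : seq 'I_N, (size js <= n)%N -> `|partials js h x| <= B) ->
  forall js : seq 'I_N, (size js <= n)%N ->
    `|partials js (fun y => g y * h y) x| <= 2 ^+ n * (A * B).
Proof.
elim: n g h => [|n IH] g h sg sh gA hB js.
  by rewrite leqn0 => /nilP ->; rewrite mul1r normrM ler_pM//; [exact: (gA [::])|exact: (hB [::])].
have A0 : 0 <= A by exact: le_trans (gA [::] _).
have B0 : 0 <= B by exact: le_trans (hB [::] _).
case/lastP: js => [_|js j].
  rewrite /= normrM; apply: (@le_trans _ _ (1 * (A * B))).
    by rewrite mul1r ler_pM//; [exact: (gA [::])|exact: (hB [::])].
  by rewrite ler_wpM2r ?mulr_ge0// exprn_ege1// ler1n.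
rewrite size_rcons ltnS => jn.
rewrite partials_rcons partialM// partialsD; first last.
- exact: smoothM (sg) (smooth_partial j sh).
- exact: smoothM (smooth_partial j sg) sh.
have gA' ks : (size ks <= n)%N -> `|partials ks g x| <= A by move=> kn; exact/gA/leqW.
have hB' ks : (size ks <= n)%N -> `|partials ks h x| <= B by move=> kn; exact/hB/leqW.
have gA1 ks : (size ks <= n)%N -> `|partials ks (partial j g) x| <= A.
  by move=> kn; rewrite -partials_rcons; apply: gA; rewrite size_rcons.
have hB1 ks : (size ks <= n)%N -> `|partials ks (partial j h) x| <= B.
  by move=> kn; rewrite -partials_rcons; apply: hB; rewrite size_rcons.
have H1 := IH _ _ (smooth_partial j sg) sh gA1 hB' _ jn.
have H2 := IH _ _ sg (smooth_partial j sh) gA' hB1 _ jn.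
by rewrite exprS mulr_natl mulrnAl mulr2n (le_trans (ler_normD _ _))// lerD.
Qed.

End scaling.

(** * Real and imaginary parts, and L^2 norms of complex functions *)

Section complex_L2.
Context {R : realType} {N : nat}.
Local Notation E := 'rV[R]_N.
Local Notation C := R[i].
Local Notation mu := (leb N : {measure set E -> \bar R}).
Local Notation intg := (rintegrable mu).
Local Notation normc := (@Normc.normc R).
Implicit Types (f g : E -> C) (x : E) (z : C).
Local Opaque Rintegral integrable.

Lemma sqr_normcE z : normc z ^+ 2 = complex.Re z ^+ 2 + complex.Im z ^+ 2.
Proof. by case: z => a b /=; rewrite sqr_sqrtr// addr_ge0 ?sqr_ge0. Qed.

Lemma normcR_ge0 z : 0 <= normc z.
Proof. by case: z => a b; exact: sqrtr_ge0. Qed.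

Lemma Re_le_normc z : `|complex.Re z| <= normc z.
Proof.
rewrite -(@ler_pXn2r _ 2)// ?nnegrE ?normcR_ge0// sqr_normcE real_normK ?num_real//.
by rewrite lerDl sqr_ge0.
Qed.

Lemma Im_le_normc z : `|complex.Im z| <= normc z.
Proof.
rewrite -(@ler_pXn2r _ 2)// ?nnegrE ?normcR_ge0// sqr_normcE real_normK ?num_real//.
by rewrite lerDr sqr_ge0.
Qed.

Lemma normc_le_ReIm z : normc z <= `|complex.Re z| + `|complex.Im z|.
Proof.
rewrite -(@ler_pXn2r _ 2)// ?nnegrE ?normcR_ge0 ?addr_ge0//.
rewrite sqr_normcE sqrrD !real_normK ?num_real// -addrA lerD2l lerDr.
by rewrite mulrn_wge0// mulr_ge0.
Qed.

Lemma Re_add z z' : complex.Re (z + z') = complex.Re z + complex.Re z'.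
Proof. by case: z; case: z'. Qed.
Lemma Im_add z z' : complex.Im (z + z') = complex.Im z + complex.Im z'.
Proof. by case: z; case: z'. Qed.
Lemma Re_opp z : complex.Re (- z) = - complex.Re z. Proof. by case: z. Qed.
Lemma Im_opp z : complex.Im (- z) = - complex.Im z. Proof. by case: z. Qed.
Lemma Re_sub z z' : complex.Re (z - z') = complex.Re z - complex.Re z'.
Proof. by rewrite Re_add Re_opp. Qed.
Lemma Im_sub z z' : complex.Im (z - z') = complex.Im z - complex.Im z'.
Proof. by rewrite Im_add Im_opp. Qed.
Lemma Re_mul z z' : complex.Re (z * z') =
  complex.Re z * complex.Re z' - complex.Im z * complex.Im z'.
Proof. by case: z; case: z'. Qed.
Lemma Im_mul z z' : complex.Im (z * z') =
  complex.Re z * complex.Im z' + complex.Im z * complex.Re z'.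
Proof. by case: z; case: z'. Qed.

Lemma normc_sqr_meas f : cmeasurable f -> meas (fun x => normc (f x) ^+ 2).
Proof.
move=> [mr mi]; under eq_fun do rewrite sqr_normcE.
by apply: measurable_funD; exact: meas_sqr.
Qed.

Lemma normc_meas f : cmeasurable f -> meas (fun x => normc (f x)).
Proof.
move=> mf; rewrite (_ : (fun x => _) = Num.sqrt \o (fun x => normc (f x) ^+ 2)).
  apply: measurableT_comp; last exact: normc_sqr_meas.
  by apply: continuous_measurable_fun; exact: sqrt_continuous.
by apply/funext => x /=; rewrite sqrtr_sqr ger0_norm// normcR_ge0.
Qed.

Definition sqL2 f := \int[mu]_x (cRe f x ^+ 2) + \int[mu]_x (cIm f x ^+ 2).

Lemma cLnorm2_sqr f : (cLnorm 2%:E f `^ 2 = \int[mu]_x (normc (f x) ^+ 2)%:E)%E.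
Proof.
rewrite /cLnorm poweR_Lnorm//; apply: eq_integral => x _.
by rewrite abse_EFin ger0_norm ?normcR_ge0// poweR_EFin powR_mulrn ?normcR_ge0.
Qed.

Lemma cLnorm2E f : L2 (cRe f) -> L2 (cIm f) -> cLnorm 2%:E f = (Num.sqrt (sqL2 f))%:E.
Proof.
move=> [_ I1] [_ I2]; have I := intgD I1 I2.
have H : (cLnorm 2%:E f `^ 2 = (sqL2 f)%:E)%E.
  rewrite cLnorm2_sqr /sqL2 -(intD I1 I2) -(intE I).
  by apply: eq_integral => x _; rewrite sqr_normcE.
have L0 : (0 <= cLnorm 2%:E f)%E by exact: Lnorm_ge0.
have -> : cLnorm 2%:E f = ((cLnorm 2%:E f `^ 2) `^ 2^-1)%E.
  by rewrite -poweRrM divff// poweRe1.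
rewrite H poweR12_sqrt//.
by rewrite lee_fin addr_ge0//; apply: int_ge0 => x; exact: sqr_ge0.
Qed.

Lemma cLnorm2_fin f : cmeasurable f -> (cLnorm 2%:E f < +oo)%E -> L2 (cRe f) /\ L2 (cIm f).
Proof.
move=> mf ff; have I : intg (fun x => normc (f x) ^+ 2).
  apply/integrableP; split; first by apply/measurable_EFinP; exact: normc_sqr_meas.
  rewrite (_ : (\int[mu]_x _)%E = (cLnorm 2%:E f `^ 2)%E); first exact: poweR_lty.
  rewrite cLnorm2_sqr; apply: eq_integral => x _ /=.
  by rewrite ger0_norm// sqr_ge0.
have [mr mi] := mf; split; split => //.
  apply: (le_intg (meas_sqr mr) _ I) => x.
  by rewrite ger0_norm ?sqr_ge0// sqr_normcE lerDl sqr_ge0.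
apply: (le_intg (meas_sqr mi) _ I) => x.
by rewrite ger0_norm ?sqr_ge0// sqr_normcE lerDr sqr_ge0.
Qed.

Lemma sqL2_ge0 f : 0 <= sqL2 f.
Proof. by rewrite addr_ge0//; apply: int_ge0 => x; exact: sqr_ge0. Qed.

Lemma sqL2_le f (e : R) : cmeasurable f -> 0 <= e -> (cLnorm 2%:E f <= e%:E)%E ->
  sqL2 f <= e ^+ 2.
Proof.
move=> mf e0 fe; have [L1 L2'] := cLnorm2_fin mf (le_lt_trans fe (ltry e)).
move: fe; rewrite cLnorm2E// lee_fin => H.
rewrite -(sqr_sqrtr (sqL2_ge0 f)).
by rewrite ler_pXn2r// nnegrE ?sqrtr_ge0.
Qed.

End complex_L2.

(** * Real Schwartz functions and real tempered distributions *)

Section schwartz_real.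
Context {R : realType} {N : nat}.
Local Notation E := 'rV[R]_N.
Local Notation C := R[i].
Local Notation normc := (@Normc.normc R).
Local Notation e_ j := (delta_mx ord0 j : E).
Implicit Types (f : E -> C) (g h : E -> R) (j : 'I_N) (x y : E) (js : seq 'I_N).
Local Opaque smooth.

Definition rschwartz_le k (M : R) g := forall js x, (size js <= k)%N ->
  (1 + enorm x) ^+ k * `|partials js g x| <= M.

Definition rschwartz g := smooth g /\ forall k, exists M, rschwartz_le k M g.

Let en1 x : 0 < 1 + enorm x. Proof. by rewrite ltr_pwDl// enorm_ge0. Qed.

Let en1k x k : 0 < (1 + enorm x) ^+ k. Proof. exact: exprn_gt0. Qed.

Lemma partials0 js : partials js (fun=> 0 : R) = (fun=> 0 : R) :> (E -> R).
Proof. by apply/funext => x; exact: (@partials_zero _ _ js (fun=> 0) setT openT). Qed.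

Lemma schwartz_le_cOf k (M : R) g : rschwartz_le k M g -> schwartz_le k M (cOf g).
Proof.
move=> gM js x jk; rewrite /cpartials cRe_cOf cIm_cOf partials0.
by rewrite /= expr0n addr0 sqrtr_sqr gM.
Qed.

Lemma schwartz_cOf g : rschwartz g -> schwartz (cOf g).
Proof.
move=> [sg gM]; split.
  by split; [rewrite cRe_cOf|rewrite cIm_cOf; exact: smooth_cst].
by move=> k; have [M kM] := gM k; exists M; exact: schwartz_le_cOf.
Qed.

Lemma rschwartz_ReIm f : schwartz f -> rschwartz (cRe f) /\ rschwartz (cIm f).
Proof.
move=> [[s1 s2] fM]; split; split => // k; have [M kM] := fM k; exists M => js x jk.
  apply: le_trans (kM js x jk); rewrite (ler_wpM2l (ltW (en1k x k)))//.
  exact: (@Re_le_normc R (cpartials js f x)).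
apply: le_trans (kM js x jk); rewrite (ler_wpM2l (ltW (en1k x k)))//.
exact: (@Im_le_normc R (cpartials js f x)).
Qed.

Lemma rtest_partials_bounded k h : rtest h -> exists2 B, 0 <= B &
  forall js x, (size js <= k)%N -> `|partials js h x| <= B.
Proof.
elim: k h => [|k IH] h th.
  have [B B0 hB] := rtest_bounded th; exists B => // js x.
  by rewrite leqn0 => /nilP ->; exact: hB.
have [B B0 hB] := rtest_bounded th.
have H j : exists D, 0 <= D /\ forall js x, (size js <= k)%N -> `|partials js (partial j h) x| <= D.
  by have [D D0 HD] := IH _ (rtest_partial j th); exists D.
have [D HD] := choice H.
have S0 : 0 <= \sum_(j < N) D j by apply: sumr_ge0 => j _; case: (HD j).
exists (B + \sum_(j < N) D j); first exact: addr_ge0.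
move=> js x; case/lastP: js => [_|js j].
  by rewrite (le_trans (hB x))// lerDl.
rewrite size_rcons ltnS partials_rcons => jk.
have [_ /(_ js x jk) H1] := HD j; apply: (le_trans H1); rewrite (bigD1 j)//= addrCA lerDl addr_ge0//.
by apply: sumr_ge0 => i _; case: (HD i).
Qed.

Lemma rschwartzM k (M B : R) g h : smooth g -> smooth h -> rschwartz_le k M g ->
  (forall js x, (size js <= k)%N -> `|partials js h x| <= B) ->
  rschwartz_le k (2 ^+ k * (M * B)) (fun x => g x * h x).
Proof.
move=> sg sh gM hB js x jk.
have gA ks : (size ks <= k)%N -> `|partials ks g x| <= M / (1 + enorm x) ^+ k.
  by move=> kk; rewrite ler_pdivlMr// mulrC gM.
have := leibniz_le sg sh gA (fun ks => hB ks x) jk.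
rewrite -(ler_pM2l (en1k x k)) => H; apply: (le_trans H).
by rewrite le_eqVlt; apply/orP; left; apply/eqP; field; rewrite gt_eqF.
Qed.

Lemma rschwartzM_rtest g h : rschwartz g -> rtest h -> rschwartz (fun x => g x * h x).
Proof.
move=> [sg gM] th; have [sh _] := th; split; first exact: smoothM.
move=> k; have [B _ hB] := rtest_partials_bounded k th; have [M kM] := gM k.
by exists (2 ^+ k * (M * B)); exact: rschwartzM.
Qed.

Lemma rschwartzD_le k (M M' : R) g h : smooth g -> smooth h -> rschwartz_le k M g ->
  rschwartz_le k M' h -> rschwartz_le k (M + M') (fun x => g x + h x).
Proof.
move=> sg sh gM hM js x jk; rewrite partialsD//.
rewrite (le_trans (ler_wpM2l (ltW (en1k x k)) (ler_normD _ _)))// mulrDr.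
by rewrite lerD ?gM ?hM.
Qed.

Lemma rschwartzZ_le k (M c : R) g : smooth g -> rschwartz_le k M g ->
  rschwartz_le k (`|c| * M) (fun x => c * g x).
Proof.
move=> sg gM js x jk; rewrite partialsZ// normrM mulrCA ler_wpM2l//; exact: gM.
Qed.

Lemma rschwartzB g h : rschwartz g -> rschwartz h -> rschwartz (fun x => g x - h x).
Proof.
move=> [sg gM] [sh hM]; split; first exact: smoothB.
move=> k; have [M kM] := gM k; have [M' kM'] := hM k; exists (M + `|-1| * M').
have := rschwartzD_le sg (smoothZ (-1) sh) kM (rschwartzZ_le (-1) sh kM').
by congr rschwartz_le; apply/funext => x; rewrite mulN1r.
Qed.

(** A Peetre-type inequality: moving the weight from y to x - y costs a constant that depends only
    on the cube containing x. *)
Lemma enorm_subl x y (c : R) : (forall i, `|x ord0 i| <= c) -> 0 <= c ->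
  1 + enorm y <= (1 + N%:R + N%:R * c) * (1 + enorm (x - y)).
Proof.
move=> xc c0.
have z0 := enorm_ge0 (x - y); set t := enorm (x - y) in z0 *.
have H : enorm y <= N%:R * (c + t).
  apply: enorm_le_coords => [|i]; first exact: addr_ge0.
  rewrite (_ : y ord0 i = x ord0 i - (x - y) ord0 i); last by rewrite !mxE; ring.
  rewrite (le_trans (ler_normB _ _))// lerD//; exact: coord_le_enorm.
have n0 : 0 <= N%:R :> R by [].
apply: (@le_trans _ _ (1 + N%:R * (c + t))); first by rewrite lerD2l.
rewrite -subr_ge0 (_ : _ - _ = t + N%:R + N%:R * c * t); last by ring.
by rewrite !addr_ge0// !mulr_ge0.
Qed.

Lemma rschwartz_refl g x : rschwartz g -> rschwartz (fun y => g (x - y)).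
Proof.
move=> [sg gM]; split; first exact: smooth_refl.
pose c := \sum_(i < N) `|x ord0 i|.
have c0 : 0 <= c by apply: sumr_ge0.
have xc i : `|x ord0 i| <= c.
  by rewrite /c (bigD1 i)//= lerDl; apply: sumr_ge0.
have D0 : 0 <= 1 + N%:R + N%:R * c by rewrite !addr_ge0// mulr_ge0.
move=> k; have [M kM] := gM k; exists ((1 + N%:R + N%:R * c) ^+ k * M) => js y jk.
rewrite partials_refl// normrM normrX normrN1 expr1n mul1r.
apply: le_trans (ler_wpM2l (exprn_ge0 k D0) (kM js (x - y) jk)).
have h1 := enorm_subl y xc c0; have h0 := le_trans (ltW (en1 y)) h1.
by rewrite mulrA -exprMn ler_wpM2r// lerXn2r// nnegrE ltW.
Qed.

Lemma enormZ (c : R) x : 0 <= c -> enorm (c *: x) = c * enorm x.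
Proof.
move=> c0; rewrite /enorm (_ : dotv (c *: x) (c *: x) = c ^+ 2 * dotv x x).
  by rewrite sqrtrM ?sqr_ge0// sqrtr_sqr ger0_norm.
by rewrite /dotv mulr_sumr; apply: eq_bigr => i _; rewrite !mxE; ring.
Qed.

Section tempered.
Variables (W : (E -> C) -> C) (K : R) (chi : R -> R).
Hypotheses (hchi : cutoff K chi) (tW : tempered W) (rW : real_distr W).

Let T g := W (cOf g).

Lemma temperedD g h : rschwartz g -> rschwartz h -> T (fun x => g x + h x) = T g + T h.
Proof.
move=> sg sh; have [lin _] := tW.
have := lin 1 _ _ (schwartz_cOf sg) (schwartz_cOf sh); rewrite mul1r => <-.
by congr W; apply/funext => x; rewrite mul1r /cOf rmorphD.
Qed.

Lemma temperedB g h : rschwartz g -> rschwartz h -> T (fun x => g x - h x) = T g - T h.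
Proof.
move=> sg sh; have [lin _] := tW.
have := lin (-1) _ _ (schwartz_cOf sh) (schwartz_cOf sg); rewrite mulN1r addrC => <-.
by congr W; apply/funext => x; rewrite mulN1r /cOf rmorphB addrC.
Qed.

(** [real_distr] concerns compactly supported tests. Multiplying g by a cutoff at radius r gives
    such a test; the remainder has a seminorm of size O(1 / r) at the order k of W, so its
    contribution vanishes as r grows. *)
Lemma tempered_real g : rschwartz g -> complex.Im (T g) = 0.
Proof.
move=> sg; have [sm gM] := sg; have [lin [k [K' Wle]]] := tW.
(* One order above that of W: the extra factor 1 + |x| in the weight yields the decay 1 / r outside
   the ball of radius r. *)
have [M' kM] := gM k.+1.
pose th x := chi (enorm (x - 0) / 1).
have tt : rtest th := radial_cutoff_rtest 0 hchi ltr01.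
have [st [cs ss]] := tt.
have [B B0 HB] := rtest_partials_bounded k tt.
have M0 : 0 <= M' by apply: le_trans (kM [::] 0 _); rewrite // mulr_ge0// ltW.
pose A := `|K'| * (2 ^+ k * (M' * (1 + B))).
have A0 : 0 <= A by rewrite !mulr_ge0// addr_ge0.
have key r : 1 <= r -> `|complex.Im (T g)| <= A / r.
  move=> r1; have r0 : 0 < r by exact: lt_le_trans r1.
  pose er x := th (r^-1 *: x).
  have ser : smooth er by exact: smooth_scale.
  have ter : rtest er.
    split => //; exists (cs * r) => x i xi; apply: (ss _ i).
    by rewrite mxE normrM gtr0_norm ?invr_gt0// mulrC ltr_pdivlMr.
  have s1 : smooth (fun x => 1 - er x) := smoothB (smooth_cst 1) ser.
  (* Each derivative of the rescaled cutoff brings a factor 1 / r <= 1, so this bound is uniform in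
     r. *)
  have hb js x : (size js <= k)%N -> `|partials js (fun x => 1 - er x) x| <= 1 + B.
    move=> jk; have pe : `|partials js er x| <= B.
      rewrite partials_scale// normrM normrX -[leRHS]mul1r ler_pM//; last exact: HB.
      by rewrite exprn_ile1// ger0_norm ?invr_ge0 ?(ltW r0)// invf_le1.
    rewrite (_ : (fun x => 1 - er x) = fun x => 1 + (-1) * er x); last first.
      by apply/funext => y; rewrite mulN1r.
    rewrite partialsD; [|exact: smooth_cst|exact: smoothZ].
    rewrite partialsZ// (le_trans (ler_normD _ _))// lerD//; last first.
      by rewrite mulN1r normrN.
    case/lastP: js jk {pe} => [_|js j _]; first by rewrite normr1.
    rewrite partials_rcons (_ : partial j _ = fun=> 0); first by rewrite partials0 normr0.
    by apply: is_derive_partial => y; exact: (@is_derive_cst R E R 1 y (e_ j)).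
  have sge : rschwartz (fun x => g x * er x) by exact: rschwartzM_rtest.
  have smg : smooth (fun x => g x * (1 - er x)) by exact: smoothM.
  have gE : g = fun x => g x * (1 - er x) + g x * er x.
    by apply/funext => x; rewrite -mulrDr subrK mulr1.
  have sgd : rschwartz (fun x => g x * (1 - er x)).
    have := rschwartzB sg sge; congr rschwartz; apply/funext => x; rewrite mulrBr mulr1//.
  have oU : open [set x : E | enorm (x - 0) < r].
    have -> : [set x : E | enorm (x - 0) < r] = (fun x => enorm (x - 0)) @^-1` [set t | t < r] by [].
    by apply: open_comp (@open_lt R r) => x _; exact: continuous_enorm.
  have bd : rschwartz_le k (2 ^+ k * (M' * (1 + B)) / r) (fun x => g x * (1 - er x)).
    move=> js x jk; have [xr|xr] := ltP (enorm (x - 0)) r.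
      rewrite (partials_zero _ oU _ xr) ?normr0 ?mulr0.
        by rewrite !mulr_ge0 ?invr_ge0 ?(ltW r0)// addr_ge0.
      move=> y /= yr; rewrite /er /th (_ : chi _ = 1) ?subrr ?mulr0//.
      have [_ h1 _ _ _] := hchi; apply: h1; rewrite subr0 divr1 enormZ ?invr_ge0 ?(ltW r0)//.
      rewrite ger0_norm; last by rewrite mulr_ge0 ?enorm_ge0// invr_ge0 ltW.
      by rewrite mulrC ler_pdivrMr// mul1r ltW//; rewrite subr0 in yr.
    have gA ks : (size ks <= k)%N -> `|partials ks g x| <= M' / (1 + enorm x) ^+ k.+1.
      by move=> kk; rewrite ler_pdivlMr// mulrC; apply: kM; exact: leqW.
    have := leibniz_le sm s1 gA (fun ks => hb ks x) jk.
    rewrite -(ler_pM2l (en1k x k)) => H; apply: (le_trans H).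
    rewrite [leLHS](_ : _ = 2 ^+ k * (M' * (1 + B)) / (1 + enorm x)); last first.
      by rewrite exprS; field; rewrite !gt_eqF.
    rewrite ler_wpM2l//; first by rewrite !mulr_ge0// addr_ge0.
    rewrite lef_pV2 ?posrE//; rewrite subr0 in xr; by rewrite (le_trans xr)// lerDr.
  have -> : T g = T (fun x => g x * (1 - er x)) + T (fun x => g x * er x).
    by rewrite -temperedD//; congr T.
  rewrite Im_add (rW (rtest_real_test (rtestM_smooth sm ter))) addr0.
  apply: (le_trans (Im_le_normc _)).
  apply: (le_trans (Wle _ _ (schwartz_cOf sgd) (schwartz_le_cOf bd))).
  by rewrite /A -[leRHS]mulrA ler_wpM2r ?ler_norm// mulr_ge0 ?invr_ge0 ?(ltW r0)// !mulr_ge0// addr_ge0.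
apply/eqP; rewrite -normr_le0; apply/ler_addgt0Pr => e e0; rewrite add0r.
have r1 : 1 <= Num.max 1 (A / e) by rewrite le_max lexx.
apply: (le_trans (key _ r1)); have m0 : 0 < Num.max 1 (A / e) by exact: lt_le_trans r1.
by rewrite ler_pdivrMr// mulrC -ler_pdivrMr// le_max lexx orbT.
Qed.

End tempered.

End schwartz_real.

(** * Convolution with W: continuity and reality *)

Section real_potential.
Context {R : realType} {N : nat}.
Local Notation E := 'rV[R]_N.
Local Notation C := R[i].
Local Notation mu := (leb N : {measure set E -> \bar R}).
Local Notation intg := (rintegrable mu).
Local Notation normc := (@Normc.normc R).
Local Notation e_ j := (delta_mx ord0 j : E).
Implicit Types (f : E -> C) (g h : E -> R) (j : 'I_N) (x y z : E) (js : seq 'I_N).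
Local Opaque smooth Rintegral integrable.

(* Continuity of W * f is needed for its measurability: on functions that are
   not measurable Lnorm is a lower integral, which is not subadditive. *)
Lemma coord_lip_continuous h :
  (forall c : R, 0 <= c -> exists2 L, 0 <= L & forall z j (s : R), (forall i, `|z ord0 i| <= c) ->
     `|s| <= c -> `|h (s *: e_ j + z) - h z| <= L * `|s|) -> continuous h.
Proof.
move=> H x; pose c := `|x| + 1; have c0 : 0 <= c by rewrite addr_ge0.
have [L L0 HL] := H c c0.
have lip y : `|y - x| <= 1 -> `|h y - h x| <= (L * `|y - x|) *+ N.
  move=> yx1.
  have sj j : `|y ord0 j - x ord0 j| <= `|y - x|.
    by have := coord_norm_le (y - x) j; rewrite !mxE.
  have xc i : `|x ord0 i| <= c by rewrite (le_trans (coord_norm_le x i))// lerDl.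
  have yc i : `|y ord0 i| <= c.
    have -> : y ord0 i = x ord0 i + (y ord0 i - x ord0 i) by rewrite addrC subrK.
    rewrite (le_trans (ler_normD _ _))// lerD//; first exact: coord_norm_le.
    exact: le_trans (sj i) yx1.
  have P z j : (forall i, z ord0 i = x ord0 i \/ z ord0 i = y ord0 i) ->
      `|h ((y ord0 j - x ord0 j) *: e_ j + z) - h z| <= L * `|y - x|.
    move=> zxy; apply: (@le_trans _ _ (L * `|y ord0 j - x ord0 j|)).
      apply: HL => [i|]; first by have [->|->] := zxy i.
      by rewrite (le_trans (sj j))// (le_trans yx1)// lerDr.
    by rewrite ler_wpM2l.
  have := coord_path P (enum_uniq 'I_N).
  rewrite size_enum_ord (_ : \row_i _ = y)//.
  by apply/rowP => i; rewrite mxE mem_enum.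
rewrite /continuous_at; apply/(cvgrPdist_le (F := nbhs x)) => e e0.
have LN : 0 <= L *+ N by exact: mulrn_wge0.
have [d d0 Hd] := small_factor LN e0.
have m0 : 0 < Num.min 1 d by rewrite lt_min ltr01.
near=> y.
have yx : `|x - y| < Num.min 1 d by near: y; apply: cvgr_dist_lt.
move: yx; rewrite lt_min distrC => /andP[/ltW y1 /ltW yd].
rewrite distrC (le_trans (lip y y1))// (le_trans _ Hd)// -mulrnAl ler_wpM2l//.
Unshelve. all: by end_near. Qed.

Section tempered.
Variables (W : (E -> C) -> C).
Hypothesis tW : tempered W.

Definition rconv g x := W (cOf (fun y => g (x - y))).

(** Shifting x by s e_j changes y -> g (x - y) by O(|s|) in the seminorm of order k. The mean value
    theorem costs one derivative, whence the use of the order k + 1; temperedness then gives the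
    Lipschitz bound. *)
Lemma rconv_lip g : rschwartz g -> forall c : R, 0 <= c -> exists2 L, 0 <= L &
  forall z j (s : R), (forall i, `|z ord0 i| <= c) -> `|s| <= c ->
    normc (rconv g (s *: e_ j + z) - rconv g z) <= L * `|s|.
Proof.
move=> sg c c0; have [sm gM] := sg; have [_ [k [K' Wle]]] := tW.
have [M kM] := gM k.+1.
have M0 : 0 <= M.
  by apply: le_trans (kM [::] 0 _); rewrite // mulr_ge0// exprn_ge0// addr_ge0// enorm_ge0.
have cc0 : 0 <= c + c by rewrite addr_ge0.
(* Points on the segment from z to z + s e_j have coordinates of absolute value at most c + c. *)
pose D0 : R := 1 + N%:R + N%:R * (c + c).
have D00 : 0 <= D0 by rewrite !addr_ge0// mulr_ge0.
exists (`|K'| * (D0 ^+ k * M)); first by rewrite !mulr_ge0// exprn_ge0.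
move=> z j s zc sc.
have sr w : rschwartz (fun y => g (w - y)) by exact: rschwartz_refl.
rewrite /rconv -(temperedB tW (sr _) (sr _)).
have bd : rschwartz_le k (D0 ^+ k * M * `|s|) (fun y => g (s *: e_ j + z - y) - g (z - y)).
  move=> js y jk.
  have en0 (w : E) : 0 < 1 + enorm w by rewrite ltr_pwDl// enorm_ge0.
  have -> : partials js (fun y => g (s *: e_ j + z - y) - g (z - y)) y =
      (-1) ^+ size js * (partials js g (s *: e_ j + (z - y)) - partials js g (z - y)).
    have -> : (fun y => g (s *: e_ j + z - y) - g (z - y)) =
        (fun y => g (s *: e_ j + z - y) + (-1) * g (z - y)).
      by apply/funext => w; rewrite mulN1r.
    rewrite (partialsD _ (smooth_refl _ sm) (smoothZ _ (smooth_refl _ sm))).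
    by rewrite (partialsZ _ _ (smooth_refl _ sm)) !(partials_refl _ _ _ sm) addrA; ring.
  rewrite normrM normrX normrN1 expr1n mul1r.
  have := @derive_mvt R N (partials js g) (z - y) j s (D0 ^+ k * M / (1 + enorm y) ^+ k).
  have -> : D0 ^+ k * M * `|s| = (1 + enorm y) ^+ k * (D0 ^+ k * M / (1 + enorm y) ^+ k * `|s|).
    by rewrite [RHS]mulrA (mulrC ((1 + enorm y) ^+ k)) divfK// gt_eqF// exprn_gt0 ?en0.
  move=> H; apply: (ler_wpM2l (exprn_ge0 k (ltW (en0 y)))).
  apply: H => [w|].
    exact: smooth_derivable (smooth_partials js sm).
  move=> t ts; rewrite -[partial j (partials js g)]/(partials (j :: js) g).
  set w := t *: e_ j + z.
  have wc i : `|w ord0 i| <= c + c.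
    rewrite !mxE (le_trans (ler_normD _ _))// lerD// normrM eqxx/=.
    rewrite (le_trans _ sc)// (le_trans _ ts)// ler_piMr//.
    by case: (i == j); rewrite ?normr1 ?normr0 ?ler01.
  have := kM (j :: js) (w - y) jk; rewrite addrA -/w => H1.
  rewrite ler_pdivlMr ?exprn_gt0 ?en0// mulrC.
  apply: (@le_trans _ _ (D0 ^+ k * (1 + enorm (w - y)) ^+ k * `|partials (j :: js) g (w - y)|)).
    rewrite ler_wpM2r// -exprMn.
    have h1 := enorm_subl y wc cc0; have h0 := le_trans (ltW (en0 y)) h1.
    by rewrite lerXn2r// nnegrE ltW.
  rewrite -mulrA ler_wpM2l ?exprn_ge0//; apply: le_trans H1.
  rewrite ler_wpM2r// exprS ler_peMl ?exprn_ge0 ?(ltW (en0 _))//.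
  by rewrite lerDl enorm_ge0.
apply: (le_trans (Wle _ _ (schwartz_cOf (rschwartzB (sr _) (sr _))) (schwartz_le_cOf bd))).
rewrite -[leRHS]mulrA ler_wpM2r ?ler_norm// mulr_ge0//.
by rewrite mulr_ge0// exprn_ge0.
Qed.

Lemma rconv_cmeas g : rschwartz g -> cmeasurable (rconv g).
Proof.
move=> sg; have H := rconv_lip sg.
split; apply: continuous_meas; apply: coord_lip_continuous => c c0.
  have [L L0 HL] := H c c0; exists L => // z j s zc sc; apply: le_trans (HL z j s zc sc).
  by rewrite /cRe -Re_sub; exact: Re_le_normc.
have [L L0 HL] := H c c0; exists L => // z j s zc sc; apply: le_trans (HL z j s zc sc).
by rewrite /cIm -Im_sub; exact: Im_le_normc.
Qed.

Lemma dconv_split f x : schwartz f -> dconv W f x = 'i%C * rconv (cIm f) x + rconv (cRe f) x.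
Proof.
move=> sf; have [s1 s2] := rschwartz_ReIm sf; have [lin _] := tW.
rewrite /rconv -(lin _ _ _ (schwartz_cOf (rschwartz_refl x s2)) (schwartz_cOf (rschwartz_refl x s1))).
congr W; apply/funext => y; rewrite /cOf /cRe /cIm; case: (f (x - y)) => a b /=.
rewrite -[RHS]/((0 * b - 1 * 0 + a) +i* (0 * 0 + 1 * b + 0))%C.
by congr (_ +i* _)%C; ring.
Qed.

End tempered.

Lemma cmeasD f f' : cmeasurable f -> cmeasurable f' -> cmeasurable (fun x => f x + f' x).
Proof.
move=> [m1 m2] [m1' m2']; split.
  rewrite (_ : cRe _ = fun x => cRe f x + cRe f' x); last by apply/funext => x; exact: Re_add.
  exact: measurable_funD.
rewrite (_ : cIm _ = fun x => cIm f x + cIm f' x); last by apply/funext => x; exact: Im_add.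
exact: measurable_funD.
Qed.

Lemma cmeasB f f' : cmeasurable f -> cmeasurable f' -> cmeasurable (fun x => f x - f' x).
Proof.
move=> [m1 m2] [m1' m2']; split.
  rewrite (_ : cRe _ = fun x => cRe f x - cRe f' x); last by apply/funext => x; exact: Re_sub.
  exact: measurable_funB.
rewrite (_ : cIm _ = fun x => cIm f x - cIm f' x); last by apply/funext => x; exact: Im_sub.
exact: measurable_funB.
Qed.

Lemma ereal_cvg0_le (T : Type) (F : set_system T) {FF : Filter F} (u : T -> \bar R) (e : R) :
  u @ F --> 0%E -> 0 < e -> \forall n \near F, (u n <= e%:E)%E.
Proof.
move=> u0 e0; have H : nbhs (0%E : \bar R) [set y : \bar R | (y < e%:E)%E].
  by apply: open_nbhs_nbhs; split; [exact: open_ereal_lt_ereal|rewrite /= lte_fin].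
apply: (@filterS _ F FF _ _ _ (u0 _ H)) => n; exact: ltW.
Qed.

(* If f_n tends to the real f in L^2 then Im f_n tends to 0, and so does
   Im (W * f_n) = W * Im f_n. *)
Lemma conv_ext_real W f (V : E -> C) (K : R) (chi : R -> R) : cutoff K chi -> multiplier 2 2 W ->
  real_distr W -> (forall x, complex.Im (f x) = 0) -> conv_ext 2 2 W f V ->
  {ae mu, forall x, cIm V x = 0}.
Proof.
move=> hchi [tW [K2 HK]] rW f0 [[mf ff] [mV fV] [f_ [sf cf cW]]].
have [_ LV] := cLnorm2_fin mV fV.
(* The first square bounds the distance from Im V to the imaginary part of W * f_n; the second
   bounds that imaginary part itself, since Im f_n has norm at most e and [K2] is the multiplier
   constant. *)
have bound (e : R) : 0 < e -> \int[mu]_x (cIm V x ^+ 2) <= 2 * (e ^+ 2 + (`|K2| * e) ^+ 2).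
  move=> e0.
  have [n _ /(_ n (leqnn n))[H1 H2]] :=
    filterI (ereal_cvg0_le cf e0) (ereal_cvg0_le cW e0).
  have [sg sh] := rschwartz_ReIm (sf n).
  pose h := cIm (f_ n); pose g := cRe (f_ n).
  have mfn : cmeasurable (f_ n) by split; apply: smooth_meas; [have [] := sg|have [] := sh].
  have mfd := cmeasB mfn mf.
  have [_ LI] := cLnorm2_fin mfd (le_lt_trans H1 (ltry e)).
  have hE : (fun x => cIm (fun x => f_ n x - f x) x) = h.
    by apply/funext => x; rewrite /cIm Im_sub f0 subr0.
  have Lh : L2 h by rewrite -hE.
  have ih : \int[mu]_x (h x ^+ 2) <= e ^+ 2.
    have := sqL2_le mfd (ltW e0) H1; rewrite /sqL2; apply: le_trans; rewrite -hE lerDr.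
    by apply: int_ge0 => x; exact: sqr_ge0.
  have sqr0E : (fun x : E => (0 : R) ^+ 2) = (fun=> 0) by apply/funext => x; rewrite expr0n.
  have L0 : L2 (fun x : E => 0 : R).
    by split; [exact: measurable_cst|rewrite sqr0E; exact: intg0].
  have mc := rconv_cmeas tW sh.
  have H3 : (cLnorm 2%:E (rconv W h) <= (`|K2| * e)%:E)%E.
    apply: (le_trans (HK _ (schwartz_cOf sh))).
    have -> := @cLnorm2E _ _ (cOf h) Lh L0.
    have ce : Num.sqrt (sqL2 (cOf h)) <= e.
      rewrite -(ger0_norm (ltW e0)) -sqrtr_sqr ler_wsqrtr// /sqL2.
      by rewrite [X in _ + X](_ : _ = 0) ?addr0// cIm_cOf sqr0E int0.
    rewrite -EFinM lee_fin (le_trans (ler_wpM2r (sqrtr_ge0 _) (ler_norm K2)))//.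
    exact: ler_wpM2l.
  have [Lc _] := cLnorm2_fin mc (le_lt_trans H3 (ltry _)).
  have ic : \int[mu]_x (cRe (rconv W h) x ^+ 2) <= (`|K2| * e) ^+ 2.
    have := sqL2_le mc (mulr_ge0 (normr_ge0 K2) (ltW e0)) H3; rewrite /sqL2; apply: le_trans.
    by rewrite lerDl; apply: int_ge0 => x; exact: sqr_ge0.
  have dE : dconv W (f_ n) = fun x => 'i%C * rconv W h x + rconv W g x.
    by apply/funext => x; rewrite (dconv_split tW x (sf n)).
  have ImE x : complex.Im (dconv W (f_ n) x) = cRe (rconv W h) x.
    rewrite dE Im_add Im_mul (tempered_real hchi tW rW (rschwartz_refl x sg)) addr0.
    by rewrite mul0r add0r mul1r.
  have md : cmeasurable (dconv W (f_ n)).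
    have [mi _] := mc; have [mg _] := rconv_cmeas tW sg; have [_ mI] := mc.
    split; last by rewrite (_ : cIm _ = cRe (rconv W h)) //; apply/funext => x; exact: ImE.
    rewrite (_ : cRe _ = fun x => - cIm (rconv W h) x + cRe (rconv W g) x).
      by apply: measurable_funD mg; exact: measurableT_comp.
    apply/funext => x; rewrite dE /cRe Re_add Re_mul; congr (_ + _).
    by rewrite mul0r add0r mul1r.
  have mdV := cmeasB md mV.
  have [_ Ld] := cLnorm2_fin mdV (le_lt_trans H2 (ltry e)).
  have id : \int[mu]_x (cIm (fun x => dconv W (f_ n) x - V x) x ^+ 2) <= e ^+ 2.
    have := sqL2_le mdV (ltW e0) H2; rewrite /sqL2; apply: le_trans; rewrite lerDr.
    by apply: int_ge0 => x; exact: sqr_ge0.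
  have := L2_shift_le LV Lc; rewrite -mulrDr => H; apply: (le_trans H).
  rewrite ler_wpM2l// addrC lerD//; apply: le_trans id.
  rewrite le_eqVlt; apply/orP; left; apply/eqP; apply: eq_int => x.
  by rewrite /cIm Im_sub ImE -sqrrN opprB.
have V0 : \int[mu]_x (cIm V x ^+ 2) = 0.
  apply/eqP; rewrite eq_le; apply/andP; split; last by apply: int_ge0 => x; exact: sqr_ge0.
  apply/ler_addgt0Pr => e e0; rewrite add0r.
  have B0 : 0 <= 2 * (1 + `|K2| ^+ 2) by rewrite mulr_ge0// addr_ge0// sqr_ge0.
  have [d d0 Hd] := small_factor B0 e0.
  have m0 : 0 < Num.min 1 d by rewrite lt_min ltr01.
  apply: (le_trans (bound _ m0)); apply: le_trans Hd.
  rewrite exprMn -{1}[_ ^+ 2]mul1r -mulrDl mulrA ler_wpM2l//.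
  rewrite expr2 (@le_trans _ _ (1 * Num.min 1 d))// ?mul1r; last by rewrite ge_min lexx orbT.
  by rewrite -[leRHS]mul1r ler_wpM2r ?(ltW m0)// ge_min lexx.
have [_ IV] := LV.
have := int_ge0_eq0 IV (fun x => sqr_ge0 _) V0.
by apply: filterS => x H; apply/eqP; rewrite -sqrf_eq0; apply/eqP; exact: H.
Qed.

End real_potential.

(** * Complex-valued Sobolev functions *)

Section complex_weak.
Context {R : realType} {N : nat}.
Local Notation E := 'rV[R]_N.
Local Notation C := R[i].
Local Notation mu := (leb N : {measure set E -> \bar R}).
Local Notation intg := (rintegrable mu).
Local Notation normc := (@Normc.normc R).
Implicit Types (f : E -> C) (h p q : E -> R) (P Q : 'I_N -> E -> R) (x : E) (j : 'I_N).
Local Opaque smooth Rintegral integrable.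

Definition eball (r : R) : set E := [set x | enorm x <= r].

Lemma measurable_eball (r : R) : measurable (eball r).
Proof.
have : measurable (~` [set x : E | r < enorm (x - 0)]).
  apply: measurableC; apply: open_measurable_rV.
  have -> : [set x : E | r < enorm (x - 0)] = (fun x => enorm (x - 0)) @^-1` [set t | r < t] by [].
  by apply: open_comp (@open_gt R r) => x _; exact: continuous_enorm.
by congr measurable; apply/seteqP; split => x /=; rewrite /eball/= subr0 leNgt => /negP.
Qed.

Lemma eball_intgP (r : R) h : meas h ->
  mu.-integrable (eball r) (EFin \o h) <-> intg (fun x => h x * \1_(eball r) x).
Proof.
move=> mh; have mB := measurable_eball r.
rewrite (integrable_mkcond _ mB); apply: iff_sym.
rewrite (_ : (EFin \o h) \_ (eball r) = EFin \o (fun x => h x * \1_(eball r) x)); first by [].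
apply/funext => x; rewrite patchE /= indicE; case: (x \in eball r); first by rewrite mulr1.
by rewrite mulr0.
Qed.

Lemma cube_sub_eball (c : R) : cube c `<=` eball (N%:R * `|c|).
Proof.
move=> x xc; apply: enorm_le_coords => // i.
by rewrite (le_trans (xc i))// ler_norm.
Qed.

Lemma eball_sub_cube (c : R) : eball c `<=` cube c.
Proof. by move=> x xc i; exact: le_trans (coord_le_enorm x i) xc. Qed.

Lemma locally_integrable_ReIm f : Defs.locally_integrable f -> locint (cRe f) /\ locint (cIm f).
Proof.
move=> [mf If]; have [mr mi] := mf; have mn := normc_meas mf.
have H h : meas h -> (forall x, `|h x| <= normc (f x)) -> locint h.
  move=> mh hf; split => // c.
  have /(eball_intgP _ mn) I := If (N%:R * `|c|).
  apply: (le_intg _ _ I).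
    by apply: measurable_funM => //; apply: measurable_indic; exact: measurable_cube.
  move=> x; rewrite normrM ler_pM// !indicE normr_nat ler_nat.
  case: (boolP (x \in cube c)) => //; rewrite inE => xc.
  by rewrite mem_set//; exact: cube_sub_eball.
by split; apply: H => // x; [exact: Re_le_normc|exact: Im_le_normc].
Qed.

Lemma locally_integrable_of f : locint (cRe f) -> locint (cIm f) -> Defs.locally_integrable f.
Proof.
move=> [mr I1] [mi I2]; have mf : cmeasurable f by [].
split => // c; apply/(eball_intgP _ (normc_meas mf)).
have I := intgD (intg_norm (I1 c)) (intg_norm (I2 c)).
apply: (le_intg _ _ I).
  by apply: measurable_funM; [exact: normc_meas|apply: measurable_indic; exact: measurable_eball].
move=> x; rewrite !normrM !indicE !normr_nat -mulrDl ler_pM//.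
  by rewrite ger0_norm ?normcR_ge0// normc_le_ReIm.
rewrite ler_nat; case: (boolP (x \in eball c)) => //; rewrite inE => xc.
by rewrite mem_set//; exact: eball_sub_cube.
Qed.

Lemma cint_mul_cOf f h : cint (fun x => f x * cOf h x) =
  (\int[mu]_x (cRe f x * h x) +i* \int[mu]_x (cIm f x * h x))%C.
Proof.
congr (_ +i* _)%C; apply: eq_int => x; rewrite /cRe /cIm /cOf ?Re_mul ?Im_mul /=.
  by rewrite mulr0 subr0.
by rewrite mulr0 add0r.
Qed.

Lemma cpartials_cOf js h : cpartials js (cOf h) = cOf (partials js h).
Proof. by apply/funext => x; rewrite /cpartials cRe_cOf cIm_cOf partials0. Qed.

Lemma weak_partial_rweak j f g : weak_partial j f g ->
  rweak j (cRe f) (cRe g) /\ rweak j (cIm f) (cIm g).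
Proof.
move=> [lf lg H]; have [l1 l2] := locally_integrable_ReIm lf.
have [l3 l4] := locally_integrable_ReIm lg.
have E h : rtest h -> \int[mu]_x (cRe f x * partial j h x) = - (\int[mu]_x (cRe g x * h x)) /\
    \int[mu]_x (cIm f x * partial j h x) = - (\int[mu]_x (cIm g x * h x)).
  move=> th; have := H _ (rtest_real_test th).
  by rewrite cpartials_cOf !cint_mul_cOf => -[-> ->].
by split; split => // h th; have [] := E h th.
Qed.

Lemma test_fun_ReIm f : test_fun f -> rtest (cRe f) /\ rtest (cIm f).
Proof.
move=> [[s1 s2] [r fr]]; split; split => //; exists r => x i xi;
  by rewrite /cRe /cIm fr// (lt_le_trans xi)// coord_le_enorm.
Qed.

Lemma rweak_weak_partial j f g : rweak j (cRe f) (cRe g) -> rweak j (cIm f) (cIm g) ->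
  weak_partial j f g.
Proof.
move=> [l1 l2 H1] [l3 l4 H2]; split; [exact: locally_integrable_of..|].
move=> psi /test_fun_ReIm[t1 t2].
have p1 := rtest_partial j t1; have p2 := rtest_partial j t2.
have I h k : locint h -> rtest k -> intg (fun x => h x * k x) by exact: locint_mul_rtest.
rewrite /cint; set A := (\int[mu]_x _)%R; set B := (\int[mu]_x _)%R.
set A' := (\int[mu]_x _)%R; set B' := (\int[mu]_x _)%R.
suff [-> ->] : A = - A' /\ B = - B' by [].
have EA : A = \int[mu]_x (cRe f x * partial j (cRe psi) x) - \int[mu]_x (cIm f x * partial j (cIm psi) x).
  by rewrite -(intB (I _ _ l1 p1) (I _ _ l3 p2)); apply: eq_int => x; rewrite [LHS]Re_mul.
have EB : B = \int[mu]_x (cRe f x * partial j (cIm psi) x) + \int[mu]_x (cIm f x * partial j (cRe psi) x).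
  by rewrite -(intD (I _ _ l1 p2) (I _ _ l3 p1)); apply: eq_int => x; rewrite [LHS]Im_mul.
have EA' : A' = \int[mu]_x (cRe g x * cRe psi x) - \int[mu]_x (cIm g x * cIm psi x).
  by rewrite -(intB (I _ _ l2 t1) (I _ _ l4 t2)); apply: eq_int => x; rewrite [LHS]Re_mul.
have EB' : B' = \int[mu]_x (cRe g x * cIm psi x) + \int[mu]_x (cIm g x * cRe psi x).
  by rewrite -(intD (I _ _ l2 t2) (I _ _ l4 t1)); apply: eq_int => x; rewrite [LHS]Im_mul.
by rewrite EA EB EA' EB' (H1 _ t1) (H1 _ t2) (H2 _ t1) (H2 _ t2) !opprD.
Qed.

Section H1norm.
Variable rho : nat -> E -> R.
Hypothesis Hrho : mollifier rho.

Lemma ae_L2 h k : meas k -> {ae mu, forall x, h x = k x} -> L2 h ->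
  L2 k /\ \int[mu]_x (k x ^+ 2) = \int[mu]_x (h x ^+ 2).
Proof.
move=> mk hk [mh Ih]; have hk2 : {ae mu, forall x, h x ^+ 2 = k x ^+ 2}.
  by apply: filterS hk => x ->.
split; first by split => //; exact: ae_intg (meas_sqr mk) hk2 Ih.
by apply: ae_eq_int; [exact: meas_sqr|exact: meas_sqr|apply: filterS hk2 => x ->].
Qed.

(* wD is a choice of representative; the uniqueness of weak derivatives
   identifies its norm. *)
Lemma wD_L2 j f p q : L2 p -> L2 q -> rweak j (cRe f) p -> rweak j (cIm f) q ->
  cLnorm 2%:E (wD j f) = (Num.sqrt (\int[mu]_x (p x ^+ 2) + \int[mu]_x (q x ^+ 2)))%:E.
Proof.
move=> Lp Lq w1 w2.
have wg : weak_partial j f (fun x => (p x +i* q x)%C) by exact: rweak_weak_partial.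
have wD1 : weak_partial j f (wD j f).
  have : [set g | weak_partial j f g] (wD j f) by apply: xgetPex; exists (fun x => (p x +i* q x)%C).
  by [].
have [w1' w2'] := weak_partial_rweak wD1.
have [_ [m1 _] _] := w1'; have [_ [m2 _] _] := w2'.
have a1 := rweak_unique Hrho w1 w1'; have a2 := rweak_unique Hrho w2 w2'.
have [L1 <-] := ae_L2 m1 a1 Lp; have [L2' <-] := ae_L2 m2 a2 Lq.
exact: cLnorm2E.
Qed.

Lemma H1normE f P Q : L2 (cRe f) -> L2 (cIm f) -> (forall j, L2 (P j)) -> (forall j, L2 (Q j)) ->
  (forall j, rweak j (cRe f) (P j)) -> (forall j, rweak j (cIm f) (Q j)) ->
  H1norm f = (Num.sqrt (sqH1 (cRe f) P + sqH1 (cIm f) Q))%:E.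
Proof.
move=> L1 L2' LP LQ wP wQ; rewrite /H1norm cLnorm2E//.
have S h k : 0 <= \int[mu]_x (h x ^+ 2) + \int[mu]_x (k x ^+ 2).
  by rewrite addr_ge0//; apply: int_ge0 => x; exact: sqr_ge0.
have sq (a : R) : 0 <= a -> (((Num.sqrt a)%:E : \bar R) `^ 2 = a%:E)%E.
  by move=> a0; rewrite poweR_EFin powR_mulrn ?sqrtr_ge0// sqr_sqrtr.
rewrite sq ?sqL2_ge0//.
under eq_bigr => j _ do rewrite (wD_L2 (LP j) (LQ j) (wP j) (wQ j)) sq//.
rewrite sumEFin -EFinD poweR12_sqrt.
  congr (Num.sqrt _)%:E; rewrite /sqL2 /sqH1 big_split/=; ring.
by rewrite lee_fin addr_ge0 ?sqL2_ge0//; apply: sumr_ge0.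
Qed.

Lemma H1norm_cOf h : rtest h -> H1norm (cOf h) = (Num.sqrt (sqH1t h))%:E.
Proof.
move=> th; have L0 : L2 (fun x : E => 0 : R).
  split; first exact: measurable_cst.
  by rewrite (_ : (fun x : E => _) = fun=> 0); [exact: intg0|apply/funext => x; rewrite expr0n].
have Lt k : rtest k -> L2 k.
  move=> tk; have [sk _] := tk; split; first exact: smooth_meas.
  have := rtest_intg (rtestM_smooth sk tk); congr (rintegrable _ _); apply/funext => x; rewrite expr2//.
have r0 : rtest (fun x : E => 0 : R) by split; [exact: smooth_cst|exists 0].
have p0 j : partial j (fun x : E => 0 : R) = fun=> 0 := partials0 [:: j].
rewrite (@H1normE _ (fun j => partial j h) (fun j x => 0)) ?cRe_cOf ?cIm_cOf//.
- rewrite -/(sqH1t h); congr (Num.sqrt _)%:E; rewrite [X in _ + X](_ : _ = 0) ?addr0//.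
  have i0 : \int[mu]_x ((0 : R) ^+ 2) = 0.
    by rewrite -[RHS](int0 mu); apply: eq_int => x; rewrite expr0n.
  by rewrite /sqH1 i0 big1// addr0.
- exact: Lt.
- by move=> j; apply: Lt; exact: rtest_partial.
- by move=> j; exact: rweak_rtest.
- by move=> j; have := rweak_rtest j r0; rewrite p0.
Qed.

(** The dual norm is a supremum over the unit ball of H^1, so h is rescaled by 1 / d. The case d = 0
    is reached by letting a positive bound tend to 0. *)
Lemma Hm1norm_bound (T : (E -> C) -> C) (m : R) : (Hm1norm T <= m%:E)%E -> 0 <= m ->
  (forall (a : R) h, rtest h -> T (cOf (fun x => a * h x)) = a%:C%C * T (cOf h)) ->
  forall h (d : R), rtest h -> 0 <= d -> sqH1t h <= d ^+ 2 -> normc (T (cOf h)) <= m * d.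
Proof.
move=> Tm m0 TZ h.
have pos (d : R) : rtest h -> 0 < d -> sqH1t h <= d ^+ 2 -> normc (T (cOf h)) <= m * d.
  move=> th d0 hd.
  have tz := rtestZ d^-1 th.
  have [sh _] := th.
  have nz : sqH1t (fun x => d^-1 * h x) = d^-1 ^+ 2 * sqH1t h.
    rewrite /sqH1t /sqH1 mulrDr mulr_sumr.
    have Lt k : rtest k -> intg (fun x => k x ^+ 2).
      move=> tk; have [sk _] := tk.
      have := rtest_intg (rtestM_smooth sk tk); congr (rintegrable _ _); apply/funext => x; rewrite expr2//.
    congr (_ + _).
      by rewrite -(intZ _ (Lt _ th)); apply: eq_int => x; rewrite exprMn.
    apply: eq_bigr => j _; rewrite -(intZ _ (Lt _ (rtest_partial j th))) partialZ//.
    by apply: eq_int => x; rewrite exprMn.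
  have H1 : (H1norm (cOf (fun x => (d^-1 * h x)%R)) <= 1)%E.
    rewrite H1norm_cOf// lee_fin -[leRHS]sqrtr1 ler_wsqrtr// nz exprVn mulrC ler_pdivrMr ?exprn_gt0//.
    by rewrite mul1r.
  have : ((normc (T (cOf (fun x => (d^-1 * h x)%R))))%:E <= m%:E)%E.
    apply: le_trans Tm; apply: ereal_sup_ubound.
    exists (cOf (fun x => d^-1 * h x)); last by [].
    by split; [exact: rtest_real_test|exact: H1].
  rewrite lee_fin TZ// Normc.normcM /= expr0n addr0 sqrtr_sqr ger0_norm ?invr_ge0 ?(ltW d0)//.
  by rewrite mulrC ler_pdivrMr.
move=> d th d0 hd; have [/pos H|d_le0] := ltP 0 d; first exact: H.
have d00 : d = 0 by apply/eqP; rewrite eq_le d_le0 d0.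
rewrite d00 mulr0; apply/ler_addgt0Pr => e e0; rewrite add0r.
have [c c0 Hc] := small_factor m0 e0; apply: le_trans Hc; apply: pos => //.
by apply: (le_trans hd); rewrite d00 expr0n sqr_ge0.
Qed.

End H1norm.

End complex_weak.

(** * Boundedness and gradient of the reference function *)

Section reference_data.
Context {R : realType} {N : nat}.
Local Notation E := 'rV[R]_N.
Local Notation C := R[i].
Local Notation mu := (leb N : {measure set E -> \bar R}).
Local Notation intg := (rintegrable mu).
Local Notation normc := (@Normc.normc R).
Implicit Types (f : E -> C) (g h : E -> R) (x : E) (j : 'I_N).
Local Opaque smooth Rintegral integrable.

(** Young's inequality gives |h| / l <= e l^-2 + e^-1 h^2, and l^-2 <= l^-N for N <= 2 and l >=
    1. *)
Lemma tame_L2 h : (N <= 2)%N -> L2 h -> tame h.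
Proof.
move=> N2 [mh Ih] e e0; exists (fun x => e^-1 * h x ^+ 2); split.
- exact: intgZ.
- by move=> x; rewrite mulr_ge0 ?sqr_ge0// invr_ge0 ltW.
- move=> l x l1; have l0 : 0 < l by exact: lt_le_trans l1.
  have := young2 l^-1 (h x) e0; rewrite normrM gtr0_norm ?invr_gt0// (mulrC l^-1) => H.
  apply: (le_trans H); rewrite lerD2r ler_wpM2l ?(ltW e0)// exprVn.
  by rewrite lef_pV2 ?posrE ?exprn_gt0// ler_weXn2l.
Qed.

Lemma powR_mono (a b c : R) : 0 <= a -> 0 <= b -> b <= c -> b `^ a <= c `^ a.
Proof. by move=> a0 b0 bc; apply: ge0_ler_powR; rewrite // nnegrE (le_trans b0). Qed.

(** If b <= e l^-n, the first term suffices. Otherwise 1 / l is less than (b / e)^(1/n), and the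
    second term does. With N = n + 1 the exponent 1 + 1/n is N / (N - 1). *)
Lemma powR_young (n : nat) (e l b : R) : (0 < n)%N -> 0 < e -> 1 <= l -> 0 <= b ->
  b / l <= e * l ^- n.+1 + (e^-1) `^ n%:R^-1 * b `^ (1 + n%:R^-1).
Proof.
move=> n0 e0 l1 b0; have l0 : 0 < l by exact: lt_le_trans l1.
have n0' : (0 : R) < n%:R by rewrite ltr0n.
have [H|H] := leP b (e * l ^- n).
  apply: (@le_trans _ _ (e * l ^- n.+1)); last by rewrite lerDl mulr_ge0// powR_ge0.
  by rewrite exprSr invfM mulrA ler_wpM2r// invr_ge0 ltW.
apply: (@le_trans _ _ ((e^-1) `^ n%:R^-1 * b `^ (1 + n%:R^-1))); last first.
  by rewrite lerDr mulr_ge0 ?(ltW e0)// invr_ge0 exprn_ge0// ltW.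
have bp : 0 < b by apply: le_lt_trans H; rewrite mulr_ge0 ?(ltW e0)// invr_ge0 exprn_ge0// ltW.
rewrite powRD; last by rewrite gt_eqF ?implybT.
rewrite powRr1// mulrCA ler_wpM2l// -powRM ?invr_ge0 ?(ltW e0)//.
have lE : l^-1 = (l ^- n) `^ n%:R^-1.
  rewrite -exprVn -powR_mulrn ?invr_ge0 ?(ltW l0)// -powRrM divff ?gt_eqF// powRr1// invr_ge0 ltW//.
rewrite lE; apply: powR_mono.
- by rewrite invr_ge0 ltW.
- by rewrite invr_ge0 exprn_ge0// ltW.
- by rewrite mulrC ler_pdivlMr// mulrC ltW.
Qed.

Lemma cLnorm_powR f (p : R) : 0 < p -> cmeasurable f -> (cLnorm p%:E f < +oo)%E ->
  intg (fun x => normc (f x) `^ p).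
Proof.
move=> p0 mf ff; apply/integrableP; split.
  apply/measurable_EFinP; apply: (measurableT_comp (@measurable_powR R p)).
  exact: normc_meas.
rewrite (_ : (\int[mu]_x _)%E = (cLnorm p%:E f `^ p)%E); first exact: poweR_lty.
rewrite /cLnorm poweR_Lnorm ?gt_eqF//; apply: eq_integral => x _ /=.
by rewrite ger0_norm ?powR_ge0// ger0_norm ?normcR_ge0// poweR_EFin.
Qed.

Lemma tame_Lp h k : (2 <= N)%N -> meas h -> {ae mu, forall x, k x = h x} -> meas k ->
  intg (fun x => `|k x| `^ (N%:R / (N%:R - 1))) -> tame h.
Proof.
move=> N2 mh kh mk Ik e e0; pose n := N.-1.
have n0 : (0 < n)%N by rewrite /n; case: (N) N2 => [//|[]].
have NE : N = n.+1 by rewrite /n prednK//; exact: leq_trans N2.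
have pE : N%:R / (N%:R - 1) = 1 + n%:R^-1 :> R.
  have n0' : (0 : R) < n%:R by rewrite ltr0n.
  by rewrite NE -natr1 addrK mulrDl divff ?gt_eqF// mul1r.
have mp g : meas g -> meas (fun x => `|g x| `^ (1 + n%:R^-1)).
  by move=> mg; apply: (measurableT_comp (@measurable_powR R _)); exact: measurableT_comp.
have Ih : intg (fun x => `|h x| `^ (1 + n%:R^-1)).
  rewrite pE in Ik; apply: (ae_intg (mp _ mh) _ Ik).
  by apply: filterS kh => x ->.
exists (fun x => (e^-1) `^ n%:R^-1 * `|h x| `^ (1 + n%:R^-1)); split.
- exact: intgZ.
- by move=> x; rewrite mulr_ge0 ?powR_ge0.
- by move=> l x l1; rewrite {1}NE; exact: powR_young.
Qed.

(** At exponent +oo, [Lnorm] is the essential supremum provided that the whole space has positive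
    measure. *)
Lemma leb_setT_gt0 : (0 < leb N [set: E])%E.
Proof.
apply: (@lt_le_trans _ _ (leb N (cube 1 : set E))).
  by rewrite leb_cube// lte_fin exprn_gt0// mulr_gt0.
by apply: le_measure; rewrite ?inE//; exact: measurable_cube.
Qed.

Lemma cLnorm_pinfty_ae f : (cLnorm +oo%E f < +oo)%E ->
  exists2 M, 0 <= M & {ae mu, forall x, normc (f x) <= M}.
Proof.
rewrite /cLnorm unlock leb_setT_gt0 => H.
have [M HM] : exists M : R, (ess_sup mu (abse \o (fun x => (normc (f x))%:E)) <= M%:E)%E.
  move: H; case: (ess_sup _ _) => [r|//|]; first by exists r.
  by exists 0; rewrite leNye.
exists `|M|; first exact: normr_ge0.
move/ess_supP : HM; apply: filterS => x /=.
by rewrite lee_fin ger0_norm ?normcR_ge0// => h; exact: le_trans h (ler_norm M).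
Qed.

Variable rho : nat -> E -> R.
Hypothesis Hrho : mollifier rho.

Record reference_gradient (phi : E -> C) (A B : 'I_N -> E -> R) (M : R) : Prop := {
  rg_measRe : meas (cRe phi); rg_measIm : meas (cIm phi);
  rg_L2A : forall j, L2 (A j); rg_L2B : forall j, L2 (B j);
  rg_weakA : forall j, rweak j (cRe phi) (A j); rg_weakB : forall j, rweak j (cIm phi) (B j);
  rg_tameA : forall j, tame (A j); rg_tameB : forall j, tame (B j);
  rg_M0 : 0 <= M; rg_bound : {ae mu, forall x, normc (phi x) <= M} }.

(** Two representatives of the gradient occur: one in L^2 from the definition of a reference
    function and, for N = 3 or 4, one in L^{N/(N-1)} from the extra assumption. Uniqueness of weak
    derivatives identifies them almost everywhere, so a single gradient has both properties. *)
Lemma reference_gradientP (phi : E -> C) : (1 <= N <= 4)%N -> reference_function phi ->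
  ((3 <= N <= 4)%N -> grad_in_Lp (N%:R / (N%:R - 1))%:E phi) ->
  exists A B M, reference_gradient phi A B M.
Proof.
move=> /andP[_ N4] [[[mphi fphi] _] _ [c [r [_ grad]]]] gradp.
have [M M0 HM] := cLnorm_pinfty_ae fphi.
have [g Hg] := choice grad.
have wg j : weak_partial j phi (g j) by have [] := Hg j.
have Lg j : L2 (cRe (g j)) /\ L2 (cIm (g j)).
  by have [_ [[mg fg] _] _ _] := Hg j; exact: cLnorm2_fin.
have wr j := weak_partial_rweak (wg j).
have tg j : tame (cRe (g j)) /\ tame (cIm (g j)).
  have [N2|N3] := leqP N 2; first by split; apply: tame_L2; have [] := Lg j.
  have p0 : (0 : R) < N%:R / (N%:R - 1).
    by rewrite divr_gt0 ?ltr0n ?(ltn_trans _ N3)// subr_gt0 ltr1n (ltn_trans _ N3).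
  have [k [wk [mk fk]]] := gradp (introT andP (conj N3 N4)) j.
  have Ik := cLnorm_powR p0 mk fk; have [mk1 mk2] := mk.
  have [w1 w2] := weak_partial_rweak wk; have [w1' w2'] := wr j.
  have [[m1 _] [m2 _]] := Lg j.
  have mp h : meas h -> meas (fun x => `|h x| `^ (N%:R / (N%:R - 1))).
    by move=> mh; apply: (measurableT_comp (@measurable_powR R _)); exact: measurableT_comp.
  have N2 : (2 <= N)%N by exact: ltnW.
  split.
    apply: (tame_Lp N2 m1 (rweak_unique Hrho w1 w1') mk1).
    apply: (le_intg (mp _ mk1) _ Ik) => x; rewrite ger0_norm ?powR_ge0//.
    by apply: powR_mono (ltW p0) _ _; rewrite ?Re_le_normc.
  apply: (tame_Lp N2 m2 (rweak_unique Hrho w2 w2') mk2).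
  apply: (le_intg (mp _ mk2) _ Ik) => x; rewrite ger0_norm ?powR_ge0//.
  by apply: powR_mono (ltW p0) _ _; rewrite ?Im_le_normc.
have [mr mi] := mphi.
exists (fun j => cRe (g j)), (fun j => cIm (g j)), M; split => //.
- by move=> j; have [] := Lg j.
- by move=> j; have [] := Lg j.
- by move=> j; have [] := wr j.
- by move=> j; have [] := wr j.
- by move=> j; have [] := tg j.
- by move=> j; have [] := tg j.
Qed.

End reference_data.

(** * Conservation of the generalized mass *)

Section evolution.
Context {R : realType} {N : nat}.
Local Notation E := 'rV[R]_N.
Local Notation C := R[i].
Local Notation mu := (leb N : {measure set E -> \bar R}).
Local Notation intg := (rintegrable mu).
Local Notation normc := (@Normc.normc R).
Implicit Types (f : E -> C) (g psi : E -> R) (x : E) (j : 'I_N) (s t : R).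
Local Opaque smooth Rintegral integrable.

Variable rho : nat -> E -> R.
Hypothesis Hrho : mollifier rho.

Record H1_path (p q : R -> E -> R) (P Q : R -> 'I_N -> E -> R) : Prop := {
  hp_Lp : forall t, L2 (p t); hp_Lq : forall t, L2 (q t);
  hp_LP : forall t j, L2 (P t j); hp_LQ : forall t j, L2 (Q t j);
  hp_wP : forall t j, rweak j (p t) (P t j); hp_wQ : forall t j, rweak j (q t) (Q t j);
  hp_cont : forall t,
    (fun s => sqH1 (fun x => p s x - p t x) (fun j x => P s j x - P t j x) +
              sqH1 (fun x => q s x - q t x) (fun j x => Q s j x - Q t j x)) @ t --> (0 : R) }.

Lemma H1_continuous_path (w : R -> E -> C) : H1_continuous w ->
  exists P Q, H1_path (fun t => cRe (w t)) (fun t => cIm (w t)) P Q.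
Proof.
move=> Hw.
have Hg (tj : R * 'I_N) : exists g : E -> C, weak_partial tj.2 (w tj.1) g /\ Lp 2%:E g.
  by case: tj => t j; have [[_ H] _] := Hw t; exact: H j.
have [g gP] := choice Hg.
have Lw t : L2 (cRe (w t)) /\ L2 (cIm (w t)).
  by have [[[mw fw] _] _] := Hw t; exact: cLnorm2_fin.
have Lg t j : L2 (cRe (g (t, j))) /\ L2 (cIm (g (t, j))).
  by have [_ [mg fg]] := gP (t, j); exact: cLnorm2_fin.
have wg t j := weak_partial_rweak (proj1 (gP (t, j))).
exists (fun t j => cRe (g (t, j))), (fun t j => cIm (g (t, j))); split.
- by move=> t; have [] := Lw t.
- by move=> t; have [] := Lw t.
- by move=> t j; have [] := Lg t j.
- by move=> t j; have [] := Lg t j.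
- by move=> t j; have [] := wg t j.
- by move=> t j; have [] := wg t j.
move=> t; have [_] := Hw t.
set S := fun s : R => _ + _.
have S0 s : 0 <= S s by rewrite addr_ge0// sqH1_ge0.
have HE s : H1norm (fun x => w s x - w t x) = (Num.sqrt (S s))%:E.
  have dR : cRe (fun x => w s x - w t x) = fun x => cRe (w s) x - cRe (w t) x.
    by apply/funext => x; exact: Re_sub.
  have dI : cIm (fun x => w s x - w t x) = fun x => cIm (w s) x - cIm (w t) x.
    by apply/funext => x; exact: Im_sub.
  have [a1 a2] := Lw s; have [b1 b2] := Lw t.
  rewrite (@H1normE _ _ _ Hrho _ (fun j x => cRe (g (s, j)) x - cRe (g (t, j)) x)
    (fun j x => cIm (g (s, j)) x - cIm (g (t, j)) x)) ?dR ?dI//.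
  - exact: L2B.
  - exact: L2B.
  - by move=> j; have [c1 _] := Lg s j; have [c2 _] := Lg t j; exact: L2B.
  - by move=> j; have [_ c1] := Lg s j; have [_ c2] := Lg t j; exact: L2B.
  - by move=> j; have [c1 _] := wg s j; have [c2 _] := wg t j; exact: rweakB.
  - by move=> j; have [_ c1] := wg s j; have [_ c2] := wg t j; exact: rweakB.
rewrite (_ : (fun s => _) = fun s => (Num.sqrt (S s))%:E); last by apply/funext => s; exact: HE.
move=> /fine_cvg H.
have -> : S = fun s => Num.sqrt (S s) * Num.sqrt (S s).
  by apply/funext => s; rewrite -expr2 sqr_sqrtr.
rewrite -(mul0r (0 : R)); exact: (cvgM H H).
Qed.

(** * Differentiating the localised mass along a solution *)

Section derivative.
Variables (W : (E -> C) -> C) (K : R) (chi : R -> R) (phi : E -> C) (u : R -> E -> C).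
Hypotheses (hchi : cutoff K chi) (rW : real_distr W) (mW : multiplier 2 2 W).
Variable v : R -> (E -> C) -> C.
Local Notation w t := (fun x => u t x - phi x).
Hypothesis Hv : Hm1_C1 (fun t => w t) v.
Hypothesis eqn : forall t, exists V : E -> C,
          conv_ext 2 2 W (fun x => (1 - normc (u t x) ^+ 2)%:C%C) V /\
          forall psi : E -> C, test_fun psi ->
            'i%C * v t psi + cint (fun x => u t x * claplacian psi x)
            + cint (fun x => u t x * V x * psi x) = 0.
Variables (A B : 'I_N -> E -> R) (M : R).
Hypothesis Hphi : reference_gradient phi A B M.
Variables (P Q : R -> 'I_N -> E -> R).
Hypothesis HP : H1_path (fun t => cRe (w t)) (fun t => cIm (w t)) P Q.

Let al t := cRe (u t).
Let be t := cIm (u t).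

Lemma re_split t : al t = fun x => cRe phi x + cRe (w t) x.
Proof. by apply/funext => x; rewrite /cRe Re_sub addrC subrK. Qed.

Lemma im_split t : be t = fun x => cIm phi x + cIm (w t) x.
Proof. by apply/funext => x; rewrite /cIm Im_sub addrC subrK. Qed.

Let ae_L2loc g : meas g -> {ae mu, forall x, `|g x| <= M} -> L2loc g.
Proof.
move=> mg gM; split => //; split; first exact: meas_sqr.
move=> c; apply: (@ae_le_intg _ _ _ mu _ (fun x => M ^+ 2 * \1_(cube c) x)).
- by apply: measurable_funM; [exact: meas_sqr|apply: measurable_indic; exact: measurable_cube].
- apply: filterS gM => x gx; rewrite normrM !indicE normr_nat ler_wpM2r// normrX.
  by rewrite lerXn2r// nnegrE// (le_trans _ gx).
- by apply: intgZ; exact: intg_indic_cube.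
Qed.

Lemma L2loc_solution t : L2loc (al t) /\ L2loc (be t).
Proof.
have aM := rg_bound Hphi.
rewrite re_split im_split; split; apply: L2locD.
- apply: (ae_L2loc (rg_measRe Hphi)).
  by apply: filterS aM => x; exact: le_trans (Re_le_normc _).
- exact: L2_L2loc (hp_Lp HP t).
- apply: (ae_L2loc (rg_measIm Hphi)).
  by apply: filterS aM => x; exact: le_trans (Im_le_normc _).
- exact: L2_L2loc (hp_Lq HP t).
Qed.

Lemma weak_solution t j : rweak j (al t) (fun x => A j x + P t j x) /\
  rweak j (be t) (fun x => B j x + Q t j x).
Proof.
rewrite re_split im_split; split; apply: rweakD.
- exact: rg_weakA Hphi j.
- exact: hp_wP HP t j.
- exact: rg_weakB Hphi j.
- exact: hp_wQ HP t j.
Qed.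

(** From g^2 <= 1 - k follows g^4 <= (1 - k)^2 <= 2 k^2 + 2. Applied to k = 1 - |u|^2, which
    [conv_ext] places in L^2, this gives the local L^4 bound on u. *)
Lemma quartic_locint g h k : meas g -> L2 k -> (forall x, k x = 1 - (g x ^+ 2 + h x ^+ 2)) ->
  locint (fun x => g x ^+ 4).
Proof.
move=> mg [mk Ik] kE; have m4 : meas (fun x => g x ^+ 4).
  by rewrite (_ : (fun x => _) = fun x => (g x ^+ 2) ^+ 2); [exact: meas_sqr (meas_sqr mg)|apply/funext => x; ring].
split => // c.
apply: (@le_intg _ _ _ mu _ (fun x => 2 * k x ^+ 2 + 2 * \1_(cube c) x)).
- by apply: measurable_funM => //; apply: measurable_indic; exact: measurable_cube.
- move=> x; rewrite indicE; case: (x \in cube c); last first.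
    by rewrite mulr0 normr0 mulr0 addr0 mulr_ge0// sqr_ge0.
  rewrite mulr1 mulr1 ger0_norm ?exprn_even_ge0//.
  have := kE x; set a := g x ^+ 2; set b := h x ^+ 2.
  have a0 : 0 <= a by exact: sqr_ge0.
  have b0 : 0 <= b by exact: sqr_ge0.
  have -> : g x ^+ 4 = a ^+ 2 by rewrite /a; ring.
  move=> ->; apply: (@le_trans _ _ ((a + b) ^+ 2)).
    by rewrite lerXn2r ?nnegrE ?addr_ge0// lerDl.
  have := sqr_ge0 ((a + b) - 2); rewrite -subr_ge0 => H.
  rewrite -subr_ge0 (_ : _ - _ = (a + b - 2) ^+ 2 - 0); last by ring.
  by [].
- exact: intgD (intgZ 2 Ik) (intgZ 2 (@intg_indic_cube R N c)).
Qed.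

Definition mass a l t := \int[mu]_x ((al t x ^+ 2 + be t x ^+ 2) * chi (enorm (x - a) / l)).

Definition mass_flux a l t := flux (fun x => chi (enorm (x - a) / l)) (al t) (be t)
  (fun j x => A j x + P t j x) (fun j x => B j x + Q t j x).

Lemma linear_on_tests (T : (E -> C) -> C) :
  (forall (a : C) (psi1 psi2 : E -> C), test_fun psi1 -> test_fun psi2 ->
     T (fun x => a * psi1 x + psi2 x) = a * T psi1 + T psi2) ->
  (forall (a : R) h, rtest h -> T (cOf (fun x => a * h x)) = a%:C%C * T (cOf h)) /\
  (forall g h, rtest g -> rtest h -> T (cOf (fun x => g x - h x)) = T (cOf g) - T (cOf h)).
Proof.
move=> lin.
have r0 : rtest (fun x : E => 0 : R) by split; [exact: smooth_cst|exists 0].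
have t0 := rtest_real_test r0.
have T0 : T (cOf (fun=> 0)) = 0.
  have := lin 1 _ _ t0 t0; rewrite mul1r.
  rewrite (_ : (fun x : E => _) = cOf (fun=> 0)); last first.
    by apply/funext => x; rewrite mul1r /cOf -rmorphD addr0.
  by move/(congr1 (fun z => z - T (cOf (fun=> 0)))); rewrite subrr addrK.
split => [a h|g h] th.
  have := lin a%:C%C _ _ (rtest_real_test th) t0; rewrite T0 addr0 => <-.
  by congr T; apply/funext => x; rewrite /cOf -rmorphM -rmorphD addr0.
move=> th'; have := lin (-1) _ _ (rtest_real_test th') (rtest_real_test th).
rewrite mulN1r addrC => <-.
by congr T; apply/funext => x; rewrite mulN1r /cOf rmorphB addrC.
Qed.

Lemma claplacian_cOf psi : claplacian (cOf psi) = cOf (lap psi).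
Proof.
apply/funext => x; rewrite /claplacian.
under eq_bigr do rewrite cpartials_cOf.
by rewrite /cOf -rmorph_sum.
Qed.

(** Multiplying the equation by -i gives v = i (Laplacian of u + u V), read on real tests. The
    imaginary part of V vanishes almost everywhere, so V is replaced by its real part. *)
Lemma velocity_eq t : exists V : E -> R, [/\ L2 V,
  forall psi, rtest psi -> complex.Re (v t (cOf psi)) =
     - (\int[mu]_x (be t x * lap psi x)) - \int[mu]_x ((be t x * V x) * psi x) &
  forall psi, rtest psi -> complex.Im (v t (cOf psi)) =
     \int[mu]_x (al t x * lap psi x) + \int[mu]_x ((al t x * V x) * psi x)].
Proof.
have [V [cV HV]] := eqn t.
have f0 x : complex.Im ((1 - normc (u t x) ^+ 2)%:C%C : C) = 0 by [].
have V0 := conv_ext_real hchi mW rW f0 cV.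
have [_ [mV fV] _] := cV; have [LV _] := cLnorm2_fin mV fV; have [mVr mVi] := mV.
have [[mal _] [mbe _]] := L2loc_solution t.
have E0 psi : rtest psi -> complex.Im (v t (cOf psi)) =
     \int[mu]_x (al t x * lap psi x) + \int[mu]_x ((al t x * cRe V x) * psi x) /\
     complex.Re (v t (cOf psi)) =
     - (\int[mu]_x (be t x * lap psi x) + \int[mu]_x ((be t x * cRe V x) * psi x)).
  move=> tp; have := HV _ (rtest_real_test tp).
  have mp := smooth_meas (proj1 tp).
  rewrite claplacian_cOf (cint_mul_cOf (u t)) (cint_mul_cOf (fun x => u t x * V x)).
  have -> : \int[mu]_x (cRe (fun x => u t x * V x) x * psi x) =
      \int[mu]_x ((al t x * cRe V x) * psi x).
    apply: ae_eq_int.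
    - apply: measurable_funM => //.
      rewrite (_ : cRe _ = fun x => al t x * cRe V x - be t x * cIm V x).
        by apply: measurable_funB; apply: measurable_funM.
      by apply/funext => x; exact: Re_mul.
    - by apply: measurable_funM => //; exact: measurable_funM.
    - apply: filterS V0 => x Vx; rewrite {1}/cRe Re_mul -/(cIm V x) Vx mulr0 subr0//.
  have -> : \int[mu]_x (cIm (fun x => u t x * V x) x * psi x) =
      \int[mu]_x ((be t x * cRe V x) * psi x).
    apply: ae_eq_int.
    - apply: measurable_funM => //.
      rewrite (_ : cIm _ = fun x => al t x * cIm V x + be t x * cRe V x).
        by apply: measurable_funD; apply: measurable_funM.
      by apply/funext => x; exact: Im_mul.
    - by apply: measurable_funM => //; exact: measurable_funM.
    - apply: filterS V0 => x Vx; rewrite {1}/cIm Im_mul -/(cIm V x) Vx mulr0 add0r//.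
  move: (\int[mu]_x (cRe _ _ * lap _ _)) (\int[mu]_x (cIm _ _ * lap _ _)) => a b.
  move: (\int[mu]_x _) (\int[mu]_x _) => c d.
  case: (v t (cOf psi)) => r i /eqP; rewrite eq_complex /= => /andP[/eqP H1 /eqP H2].
  by split; lra.
exists (cRe V); split => // psi tp; have [H1 H2] := E0 psi tp => //.
by rewrite H2 opprD.
Qed.

Lemma le_abs_fine (z : \bar R) : (z < +oo)%E -> (z <= `|fine z|%:E)%E.
Proof. by case: z => [r|//|] _; rewrite ?leNye// lee_fin ler_norm. Qed.

Lemma cvg_shift0 t : (fun h : R => t + h) @ 0^' --> t.
Proof.
rewrite -{2}[t]addr0; apply: cvgD; first exact: cvg_cst.
exact: cvg_within.
Qed.

Lemma quartic_solution t : locint (fun x => al t x ^+ 4) /\ locint (fun x => be t x ^+ 4).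
Proof.
have [V [[[mf ff] _ _] _]] := eqn t.
have [L1 _] := cLnorm2_fin mf ff.
have [[mal _] [mbe _]] := L2loc_solution t.
split.
  apply: (@quartic_locint (al t) (be t) _ mal L1) => x.
  by rewrite /cRe /= sqr_normcE.
apply: (@quartic_locint (be t) (al t) _ mbe L1) => x.
by rewrite /cRe /= sqr_normcE (addrC (be t x ^+ 2)).
Qed.

(** The data of [mass_derivative] are read off from the solution: smallness of increments from
    continuity in H^1, the error of the quotient from differentiability in H^{-1}, the velocity from
    the equation. *)
Lemma mass_is_derive a l t : 0 < l -> is_derive t (1 : R) (mass a l) (mass_flux a l t).
Proof.
move=> l0; have te := radial_cutoff_rtest a hchi l0; have [_ [c sc]] := te.
have [V [LV HR HI]] := velocity_eq t.
have [[linv finv] _ quot] := Hv t.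
have [vZ vB] := linear_on_tests linv.
have [Lal Lbe] := L2loc_solution t.
have [al4 be4] := quartic_solution t.
pose Al j x := A j x + P t j x; pose Be j x := B j x + Q t j x.
have LAl j : L2 (Al j) := L2D (rg_L2A Hphi j) (hp_LP HP t j).
have LBe j : L2 (Be j) := L2D (rg_L2B Hphi j) (hp_LQ HP t j).
have wal j : rweak j (al t) (Al j) := proj1 (weak_solution t j).
have wbe j : rweak j (be t) (Be j) := proj2 (weak_solution t j).
pose da h x := cRe (w (t + h)) x - cRe (w t) x.
pose db h x := cIm (w (t + h)) x - cIm (w t) x.
pose dA h j x := P (t + h) j x - P t j x.
pose dB h j x := Q (t + h) j x - Q t j x.
have Lda h : L2 (da h) := L2B (hp_Lp HP (t + h)) (hp_Lp HP t).
have Ldb h : L2 (db h) := L2B (hp_Lq HP (t + h)) (hp_Lq HP t).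
have LdA h j : L2 (dA h j) := L2B (hp_LP HP (t + h) j) (hp_LP HP t j).
have LdB h j : L2 (dB h j) := L2B (hp_LQ HP (t + h) j) (hp_LQ HP t j).
have wda h j : rweak j (da h) (dA h j) := rweakB (hp_wP HP (t + h) j) (hp_wP HP t j).
have wdb h j : rweak j (db h) (dB h j) := rweakB (hp_wQ HP (t + h) j) (hp_wQ HP t j).
have en0 := cvg_comp _ _ (@cvg_shift0 t) (hp_cont HP t).
pose vR psi := complex.Re (v t (cOf psi)); pose vI psi := complex.Im (v t (cOf psi)).
pose Cv := `|fine (Hm1norm (v t))|.
pose Th (h : R) : (E -> C) -> C := fun f =>
  (h^-1)%:C%C * (distr_of (w (t + h)) f - distr_of (w t) f) - v t f.
pose eps h := `|fine (Hm1norm (Th h))|.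
have eps0 : eps h @[h --> 0^'] --> 0.
  have H : (fun h : R => fine (Hm1norm (Th h))) @ 0^' --> (0 : R) by exact: (fine_cvg quot).
  by have := cvg_norm H; rewrite normr0; apply.
have vb psi (d : R) : rtest psi -> 0 <= d -> sqH1t psi <= d ^+ 2 -> normc (v t (cOf psi)) <= Cv * d.
  exact: (Hm1norm_bound Hrho (le_abs_fine finv) (normr_ge0 _) vZ).
have vRb psi (d : R) : rtest psi -> 0 <= d -> sqH1t psi <= d ^+ 2 -> `|vR psi| <= Cv * d.
  move=> tp d0 pd; exact: le_trans (Re_le_normc _) (vb psi d tp d0 pd).
have vIb psi (d : R) : rtest psi -> 0 <= d -> sqH1t psi <= d ^+ 2 -> `|vI psi| <= Cv * d.
  move=> tp d0 pd; exact: le_trans (Im_le_normc _) (vb psi d tp d0 pd).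
have vRB psi psi' : rtest psi -> rtest psi' -> vR (fun x => psi x - psi' x) = vR psi - vR psi'.
  by move=> tp tp'; rewrite /vR (vB _ _ tp tp') Re_sub.
have vIB psi psi' : rtest psi -> rtest psi' -> vI (fun x => psi x - psi' x) = vI psi - vI psi'.
  by move=> tp tp'; rewrite /vI (vB _ _ tp tp') Im_sub.
have Iw s psi : rtest psi -> intg (fun x => cRe (w s) x * psi x) /\ intg (fun x => cIm (w s) x * psi x).
  move=> tp; split.
    exact: locint_mul_rtest (L2loc_locint (L2_L2loc (hp_Lp HP s))) tp.
  exact: locint_mul_rtest (L2loc_locint (L2_L2loc (hp_Lq HP s))) tp.
have dZ s (b : R) psi : rtest psi -> distr_of (w s) (cOf (fun x => b * psi x)) = b%:C%C * distr_of (w s) (cOf psi).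
  move=> tp; have [I1 I2] := Iw s psi tp.
  rewrite /distr_of !cint_mul_cOf.
  under eq_int do rewrite mulrCA.
  under [X in (_ +i* X)%C]eq_int do rewrite mulrCA.
  rewrite (intZ b I1) (intZ b I2); move: (\int[mu]_x _) (\int[mu]_x _) => y z.
  by apply/eqP; rewrite eq_complex Re_mul Im_mul /=; apply/andP; split; apply/eqP; ring.
have ThZ (h : R) (b : R) psi : rtest psi -> Th h (cOf (fun x => b * psi x)) = b%:C%C * Th h (cOf psi).
  by move=> tp; rewrite /Th (dZ _ _ _ tp) (dZ _ _ _ tp) (vZ _ _ tp); ring.
(* [fine] is faithful on finite values only; for h near 0 the norm of [Th h] is at most 1, hence
   finite and bounded by [eps h]. *)
have Tb : \forall h \near 0^', forall psi (d : R), rtest psi -> 0 <= d -> sqH1t psi <= d ^+ 2 ->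
    normc (Th h (cOf psi)) <= eps h * d.
  apply: filterS (ereal_cvg0_le quot ltr01) => h h1.
  exact: (Hm1norm_bound Hrho (le_abs_fine (le_lt_trans h1 (ltry 1))) (normr_ge0 _) (ThZ h)).
have ThE (h : R) psi : rtest psi ->
    complex.Re (Th h (cOf psi)) = h^-1 * \int[mu]_x (da h x * psi x) - vR psi /\
    complex.Im (Th h (cOf psi)) = h^-1 * \int[mu]_x (db h x * psi x) - vI psi.
  move=> tp; have [I1 I2] := Iw (t + h) psi tp; have [J1 J2] := Iw t psi tp.
  rewrite /Th Re_sub Im_sub -/(vR psi) -/(vI psi) /distr_of !cint_mul_cOf.
  rewrite (@eq_int _ _ _ mu (fun x => da h x * psi x)
    (fun x => cRe (w (t + h)) x * psi x - cRe (w t) x * psi x)); last by move=> x; rewrite /da mulrBl.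
  rewrite (@eq_int _ _ _ mu (fun x => db h x * psi x)
    (fun x => cIm (w (t + h)) x * psi x - cIm (w t) x * psi x)); last by move=> x; rewrite /db mulrBl.
  rewrite (intB I1 J1) (intB I2 J2).
  move: (\int[mu]_x _) (\int[mu]_x _) (\int[mu]_x _) (\int[mu]_x _) => y1 y2 y3 y4.
  by rewrite Re_mul Im_mul /=; split; ring.
have vRe : \forall h \near 0^', forall psi (d : R), rtest psi -> 0 <= d -> sqH1t psi <= d ^+ 2 ->
    `|h^-1 * \int[mu]_x (da h x * psi x) - vR psi| <= eps h * d.
  apply: filterS Tb => h Hh psi d tp d0 pd; have [<- _] := ThE h psi tp.
  exact: le_trans (Re_le_normc _) (Hh psi d tp d0 pd).
have vIe : \forall h \near 0^', forall psi (d : R), rtest psi -> 0 <= d -> sqH1t psi <= d ^+ 2 ->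
    `|h^-1 * \int[mu]_x (db h x * psi x) - vI psi| <= eps h * d.
  apply: filterS Tb => h Hh psi d tp d0 pd; have [_ <-] := ThE h psi tp.
  exact: le_trans (Im_le_normc _) (Hh psi d tp d0 pd).
have main := mass_derivative Hrho te sc Lal Lbe al4 be4 LAl LBe wal wbe LV HR HI
  Lda Ldb LdA LdB wda wdb en0 eps0 vRb vIb vRB vIB vRe vIe.
have mE h : \int[mu]_x (((al t x + da h x) ^+ 2 + (be t x + db h x) ^+ 2) *
    chi (enorm (x - a) / l)) = mass a l (h *: 1 + t).
  rewrite [h *: 1]mulr1 /mass addrC; apply: eq_int => x.
  by rewrite /da /db /al /be /cRe /cIm !Re_sub !Im_sub; congr ((_ ^+ 2 + _ ^+ 2) * _); ring.
have main' : (fun h : R => h^-1 *: (mass a l (h *: 1 + t) - mass a l t)) @ 0^' --> mass_flux a l t.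
  rewrite (_ : (fun h : R => _) = fun h => h^-1 * (\int[mu]_x (((al t x + da h x) ^+ 2 +
    (be t x + db h x) ^+ 2) * chi (enorm (x - a) / l)) - mass a l t)); last first.
    by apply/funext => h; rewrite mE.
  exact: main.
split; first by apply/cvg_ex; exists (mass_flux a l t); exact: main'.
exact: (cvg_lim (@Rhausdorff R) main').
Qed.

Hypothesis N4 : (N <= 4)%N.

(* phi is bounded only almost everywhere. *)
Let clip g x := Num.max (- M) (Num.min M (g x)).

Let clip_bounded g : bounded_by M (clip g).
Proof.
have M0 := rg_M0 Hphi; have MM : - M <= M by rewrite (le_trans _ M0)// oppr_le0.
by move=> x; rewrite ler_norml /clip le_max lexx/= ge_max MM ge_min lexx.
Qed.

Let clip_meas g : meas g -> meas (clip g).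
Proof.
move=> mg; apply: measurable_maxr; first exact: measurable_cst.
by apply: measurable_minr => //; exact: measurable_cst.
Qed.

Let clip_id g x : `|g x| <= M -> clip g x = g x.
Proof.
by rewrite ler_norml => /andP[h1 h2]; rewrite /clip (min_idPr h2) (max_idPr h1).
Qed.

Let flux_meas (eta a1 b1 : E -> R) (A1 B1 : 'I_N -> E -> R) : rtest eta -> meas a1 -> meas b1 ->
  (forall j, meas (A1 j)) -> (forall j, meas (B1 j)) ->
  meas (fun x => \sum_(j < N) 2 * (a1 x * B1 j x - b1 x * A1 j x) * partial j eta x).
Proof.
move=> te ma mb mA mB; apply: measurable_sum => j.
apply: measurable_funM; last exact: (smooth_meas (proj1 (rtest_partial j te))).
apply: measurable_funM; first exact: measurable_cst.
exact: (measurable_funB (measurable_funM ma (mB j)) (measurable_funM mb (mA j))).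
Qed.

(** The neighbourhood is joint in (s, l), the form in which compactness in time can be applied. The
    truncated phi agrees with phi almost everywhere and leaves the flux unchanged. *)
Lemma mass_flux_small a t (e0 : R) : 0 < e0 ->
  \forall s \near t & l \near pinfty_nbhs R, `|mass_flux a l s| <= e0.
Proof.
move=> e0p.
have aM := rg_bound Hphi.
have aeA : {ae mu, forall x, cRe phi x = clip (cRe phi) x}.
  by apply: filterS aM => x h; rewrite clip_id//; exact: le_trans (Re_le_normc _) h.
have aeB : {ae mu, forall x, cIm phi x = clip (cIm phi) x}.
  by apply: filterS aM => x h; rewrite clip_id//; exact: le_trans (Im_le_normc _) h.
have mA := clip_meas (rg_measRe Hphi); have mB := clip_meas (rg_measIm Hphi).
have LA := rg_L2A Hphi; have LB := rg_L2B Hphi.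
have rfl (k : E -> R) : {ae mu, forall x, k x = k x} by exact/nearW.
have wA j : rweak j (clip (cRe phi)) (A j).
  exact: (ae_rweak aeA (rfl (A j)) mA (proj1 (LA j)) (rg_weakA Hphi j)).
have wB j : rweak j (clip (cIm phi)) (B j).
  exact: (ae_rweak aeB (rfl (B j)) mB (proj1 (LB j)) (rg_weakB Hphi j)).
have [d [L [d0 L1 HL]]] := flux_uniform a hchi N4 Hrho (@clip_bounded (cRe phi)) (@clip_bounded (cIm phi))
  mA mB LA LB wA wB (rg_tameA Hphi) (rg_tameB Hphi) (hp_Lp HP t) (hp_Lq HP t)
  (hp_LP HP t) (hp_LQ HP t) e0p.
have near_s : \forall s \near t,
    sqH1 (fun x => cRe (w s) x - cRe (w t) x) (fun j x => P s j x - P t j x) +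
    sqH1 (fun x => cIm (w s) x - cIm (w t) x) (fun j x => Q s j x - Q t j x) <= d.
  apply: filterS ((cvgrPdist_le _ _).1 (hp_cont HP t) _ d0) => s.
  by rewrite sub0r normrN; exact: le_trans (ler_norm _).
exists ([set s | sqH1 (fun x => cRe (w s) x - cRe (w t) x) (fun j x => P s j x - P t j x) +
    sqH1 (fun x => cIm (w s) x - cIm (w t) x) (fun j x => Q s j x - Q t j x) <= d], [set l | L <= l]).
  by split; [exact: near_s|apply: nbhs_pinfty_ge; exact: num_real].
case=> s l /= [sd Ll].
have l0 : 0 < l by exact: lt_le_trans (lt_le_trans ltr01 L1) Ll.
have te := radial_cutoff_rtest a hchi l0.
have s1 : sqH1 (fun x => cRe (w s) x - cRe (w t) x) (fun j x => P s j x - P t j x) <= d.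
  by apply: le_trans sd; rewrite lerDl sqH1_ge0.
have s2 : sqH1 (fun x => cIm (w s) x - cIm (w t) x) (fun j x => Q s j x - Q t j x) <= d.
  by apply: le_trans sd; rewrite lerDr sqH1_ge0.
have := HL l Ll _ _ _ _ (hp_Lp HP s) (hp_Lq HP s) (hp_LP HP s) (hp_LQ HP s)
  (hp_wP HP s) (hp_wQ HP s) s1 s2.
congr (`|_| <= _); rewrite /mass_flux /flux.
have mP j := proj1 (hp_LP HP s j); have mQ j := proj1 (hp_LQ HP s j).
have mp := proj1 (hp_Lp HP s); have mq := proj1 (hp_Lq HP s).
have mAP j : meas (fun x => A j x + P s j x) by apply: measurable_funD (mP j); exact: (proj1 (LA j)).
have mBQ j : meas (fun x => B j x + Q s j x) by apply: measurable_funD (mQ j); exact: (proj1 (LB j)).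
have [[mal _] [mbe _]] := L2loc_solution s.
apply: ae_eq_int.
- exact: flux_meas te (measurable_funD mA mp) (measurable_funD mB mq) mAP mBQ.
- exact: flux_meas te mal mbe mAP mBQ.
- apply: filterS2 aeA aeB => x xA xB; apply: eq_bigr => j _.
  by rewrite -xA -xB re_split im_split.
Qed.

(** Compactness of [-T, T] in its near-covering form replaces the thresholds on l attached to the
    individual times by a single one. *)
Lemma mass_flux_small_on a (T e0 : R) : 0 < e0 ->
  \forall l \near pinfty_nbhs R, forall s, `|s| <= T -> `|mass_flux a l s| <= e0.
Proof.
move=> e0p.
have cT : compact `[- T, T]%classic by exact: segment_compact.
have := (compact_near_coveringP _).1 cT _ (pinfty_nbhs R) (fun l s => `|mass_flux a l s| <= e0) _
  (fun t _ => mass_flux_small a t e0p).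
move=> H; near=> l; move=> s sT.
have Hl : `[- T, T]%classic `<=` (fun s => `|mass_flux a l s| <= e0) by near: l; exact: H.
by apply: Hl; rewrite /= in_itv/= -ler_norml.
Unshelve. all: by end_near.
Qed.

(** The flux is at most d between times 0 and T, with |T| d <= e, so the mean value theorem applies;
    a negative T exchanges the end points. *)
Lemma mass_close a (T e : R) : 0 < e -> \forall l \near pinfty_nbhs R, `|mass a l T - mass a l 0| <= e.
Proof.
move=> e0.
have [d d0 Hd] := small_factor (normr_ge0 T) e0.
have := mass_flux_small_on a `|T| d0 => H.
near=> l.
have l0 : 0 < l by near: l; apply: nbhs_pinfty_gt; exact: num_real.
have Hl : forall s, `|s| <= `|T| -> `|mass_flux a l s| <= d by near: l; exact: H.
apply: le_trans Hd.
have der s : is_derive s (1 : R) (mass a l) (mass_flux a l s) := mass_is_derive a s l0.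
have cont : continuous (mass a l).
  by move=> s; apply: differentiable_continuous; apply/derivable1_diffP; have [] := der s.
have mvt (b c : R) : b <= c -> (forall s, b <= s <= c -> `|s| <= `|T|) ->
    `|mass a l c - mass a l b| <= d * `|c - b|.
  move=> bc sT.
  have [s] := @MVT_segment R (mass a l) (mass_flux a l) b c bc (fun s _ => der s)
    (continuous_subspaceT cont).
  rewrite in_itv/= => /sT sT' ->; rewrite normrM ler_wpM2r//; exact: Hl.
have [T0|T0] := leP 0 T.
  rewrite -{2}(subr0 T) [leRHS]mulrC; apply: mvt => // s /andP[s0 sT].
  by rewrite !ger0_norm.
rewrite distrC -[`|T|]normrN -(sub0r T) [leRHS]mulrC; apply: mvt; first exact: ltW.
move=> s /andP[Ts s0]; rewrite (ler0_norm s0) (ler0_norm (ltW T0)).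
by rewrite lerN2.
Unshelve. all: by end_near. Qed.

(** The integral of the cutoff does not depend on time, so differences of local masses are
    differences of [mass]. At a fixed radius all integrals are finite. *)
Lemma local_massE a l t : 0 < l -> local_mass chi (u t) a l =
  (\int[mu]_x chi (enorm (x - a) / l) - mass a l t)%:E.
Proof.
move=> l0; have te := radial_cutoff_rtest a hchi l0.
have [[_ l1] [_ l2]] := L2loc_solution t.
have I1 := rtest_intg te; have I2 : intg (fun x => (al t x ^+ 2 + be t x ^+ 2) * chi (enorm (x - a) / l)).
  have [[ma la] [mb lb]] := L2loc_solution t; exact: locint_mul_rtest (locintD la lb) te.
rewrite /mass -(intB I1 I2) -(intE (intgB I1 I2)); apply: eq_integral => x _.
by rewrite sqr_normcE mulrBl mul1r.
Qed.

End derivative.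

End evolution.

(** Shrinking each filter set to the points where the two functions are e-close gives one inequality
    up to e, and the hypothesis is symmetric. Real values are required eventually, while the upper
    limits may be infinite. *)
Lemma limf_esup_close (R : realType) (F : set_system R) {FF : Filter F}
    (f g : R -> \bar R) :
  (forall e : R, 0 < e -> \forall l \near F, exists r r' : R,
     [/\ f l = r%:E, g l = r'%:E & `|r - r'| <= e]) ->
  limf_esup f F = limf_esup g F.
Proof.
have le (f' g' : R -> \bar R) : (forall e : R, 0 < e -> \forall l \near F, exists r r' : R,
     [/\ f' l = r%:E, g' l = r'%:E & `|r - r'| <= e]) -> (limf_esup f' F <= limf_esup g' F)%E.
  move=> H; apply/lee_addgt0Pr => e e0; rewrite -leeBlDr//.
  apply: le_ereal_inf_tmp => _ [V FV <-]; rewrite leeBlDr//.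
  apply: (@le_trans _ _ (ereal_sup (f' @` (V `&` [set l | exists r r' : R,
     [/\ f' l = r%:E, g' l = r'%:E & `|r - r'| <= e]])))).
    apply: ereal_inf_lbound; exists (V `&` [set l | exists r r' : R,
     [/\ f' l = r%:E, g' l = r'%:E & `|r - r'| <= e]]) => //.
    exact: filterI FV (H e e0).
  apply: ge_ereal_sup => _ [l [Vl [r [r' [fr gr rr]]]] <-].
  apply: (@le_trans _ _ (g' l + e%:E)%E).
    rewrite fr gr -EFinD lee_fin -lerBlDl.
    exact: le_trans (ler_norm _) rr.
  by apply: leeD2r; apply: ereal_sup_ubound; exists l.
move=> H; apply/eqP; rewrite eq_le (le _ _ H)/=; apply: (le) => e e0.
apply: filterS (H e e0) => l [r [r' [h1 h2 h3]]]; exists r', r; split => //.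
by rewrite distrC.
Qed.

Lemma limf_einf_close (R : realType) (F : set_system R) {FF : Filter F}
    (f g : R -> \bar R) :
  (forall e : R, 0 < e -> \forall l \near F, exists r r' : R,
     [/\ f l = r%:E, g l = r'%:E & `|r - r'| <= e]) ->
  limf_einf f F = limf_einf g F.
Proof.
move=> H; rewrite /limf_einf (@limf_esup_close _ F _ (\- f)%E (\- g)%E)// => e e0.
apply: filterS (H e e0) => l [r [r' [-> -> h3]]]; exists (- r), (- r'); split => //.
by rewrite -opprD normrN.
Qed.

Lemma eq_local_mass (R : realType) (N : nat) (K : R) (chi : R -> R) (f g : 'rV[R]_N -> R[i]) a l :
  cutoff K chi -> 0 < l -> cmeasurable f -> cmeasurable g ->
  {ae leb N : {measure set 'rV[R]_N -> \bar R}, forall x, f x = g x} ->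
  local_mass chi f a l = local_mass chi g a l.
Proof.
move=> hchi l0 mf mg fg; rewrite /local_mass.
have me := smooth_meas (proj1 (radial_cutoff_rtest a hchi l0)).
have mk h : cmeasurable h -> measurable_fun setT
    (fun x : 'rV[R]_N => ((1 - Normc.normc (h x) ^+ 2) * chi (enorm (x - a) / l))%:E).
  move=> mh; apply/measurable_EFinP; apply: measurable_funM => //.
  by apply: measurable_funB; [exact: measurable_cst|exact: normc_sqr_meas].
apply: ae_eq_integral => //; [exact: mk|exact: mk|].
by apply: filterS fg => x -> _.
Qed.

Unset Implicit Arguments.

Theorem theorem1p9 (R : realType) (N : nat) (hN : (1 <= N <= 4)%N)
  (K : R) (chi : R -> R) (hchi : cutoff K chi)
  (phi : 'rV[R]_N -> R[i]) (hphi : reference_function phi)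
  (hphi_grad : (3 <= N <= 4)%N ->
     grad_in_Lp (N%:R / (N%:R - 1))%:E phi)
  (W : ('rV[R]_N -> R[i]) -> R[i])
  (hW_real : real_distr W) (hW_even : even_distr W) (hW : condition_W W)
  (hW_abc : [\/ (2 <= N)%N /\ positive_definite_distr W,
                multiplier 1 1 W /\ positive_distr W |
                ess_inf_fourier_pos W])
  (u0 : 'rV[R]_N -> R[i]) (hu0 : sobolev 1 2%:E (fun x => u0 x - phi x))
  (m : R) (hm : generalized_mass chi u0 m%:E)
  (u : R -> 'rV[R]_N -> R[i]) (hu : NGP_solution W phi u0 u) :
  forall t : R, generalized_mass chi (u t) m%:E.
Proof.
move=> t.
have [_ chi1 chi0 _ _] := hchi.
(* The cutoff defining the mass also serves as the profile of the mollifiers. *)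
have [rho Hrho] := @mollifier_exists R N chi (cutoff_smooth1 hchi) chi1 chi0.
have [A [B [M Hphi]]] := reference_gradientP Hrho hN hphi hphi_grad.
have mW : multiplier 2 2 W.
  by have [? [? [? [? [? [? [? [? [? [? [_ _ _ [H _ _ _ _] _]]]]]]]]]]] := hW.
have [v [Hw Hv ae0 eqn]] := hu.
have [P [Q HP]] := H1_continuous_path Hrho Hw.
have /andP[_ N4] := hN.
have mphi : cmeasurable phi := conj (rg_measRe Hphi) (rg_measIm Hphi).
have mw s : cmeasurable (fun x => u s x - phi x).
  exact: conj (proj1 (hp_Lp HP s)) (proj1 (hp_Lq HP s)).
have mu0 : cmeasurable u0.
  have [[m0 _] _] := hu0; have := cmeasD m0 mphi.
  by congr cmeasurable; apply/funext => x; rewrite subrK.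
have mu_ s : cmeasurable (u s).
  by have := cmeasD (mw s) mphi; congr cmeasurable; apply/funext => x; rewrite subrK.
have close a (e : R) : 0 < e -> \forall l \near pinfty_nbhs R, exists r r' : R,
    [/\ local_mass chi (u t) a l = r%:E, local_mass chi u0 a l = r'%:E & `|r - r'| <= e].
  move=> e0.
  have H := mass_close Hrho hchi hW_real mW Hv eqn Hphi HP N4 a t e0.
  near=> l.
  have l0 : 0 < l by near: l; apply: nbhs_pinfty_gt; exact: num_real.
  (* The initial condition holds almost everywhere, so [u0] is replaced by [u 0] under the
     integral. *)
  rewrite -(eq_local_mass a hchi l0 (mu_ 0) mu0 ae0).
  rewrite !(local_massE hchi Hphi HP)//.
  eexists; eexists; split; [reflexivity|reflexivity|].
  rewrite opprB addrC addrA subrK distrC.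
  by near: l; exact: H.
have sup_eq : (fun a => limf_esup (local_mass chi (u t) a) (pinfty_nbhs R)) =
    fun a => limf_esup (local_mass chi u0 a) (pinfty_nbhs R).
  by apply/funext => a; exact: (@limf_esup_close R (pinfty_nbhs R) _ _ _ (close a)).
have inf_eq : (fun a => limf_einf (local_mass chi (u t) a) (pinfty_nbhs R)) =
    fun a => limf_einf (local_mass chi u0 a) (pinfty_nbhs R).
  by apply/funext => a; exact: (@limf_einf_close R (pinfty_nbhs R) _ _ _ (close a)).
have [m_sup m_inf] := hm.
split; first exact: (etrans (congr1 (fun F => ereal_inf (range F)) sup_eq) m_sup).
exact: (etrans (congr1 (fun F => ereal_sup (range F)) inf_eq) m_inf).
Unshelve. all: by end_near. Qed.
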